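(* In the interactive effects panel model described in the context, let $q=1$, so that $\boldsymbol{\Lambda}_0'=(1,\boldsymbol{\lambda}_0')$. Assume: (A1) the vectors $\boldsymbol{v}_i := (\boldsymbol{z}_i',\boldsymbol{a}_i',\boldsymbol{\epsilon}_i')'$ $(i=1,\ldots,n)$ are independently and identically distributed; (A2$^*$) the entries in $\boldsymbol{v}_i$ have finite fourth moments; (A3) $E(\boldsymbol{z}_1\boldsymbol{\epsilon}_1')=\boldsymbol{0}$; (A4) $\mathrm{Var}(\boldsymbol{z}_1)$ is positive definite; (A5) for each $\boldsymbol{\psi}\in\boldsymbol{\Psi}$ with $\boldsymbol{\psi}\neq\boldsymbol{\psi}_0$ there is at least one $t\in\{1,\ldots,T\}$ such that $\boldsymbol{\pi}_t(\boldsymbol{\psi})\neq\boldsymbol{\pi}_t(\boldsymbol{\psi}_0)$. Let $\widehat{\boldsymbol{\beta}}$ be the subvector of $\widehat{\boldsymbol{\psi}}$ consisting of its first $K$ entries (the estimator of $\boldsymbol{\beta}_0$), and let $\boldsymbol{C}:=(\boldsymbol{I}_K\ \ \boldsymbol{0}\ \ -\boldsymbol{I}_K)$ be the $K\times(p+K)$ matrix such that $\boldsymbol{C}(\widehat{\boldsymbol{\psi}}',\widehat{\boldsymbol{\beta}}_{FE}')'=\widehat{\boldsymbol{\beta}}-\widehat{\boldsymbol{\beta}}_{FE}$. If (A) $\boldsymbol{\Lambda}_0=\boldsymbol{\iota}_T$ is true, or (B) $\boldsymbol{\Phi}_{0t}^{x}=\boldsymbol{\Phi}_0^{x}$ for all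 $t$ (i.e. $\boldsymbol{\Phi}_{0t}^{x}$ does not depend on $t$) is true, or both (A) and (B) are true, then the random variable $$\vartheta_n:=n\left(\widehat{\boldsymbol{\beta}}-\widehat{\boldsymbol{\beta}}_{FE}\right)'\left(\boldsymbol{C}(\boldsymbol{H}_0^{+})^{-1}\boldsymbol{A}_0^{+}(\boldsymbol{H}_0^{+})^{-1}\boldsymbol{C}'\right)^{-1}\left(\widehat{\boldsymbol{\beta}}-\widehat{\boldsymbol{\beta}}_{FE}\right)$$ converges in distribution, as $n\to\infty$ with $T$ fixed, to a chi-square distribution with $K$ degrees of freedom.
   Context: Model (case $q=1$). For individuals $i=1,\ldots,n$ and periods $t=1,\ldots,T$ ($T\geq 2$), $$\boldsymbol{y}_i=\boldsymbol{X}_i\boldsymbol{\beta}_0+\boldsymbol{\delta}_0+\boldsymbol{\Phi}_0\widetilde{\eta}_i+\boldsymbol{\epsilon}_i,$$ where $\boldsymbol{y}_i=(y_{i1},\ldots,y_{iT})'$, $\boldsymbol{X}_i$ is the $T\times K$ random matrix with $t$th row $\boldsymbol{x}_{it}'$, $\boldsymbol{\beta}_0\in\mathbb{R}^K$ and $\boldsymbol{\delta}_0\in\mathbb{R}^T$ are fixed parameters, $\boldsymbol{\Phi}_0=(\phi_{01},\ldots,\phi_{0T})'$ is a fixed $T\times 1$ vector with $\phi_{01}\ne0$, $\widetilde{\eta}_i$ is an unobserved scalar random variable with $E(\widetilde{\eta}_i)=0$ and nonzero variance, and $\boldsymbol{\epsilon}_i=(\epsilon_{i1},\ldots,\epsilon_{iT})'$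 is an unobserved error vector. Standing assumption: $E(\epsilon_{it}\mid\boldsymbol{x}_{it},\delta_{0t},\phi_{0t}\widetilde{\eta}_i)=0$ (so $E(\boldsymbol{\epsilon}_i)=\boldsymbol{0}$). Put $\eta_i:=\phi_{01}\widetilde{\eta}_i$, $\boldsymbol{\lambda}_0:=(\phi_{02},\ldots,\phi_{0T})'/\phi_{01}$, $\boldsymbol{\Lambda}_0':=(1,\boldsymbol{\lambda}_0')$, so $\boldsymbol{\Lambda}_0\eta_i=\boldsymbol{\Phi}_0\widetilde{\eta}_i$. $\boldsymbol{\iota}_T$ is the $T\times1$ vector of ones. Factor loadings of the regressors. $\boldsymbol{\Phi}_{0t}^{x}:=\mathrm{Var}(\widetilde{\eta}_i)^{-1}\mathrm{Cov}(\widetilde{\eta}_i,\boldsymbol{x}_{it})$ (a $1\times K$ row), so that $\boldsymbol{x}_{it}=\boldsymbol{\delta}_{0t}^{x}+\boldsymbol{\Phi}_{0t}^{x\prime}\widetilde{\eta}_i+\boldsymbol{\epsilon}_{it}^{x}$ with $\boldsymbol{\delta}_{0t}^x = E(\boldsymbol{x}_{it})$ and $E(\widetilde{\eta}_i\boldsymbol{\epsilon}_{it}^{x\prime})=\boldsymbol{0}$. Projection. $\boldsymbol{z}_i$ is the $m\times1$ vector of all distinct entries of $(\boldsymbol{x}_{i1}',\ldots,\boldsymbol{x}_{iT}')'$ (with further entries removed, if needed, until $E(\boldsymbol{z}_i\boldsymbol{z}_i')$ has full rank). Thus for each $t$ there is a constant $m\times K$ matrix $\boldsymbol{S}_t$ (a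 0/1 selection matrix when every entry of $\boldsymbol{x}_{it}$ is an entry of $\boldsymbol{z}_i$) such that, after subtracting means from both sides, $\boldsymbol{x}_{it}$ equals $\boldsymbol{S}_t'\boldsymbol{z}_i$. The linear projection of $\eta_i$ on $1$ and $\boldsymbol{z}_i$ is $\eta_i=\mu_0+\boldsymbol{z}_i'\boldsymbol{\theta}_0+a_i$, with $\boldsymbol{\theta}_0=\mathrm{Var}(\boldsymbol{z}_i)^{-1}\mathrm{Cov}(\boldsymbol{z}_i,\eta_i)$ and $\mu_0=-E(\boldsymbol{z}_i')\boldsymbol{\theta}_0$; so $a_i$ has mean zero and is uncorrelated with $\boldsymbol{z}_i$. Write $\boldsymbol{a}_i=a_i$, $\boldsymbol{u}_i=\boldsymbol{\Lambda}_0a_i+\boldsymbol{\epsilon}_i$, and $\boldsymbol{\psi}_0=(\boldsymbol{\beta}_0',\boldsymbol{\theta}_0',\boldsymbol{\lambda}_0')'$. Estimators. A generic parameter is $\boldsymbol{\psi}=(\boldsymbol{\beta}',\boldsymbol{\theta}',\boldsymbol{\lambda}')'\in\boldsymbol{\Psi}\subseteq\mathbb{R}^p$, $p=K+m+T-1$, with $\boldsymbol{\beta}\in\mathbb{R}^K$, $\boldsymbol{\theta}\in\mathbb{R}^m$, $\boldsymbol{\lambda}=(\lambda_2,\ldots,\lambda_T)'$, $\lambda_1:=1$, $\boldsymbol{\Lambda}'=(1,\boldsymbol{\lambda}')$; $\boldsymbol{\psi}_0\in\boldsymbol{\Psi}$. A dot denotes cross-sectional demeaning, e.g. $\dot{\boldsymbol{X}}_i=\boldsymbol{X}_i-\frac1n\sum_{j=1}^n\boldsymbol{X}_j$,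 and likewise $\dot{\boldsymbol{y}}_i,\dot{\boldsymbol{z}}_i$. $\widehat{\boldsymbol{\psi}}$ is the (measurable) minimizer, over a compact set $\overline{\boldsymbol{\Psi}}\subseteq\boldsymbol{\Psi}$ with $\boldsymbol{\psi}_0$ in its interior, of $$S_n(\boldsymbol{\psi})=\frac1{2n}\sum_{i=1}^n\left\|\dot{\boldsymbol{y}}_i-\dot{\boldsymbol{X}}_i\boldsymbol{\beta}-\boldsymbol{\Lambda}\dot{\boldsymbol{z}}_i'\boldsymbol{\theta}\right\|^2=\frac1{2n}\sum_{i=1}^n\sum_{t=1}^T\left(\dot y_{it}-\dot{\boldsymbol{z}}_i'\boldsymbol{\pi}_t(\boldsymbol{\psi})\right)^2,\qquad \boldsymbol{\pi}_t(\boldsymbol{\psi}):=\boldsymbol{S}_t\boldsymbol{\beta}+\lambda_t\boldsymbol{\theta}.$$ The two-way fixed effects (TWFE) estimator is $\widehat{\boldsymbol{\beta}}_{FE}=\left(\sum_i\dot{\boldsymbol{X}}_i'\boldsymbol{Q}\dot{\boldsymbol{X}}_i\right)^{-1}\sum_i\dot{\boldsymbol{X}}_i'\boldsymbol{Q}\dot{\boldsymbol{y}}_i$ with $\boldsymbol{Q}:=\boldsymbol{I}_T-\boldsymbol{\iota}_T(\boldsymbol{\iota}_T'\boldsymbol{\iota}_T)^{-1}\boldsymbol{\iota}_T'$. It is implicit that $E(\boldsymbol{X}_1^{*\prime}\boldsymbol{Q}\boldsymbol{X}_1^{*})$ is nonsingular and that the matrix $\boldsymbol{C}(\boldsymbol{H}_0^{+})^{-1}\boldsymbol{A}_0^{+}(\boldsymbol{H}_0^{+})^{-1}\boldsymbol{C}'$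 inverted in $\vartheta_n$ is nonsingular. Other notation. $\boldsymbol{X}_i^{*}:=\boldsymbol{X}_i-E(\boldsymbol{X}_1)$, $\boldsymbol{y}_i^{*}:=\boldsymbol{y}_i-E(\boldsymbol{y}_1)$. With $\boldsymbol{X}_{2i}$ the last $T-1$ rows of $\boldsymbol{X}_i$, $$\boldsymbol{R}_i:=\begin{pmatrix}\boldsymbol{x}_{i1}'&\boldsymbol{z}_i'&\boldsymbol{0}\\ \boldsymbol{X}_{2i}&\boldsymbol{\lambda}_0\boldsymbol{z}_i'&(\boldsymbol{z}_i'\boldsymbol{\theta}_0)\boldsymbol{I}_{T-1}\end{pmatrix}\ (T\times p),\qquad \boldsymbol{R}_i^{*}:=\boldsymbol{R}_i-E(\boldsymbol{R}_1),$$ $\boldsymbol{R}_i^{+}:=\mathrm{diag}(\boldsymbol{R}_i^{*},\boldsymbol{Q}\boldsymbol{X}_i^{*})$ (block diagonal), $\boldsymbol{u}_i^{+\prime}:=(\boldsymbol{u}_i',(\boldsymbol{y}_i^{*}-\boldsymbol{X}_i^{*}\boldsymbol{\beta}_0)')$, $\boldsymbol{H}_0^{+}:=E(\boldsymbol{R}_1^{+\prime}\boldsymbol{R}_1^{+})$, $\boldsymbol{A}_0^{+}:=E(\boldsymbol{R}_1^{+\prime}\boldsymbol{u}_1^{+}\boldsymbol{u}_1^{+\prime}\boldsymbol{R}_1^{+})$. *)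

(* Defs.v *)
From HB Require Import structures.
From mathcomp Require Import all_boot all_order all_algebra finmap.
From mathcomp Require Import all_classical all_reals all_analysis.
From mathcomp Require Import measurable_realfun.

Set Implicit Arguments.
Unset Strict Implicit.
Unset Printing Implicit Defensive.

Import Order.TTheory GRing.Theory Num.Theory.
Import numFieldNormedType.Exports.

Local Open Scope classical_set_scope.
Local Open Scope ring_scope.

Section random_matrices.
Context {d : measure_display} {Omega : measurableType d} {R : realType}.
Variable P : probability Omega R.

Definition measurable_mx m n (A : Omega -> 'M[R]_(m, n)) : Prop :=
  forall i j, measurable_fun [set: Omega] (fun w => A w i j).

(* Entrywise expectation; [fine] is harmless whenever the entries are
   integrable. *)
Definition Emx m n (A : Omega -> 'M[R]_(m, n)) : 'M[R]_(m, n) :=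
  \matrix_(i, j) fine ('E_P[fun w => A w i j])%E.

Definition Covmx m n (U : Omega -> 'cV[R]_m) (V : Omega -> 'cV[R]_n) :
    'M[R]_(m, n) :=
  \matrix_(i, j) fine (covariance P (fun w => U w i 0) (fun w => V w j 0)).

Definition Varmx m (U : Omega -> 'cV[R]_m) : 'M[R]_m := Covmx U U.

(* The library puts the Borel sigma-algebra on tuples, not on matrices. *)
Definition tuple_of_cV n (v : 'cV[R]_n) : n.-tuple R := [tuple v i 0 | i < n].

Definition mutually_independent n (V : nat -> Omega -> 'cV[R]_n) : Prop :=
  forall (J : {fset nat}) (B : nat -> set (n.-tuple R)),
    (forall i, measurable (B i)) ->
    P (\bigcap_(i in [set` J]) [set w | B i (tuple_of_cV (V i w))]) =
    (\prod_(i <- J) P [set w | B i (tuple_of_cV (V i w))])%E.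

Definition identically_distributed n (V : nat -> Omega -> 'cV[R]_n) : Prop :=
  forall (i j : nat) (B : set (n.-tuple R)), measurable B ->
    P [set w | B (tuple_of_cV (V i w))] = P [set w | B (tuple_of_cV (V j w))].

(* E(e | W) = 0: e is integrable and integrates to 0 over every event of the
   sigma-algebra generated by W. *)
Definition cond_mean0 n (e : Omega -> R) (W : Omega -> 'cV[R]_n) : Prop :=
  P.-integrable [set: Omega] (EFin \o e) /\
  forall B : set (n.-tuple R), measurable B ->
    (\int[P]_(w in [set w | B (tuple_of_cV (W w))]) (e w)%:E = 0)%E.

(* Convergence of the distribution functions at every continuity point of the
   limit law. *)
Definition converges_in_distribution (Y : nat -> Omega -> R)
    (mu : probability R R) : Prop :=
  (forall n, measurable_fun [set: Omega] (Y n)) /\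
  forall x : R, mu [set x] = 0%E ->
    P [set w | Y n w <= x] @[n --> \oo] --> mu [set y : R | y <= x].

End random_matrices.

Definition posdefmx (R : realType) n (A : 'M[R]_n) : Prop :=
  A^T = A /\ forall c : 'cV[R]_n, c != 0 -> 0 < (c^T *m A *m c) 0 0.

Section chi_square.
Context {R : realType}.

(* [normal_prob] lives on [measurableTypeR R]: the Borel sets of R under another
   display. *)
Definition add_square (xy : measurableTypeR R * R) : R := xy.1 ^+ 2 + xy.2.

Lemma measurable_add_square :
  measurable_fun [set: measurableTypeR R * R] add_square.
Proof.
apply: measurable_funD; last exact: measurable_snd.
by apply: measurable_funX; exact: measurable_fst.
Qed.

HB.instance Definition _ :=
  isMeasurableFun.Build _ _ _ _ add_square measurable_add_square.

(* The law of the sum of the squares of k independent N(0,1) variables: the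
   product measure makes the new variable independent of the previous sum. *)
Fixpoint chi_square (k : nat) : probability R R :=
  if k is k'.+1 then
    distribution (normal_prob 0 1 \x chi_square k')%E add_square
  else dirac (0 : R).

End chi_square.

(* The primitives of the model with 1 + T1 periods; individual i of the text
   is individual i.-1 here, so individual 0 plays the role of the subscript 1
   in E(X_1), etc. *)
Record panel d (Omega : measurableType d) (R : realType) (T1 K m : nat) := Panel
  { regr : nat -> Omega -> 'M[R]_(1 + T1, K)
  ; effect : nat -> Omega -> R
  ; error : nat -> Omega -> 'cV[R]_(1 + T1)
  ; zvec : nat -> Omega -> 'cV[R]_m
  ; beta0 : 'cV[R]_K
  ; delta0 : 'cV[R]_(1 + T1)
  ; Phi0 : 'cV[R]_(1 + T1) }.

Section model.
Context {d : measure_display} {Omega : measurableType d} {R : realType}.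
Context {T1 K m : nat}.
Variables (P : probability Omega R) (M : panel Omega R T1 K m).
Local Notation T := (1 + T1)%N.
Local Notation p := (K + (m + T1))%N.

Definition outcome (i : nat) (w : Omega) : 'cV[R]_T :=
  regr M i w *m beta0 M + delta0 M + effect M i w *: Phi0 M + error M i w.

Definition xvec (t : 'I_T) (i : nat) (w : Omega) : 'cV[R]_K :=
  (row t (regr M i w))^T.

Definition phi01 : R := Phi0 M (lshift T1 0) 0.

Definition eta (i : nat) (w : Omega) : R := phi01 * effect M i w.

Definition lambda0 : 'cV[R]_T1 := phi01^-1 *: dsubmx (Phi0 M).

Definition Lambda_of (l : 'cV[R]_T1) : 'cV[R]_T := col_mx 1%:M l.

Definition Lambda0 : 'cV[R]_T := Lambda_of lambda0.

Definition iota_T : 'cV[R]_T := const_mx 1.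

Definition Phi_x (t : 'I_T) : 'rV[R]_K :=
  (fine ('V_P[effect M 0])%E)^-1 *:
    Covmx P (fun w => (effect M 0 w)%:M : 'cV[R]_1) (xvec t 0).

Definition theta0 : 'cV[R]_m :=
  invmx (Varmx P (zvec M 0)) *m
    Covmx P (zvec M 0) (fun w => (eta 0 w)%:M : 'cV[R]_1).

Definition mu0 : R := - ((Emx P (zvec M 0))^T *m theta0) 0 0.

Definition proj_error (i : nat) (w : Omega) : R :=
  eta i w - mu0 - ((zvec M i w)^T *m theta0) 0 0.

Definition vvec (i : nat) (w : Omega) : 'cV[R]_(m + (1 + T)) :=
  col_mx (zvec M i w) (col_mx (proj_error i w)%:M (error M i w)).

Definition uvec (i : nat) (w : Omega) : 'cV[R]_T :=
  proj_error i w *: Lambda0 + error M i w.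

Definition psi_beta (psi : 'cV[R]_p) : 'cV[R]_K := usubmx psi.
Definition psi_theta (psi : 'cV[R]_p) : 'cV[R]_m := usubmx (dsubmx psi).
Definition psi_lambda (psi : 'cV[R]_p) : 'cV[R]_T1 := dsubmx (dsubmx psi).

Definition psi0 : 'cV[R]_p := col_mx (beta0 M) (col_mx theta0 lambda0).

Definition pi_t (S : 'I_T -> 'M[R]_(m, K)) (t : 'I_T) (psi : 'cV[R]_p) :
    'cV[R]_m :=
  S t *m psi_beta psi + Lambda_of (psi_lambda psi) t 0 *: psi_theta psi.

Definition demean (n : nat) a b (A : nat -> Omega -> 'M[R]_(a, b)) (i : nat)
    (w : Omega) : 'M[R]_(a, b) :=
  A i w - n%:R^-1 *: \sum_(j < n) A j w.

(* The library norm on matrices is the max norm. *)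
Definition sqnorm a (v : 'cV[R]_a) : R := \sum_(t < a) v t 0 ^+ 2.

Definition objective (n : nat) (w : Omega) (psi : 'cV[R]_p) : R :=
  (2 * n%:R)^-1 * \sum_(i < n)
    sqnorm (demean n outcome i w - demean n (regr M) i w *m psi_beta psi
            - Lambda_of (psi_lambda psi)
                *m ((demean n (zvec M) i w)^T *m psi_theta psi)).

Definition Qmx : 'M[R]_T :=
  1%:M - iota_T *m invmx (iota_T^T *m iota_T) *m iota_T^T.

Definition beta_FE (n : nat) (w : Omega) : 'cV[R]_K :=
  invmx (\sum_(i < n) (demean n (regr M) i w)^T *m Qmx *m demean n (regr M) i w)
    *m \sum_(i < n) (demean n (regr M) i w)^T *m Qmx *m demean n outcome i w.

Definition Xstar (i : nat) (w : Omega) : 'M[R]_(T, K) :=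
  regr M i w - Emx P (regr M 0).

Definition ystar (i : nat) (w : Omega) : 'cV[R]_T :=
  outcome i w - Emx P (outcome 0).

Definition Rmx (i : nat) (w : Omega) : 'M[R]_(T, p) :=
  block_mx (usubmx (regr M i w)) (row_mx (zvec M i w)^T 0)
           (dsubmx (regr M i w)) (row_mx (lambda0 *m (zvec M i w)^T)
                                    (((zvec M i w)^T *m theta0) 0 0)%:M).

Definition Rstar (i : nat) (w : Omega) : 'M[R]_(T, p) :=
  Rmx i w - Emx P (Rmx 0).

Definition Rplus (i : nat) (w : Omega) : 'M[R]_(T + T, p + K) :=
  block_mx (Rstar i w) 0 0 (Qmx *m Xstar i w).

Definition uplus (i : nat) (w : Omega) : 'cV[R]_(T + T) :=
  col_mx (uvec i w) (ystar i w - Xstar i w *m beta0 M).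

Definition H0plus : 'M[R]_(p + K) :=
  Emx P (fun w => (Rplus 0 w)^T *m Rplus 0 w).

Definition A0plus : 'M[R]_(p + K) :=
  Emx P (fun w => (Rplus 0 w)^T *m uplus 0 w *m (uplus 0 w)^T *m Rplus 0 w).

Definition Cmx : 'M[R]_(K, p + K) := row_mx (row_mx 1%:M 0) (- 1%:M).

Definition Vdiff : 'M[R]_K :=
  Cmx *m invmx H0plus *m A0plus *m invmx H0plus *m Cmx^T.

Definition is_estimator (Psibar : set 'cV[R]_p)
    (psihat : nat -> Omega -> 'cV[R]_p) : Prop :=
  forall n, measurable_mx (psihat n) /\
    ((0 < n)%N -> forall w, Psibar (psihat n w) /\
       forall psi, Psibar psi -> objective n w (psihat n w) <= objective n w psi).

Definition vartheta (psihat : nat -> Omega -> 'cV[R]_p) (n : nat) (w : Omega) :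
    R :=
  let b := psi_beta (psihat n w) - beta_FE n w in
  n%:R * (b^T *m invmx Vdiff *m b) 0 0.

End model.

(* Main.v *)
From mathcomp Require Import all_boot all_order all_algebra finmap.
From mathcomp Require Import all_classical all_reals all_analysis.
From mathcomp Require Import measurable_realfun.
From mathcomp Require Import ring lra.
Require Import Defs.

(** Both estimators are functions of the demeaned second moments Z of z_i and
   (z_i, u_i). Condition (A) or (B) makes the population within equation hold at
   beta0, so that the two estimators differ, up to O(n^-3/4), by the linear map
   C (H0+)^-1 applied to the sample mean of R_i+' u_i+. For the nonlinear
   estimator this follows, without first-order conditions, by comparing the
   minimiser with the one-step candidate psi0 + H0^-1 score; every estimate is
   deterministic on an event of large probability given by Chebyshev.

   It remains to find the limit law of a positive quadratic form q in a
   normalised i.i.d. sum. Replacing the summands one at a time along the solution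
   (1 + 2 s t)^(-K/2) exp (- s q / (1 + 2 s t)) of the heat equation gives the
   limit (1 + 2 s)^(-K/2) of the Laplace transform, which is that of the
   chi-square law. Its values at the natural numbers are the moments of
   exp (- theta) in [0, 1], so Bernstein polynomials turn their convergence into
   the convergence of the distribution functions. *)

Set Implicit Arguments.
Unset Strict Implicit.
Unset Printing Implicit Defensive.

Import Order.TTheory GRing.Theory Num.Theory.
Import numFieldNormedType.Exports.

Local Open Scope classical_set_scope.
Local Open Scope ring_scope.

(** * Moments and independence *)

(** The entries of v_i have four moments, so the summands of the linearised difference, quadratic in
    v_i, have only two. This is why the remainder of one replacement is min(r^2, r^3) and is handled
    by dominated convergence. The test function exp(- s q) is chosen because its heat flow is
    explicit: no Gaussian vector and no characteristic function is ever introduced.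

    The one-step comparison bounds the square of the error by r^3 with r = n^(-1/2). This is weaker
    than the usual error of order 1/n, but it is o(n^(-1/2)), and the criterion, a polynomial in
    psi, is only expanded, never differentiated.

    The population within equation is sum_(s,t) Q_st Lambda_t S_s' Var(z) theta = 0. Under (A),
    Lambda_t is constant in t and the rows of Q sum to 0; under (B), S_s' Var(z) theta = Cov(x_s,
    eta) is constant in s and the columns of Q sum to 0.

    The i.i.d. hypothesis concerns v_i only, whereas x_it is a function of z_i only up to a null
    set. All statistics are therefore rewritten in z_i and u_i on a single event of probability
    one. *)

Section moments.
Context {d : measure_display} {T : measurableType d} {R : realType}.
Variable P : probability T R.

(** Membership in L^k. Measurability is bundled in, so that later integrability claims reduce to
    closure rules. *)
Definition moment (k : nat) (X : T -> R) : Prop :=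
  measurable_fun setT X /\
  P.-integrable setT (EFin \o (fun w => `|X w| ^+ k)).

Lemma moment_measurable k X : moment k X -> measurable_fun setT X.
Proof. by case. Qed.

Lemma rintegrable_le (X Y : T -> R) : measurable_fun setT X ->
  P.-integrable setT (EFin \o Y) -> (forall w, `|X w| <= Y w) ->
  P.-integrable setT (EFin \o X).
Proof.
move=> mX iY XY; apply: (le_integrable _ _ _ iY) => //.
- exact/measurable_EFinP.
- move=> w _ /=; rewrite lee_fin (le_trans (XY w))// ler_norm//.
Qed.

Lemma rintegrable_cst (c : R) : P.-integrable setT (EFin \o (fun=> c)).
Proof.
exact: finite_measure_integrable_cst.
Qed.

Lemma measurable_normX (k : nat) (X : T -> R) : measurable_fun setT X ->
  measurable_fun setT (fun w => `|X w| ^+ k).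
Proof.
move=> mX; apply: measurable_funX; exact: measurableT_comp.
Qed.

Lemma moment_le k (X Y : T -> R) : measurable_fun setT X -> moment k Y ->
  (forall w, `|X w| <= `|Y w|) -> moment k X.
Proof.
move=> mX [mY iY] XY; split=> //.
apply: (rintegrable_le _ iY); first exact: measurable_normX.
by move=> w; rewrite ger0_norm ?exprn_ge0// lerXn2r ?nnegrE.
Qed.

Lemma moment_cst k c : moment k (fun=> c).
Proof. by split=> //; exact: (rintegrable_cst (`|c| ^+ k)). Qed.

Lemma normrXD_le (x y : R) k : `|x + y| ^+ k <= 2 ^+ k * (`|x| ^+ k + `|y| ^+ k).
Proof.
wlog xy : x y / `|x| <= `|y|.
  move=> h; case: (leP `|x| `|y|) => [/h//|/ltW/h].
  by rewrite addrC [in X in _ * X]addrC.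
apply: (@le_trans _ _ ((2 * `|y|) ^+ k)).
  rewrite lerXn2r ?nnegrE ?mulr_ge0//.
  by rewrite (le_trans (ler_normD _ _))// mulr_natl mulr2n lerD2r.
by rewrite exprMn ler_wpM2l ?exprn_ge0// lerDr exprn_ge0.
Qed.

Lemma rintegrableD (X Y : T -> R) : P.-integrable setT (EFin \o X) ->
  P.-integrable setT (EFin \o Y) -> P.-integrable setT (EFin \o (fun w => X w + Y w)).
Proof. by move=> iX iY; exact: (integrableD measurableT iX iY). Qed.

Lemma rintegrableZ (c : R) (X : T -> R) : P.-integrable setT (EFin \o X) ->
  P.-integrable setT (EFin \o (fun w => c * X w)).
Proof. by move=> iX; exact: (integrableZl measurableT c iX). Qed.

Lemma rintegrableN (X : T -> R) : P.-integrable setT (EFin \o X) ->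
  P.-integrable setT (EFin \o (fun w => - X w)).
Proof. by move=> iX; exact: (integrableN iX). Qed.

Lemma rintegrableB (X Y : T -> R) : P.-integrable setT (EFin \o X) ->
  P.-integrable setT (EFin \o Y) -> P.-integrable setT (EFin \o (fun w => X w - Y w)).
Proof. by move=> iX iY; exact: (integrableB measurableT iX iY). Qed.

Lemma momentD k X Y : moment k X -> moment k Y -> moment k (fun w => X w + Y w).
Proof.
move=> [mX iX] [mY iY]; split; first exact: measurable_funD.
apply: (@rintegrable_le _ (fun w => 2 ^+ k * (`|X w| ^+ k + `|Y w| ^+ k))).
- by apply: measurable_normX; exact: measurable_funD.
- by apply: rintegrableZ; exact: rintegrableD.
- by move=> w; rewrite ger0_norm ?exprn_ge0// normrXD_le.
Qed.

Lemma momentZ k c X : moment k X -> moment k (fun w => c * X w).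
Proof.
move=> [mX iX]; split; first exact: measurable_funM.
have := rintegrableZ (`|c| ^+ k) iX.
by congr (_.-integrable _ _); apply/funext => w /=; rewrite -exprMn -normrM.
Qed.

Lemma momentB k X Y : moment k X -> moment k Y -> moment k (fun w => X w - Y w).
Proof.
move=> mX /(momentZ (-1)) /(momentD mX).
by congr moment; apply/funext => w; rewrite mulN1r.
Qed.

Lemma moment_sum k (I : Type) (r : seq I) (Q : pred I) (X : I -> T -> R) :
  (forall i, Q i -> moment k (X i)) -> moment k (fun w => \sum_(i <- r | Q i) X i w).
Proof.
move=> h; elim: r => [|i r IH].
  under eq_fun do rewrite big_nil; exact: moment_cst.
under eq_fun do rewrite big_cons.
by case: (boolP (Q i)) => // Qi; exact: momentD (h _ Qi) IH.
Qed.

(** From ab <= a^2 + b^2 with a = |X|^k and b = |Y|^k. The form [k + k] matches the uses 4 = 2 + 2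
    and 2 = 1 + 1 by computation. *)
Lemma momentM k X Y : moment (k + k) X -> moment (k + k) Y ->
  moment k (fun w => X w * Y w).
Proof.
move=> [mX iX] [mY iY]; split; first exact: measurable_funM.
apply: (rintegrable_le _ (rintegrableD iX iY)).
  by apply: measurable_normX; exact: measurable_funM.
move=> w; rewrite ger0_norm ?exprn_ge0// normrM exprMn.
set a := `|X w| ^+ k; set b := `|Y w| ^+ k; rewrite !exprD -/a -/b.
have : 0 <= (a - b) ^+ 2 + (a ^+ 2 + b ^+ 2) by rewrite !addr_ge0 ?sqr_ge0.
by rewrite -!expr2; nra.
Qed.

Lemma moment_leq j k X : (j <= k)%N -> moment k X -> moment j X.
Proof.
move=> jk [mX iX]; split=> //.
apply: (rintegrable_le _ (rintegrableD (rintegrable_cst 1) iX)).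
  exact: measurable_normX.
move=> w; rewrite ger0_norm ?exprn_ge0//.
have [x1|x1] := leP `|X w| 1.
  by rewrite (@le_trans _ _ 1) ?exprn_ile1// lerDl exprn_ge0.
by rewrite (@le_trans _ _ (`|X w| ^+ k))// ?lerDr// ler_eXn2l.
Qed.

Lemma moment1_integrable X : moment 1 X <-> P.-integrable setT (EFin \o X).
Proof.
split=> [[mX iX]|iX].
  by apply: (rintegrable_le mX iX) => w; rewrite expr1.
have mX : measurable_fun setT X by case/integrableP : iX => /measurable_EFinP.
split=> //; apply: (@rintegrable_le _ (fun w => `|X w|)).
- exact: measurable_normX.
- exact: integrable_norm.
- by move=> w; rewrite expr1 normr_id.
Qed.

Lemma moment_integrable k X : (0 < k)%N -> moment k X ->
  P.-integrable setT (EFin \o X).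
Proof. by move=> k0 /(moment_leq k0) /moment1_integrable. Qed.

Lemma moment2_sqr X : moment 2 X -> P.-integrable setT (EFin \o (fun w => X w ^+ 2)).
Proof.
move=> [_].
by congr (_.-integrable _ _); apply/funext => w /=; rewrite real_normK ?num_real.
Qed.

Lemma moment_bounded k (X : T -> R) (c : R) : measurable_fun setT X -> (forall w, `|X w| <= c) ->
  moment k X.
Proof.
move=> mX Xc; apply: (moment_le mX (moment_cst k c)) => w.
by rewrite (le_trans (Xc w))// ler_norm.
Qed.

Lemma momentM_bounded k (X Y : T -> R) (c : R) : measurable_fun setT X -> (forall w, `|X w| <= c) ->
  moment k Y -> moment k (fun w => X w * Y w).
Proof.
move=> mX Xc mY; apply: (moment_le _ (momentZ c mY)).
  by apply: measurable_funM => //; exact: moment_measurable mY.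
move=> w; rewrite !normrM; apply: ler_wpM2r => //.
exact: le_trans (Xc w) (ler_norm c).
Qed.

Lemma fine_expectation (X : T -> R) : fine 'E_P[X]%E = \int[P]_w X w.
Proof. by rewrite /Rintegral unlock. Qed.

Lemma int_cst (c : R) : \int[P]_w c = c.
Proof.
transitivity (c * fine (P setT)); first exact: Rintegral_cst.
by rewrite probability_setT /= mulr1.
Qed.

Lemma int_sum (I : Type) (r : seq I) (Q : pred I) (X : I -> T -> R) :
  (forall i, Q i -> P.-integrable setT (EFin \o X i)) ->
  \int[P]_w (\sum_(i <- r | Q i) X i w) = \sum_(i <- r | Q i) \int[P]_w X i w /\
  P.-integrable setT (EFin \o (fun w => \sum_(i <- r | Q i) X i w)).
Proof.
move=> h; elim: r => [|i r [IH1 IH2]].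
  rewrite big_nil; under eq_Rintegral do rewrite big_nil.
  by rewrite int_cst; split=> //; under eq_fun do rewrite big_nil; exact: rintegrable_cst.
rewrite big_cons; under eq_Rintegral do rewrite big_cons.
under [X in _ /\ P.-integrable _ (_ \o X)]eq_fun do rewrite big_cons.
case: (boolP (Q i)) => // Qi; rewrite RintegralD//; [|exact: h].
by rewrite IH1; split=> //; apply: rintegrableD => //; exact: h.
Qed.

End moments.

(** * Independence of one observation from the preceding ones *)

Section iid.
Context {d d' : measure_display} {Omega : measurableType d}
  {T : measurableType d'} {R : realType}.
Variables (P : probability Omega R) (V : nat -> Omega -> T).
Hypothesis mV : forall i, measurable_fun setT (V i).
Hypothesis indV : forall (J : {fset nat}) (B : nat -> set T),
  (forall i, measurable (B i)) ->
  P (\bigcap_(i in [set` J]) V i @^-1` B i) =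
  (\prod_(i <- J) P (V i @^-1` B i))%E.

(** A pi-system generating the sigma-algebra of [V 0], ..., [V (k-1)]. The type [past k] is Omega
    under that smaller sigma-algebra, so that depending on the past only becomes plain
    measurability. *)
Definition past_cyl (k : nat) : set (set Omega) :=
  [set C | exists2 B : nat -> set T, (forall i, measurable (B i)) &
     C = \bigcap_(i in [set i | (i < k)%N]) V i @^-1` B i].

Local Notation past k := (g_sigma_algebraType (past_cyl k)).

Lemma past_cyl_measurable k C : past_cyl k C -> measurable C.
Proof.
case=> B mB ->; apply: bigcap_measurableType => i _.
by rewrite -[_ @^-1` _]setTI; exact: mV.
Qed.

Lemma past_sub k (C : set (past k)) : measurable C -> @measurable _ Omega C.
Proof.
by apply: smallest_sub; [exact: sigma_algebra_measurable|exact: past_cyl_measurable].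
Qed.

Lemma past_cyl_setI k : setI_closed (past_cyl k).
Proof.
move=> _ _ [B mB ->] [C mC ->]; exists (fun i => B i `&` C i).
  by move=> i; exact: measurableI.
by rewrite -bigcapI.
Qed.

Lemma past_cyl_setT k : past_cyl k setT.
Proof.
exists (fun=> setT) => //.
by apply/seteqP; split.
Qed.

Lemma measurable_past k i : (i < k)%N ->
  @measurable_fun _ _ (past k) T setT (V i).
Proof.
move=> ik _ B mB; rewrite setTI; apply: sub_sigma_algebra.
exists (fun j => if j == i then B else setT); first by move=> j; case: ifP.
apply/seteqP; split => w /=.
  by move=> Bw j /= jk; case: ifP => // /eqP ->.
by move=> /(_ i ik) /=; rewrite eqxx.
Qed.

Lemma past_idfun_measurable k : measurable_fun setT (idfun : Omega -> past k).
Proof. by move=> _ B mB; rewrite setTI; exact: (past_sub mB). Qed.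

Lemma past_fun_measurable k d2 (U : measurableType d2) (f : Omega -> U) :
  @measurable_fun _ _ (past k) U setT f -> measurable_fun setT f.
Proof.
by move=> mf; exact: (measurableT_comp mf (@past_idfun_measurable k)).
Qed.

Lemma past_cyl_indep k (C : set Omega) (B : set T) : past_cyl k C -> measurable B ->
  P (C `&` V k @^-1` B) = (P C * P (V k @^-1` B))%E.
Proof.
move=> [A mA CE] mB.
have inI n i : ([set` [fset i in iota 0 n]%fset] i) = (i < n)%N :> Prop.
  by rewrite /= !inE mem_iota.
have -> : C = \bigcap_(i in [set` [fset i in iota 0 k]%fset]) V i @^-1` A i.
  rewrite CE; congr bigcap; apply/seteqP.
  by split=> i /=; rewrite !inE/= mem_iota.
(* Absorbing the event on [V k] as one more coordinate turns the intersection into a cylinder of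
   length k + 1, whose product formula splits off its last factor. *)
pose A' i := if i == k then B else A i.
have mA' i : measurable (A' i) by rewrite /A'; case: ifP.
have -> : \bigcap_(i in [set` [fset i in iota 0 k]%fset]) V i @^-1` A i `&`
    V k @^-1` B = \bigcap_(i in [set` [fset i in iota 0 k.+1]%fset]) V i @^-1` A' i.
  apply/seteqP; split => w.
    move=> [h Bw] i; rewrite inI ltnS leq_eqVlt /A'.
    by case: eqP => [->//|_] /= ik; apply: h; rewrite inI.
  move=> h; split.
    move=> i; rewrite inI => ik.
    have := h i; rewrite inI ltnS => /(_ (ltnW ik)).
    by rewrite /A' ltn_eqF.
  by have := h k; rewrite inI ltnSn => /(_ isT); rewrite /A' eqxx.
rewrite !indV//.
have E n : [fset i in iota 0 n]%fset =i index_iota 0 n.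
  by move=> i; rewrite !inE /index_iota subn0.
have PE n : perm_eq [fset i in iota 0 n]%fset (index_iota 0 n).
  apply: uniq_perm; [exact: fset_uniq|exact: iota_uniq|exact: E].
rewrite !(perm_big _ (PE _)) /= big_nat_recr//=; congr (_ * _)%E.
  by apply: eq_big_nat => i /andP[_ ik]; rewrite /A' ltn_eqF.
by rewrite /A' eqxx.
Qed.

(** Uniqueness of measures: C -> P(C and [V k] in B) and C -> P([V k] in B) P(C) are finite measures
    that agree on the generating pi-system. *)
Lemma past_indep k (C : set (past k)) (B : set T) : measurable C -> measurable B ->
  P (C `&` V k @^-1` B) = (P C * P (V k @^-1` B))%E.
Proof.
move=> mC mB.
have mVB : measurable (V k @^-1` B) by rewrite -[_ @^-1` _]setTI; exact: mV.
pose p := fine (P (V k @^-1` B)).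
have p0 : 0 <= p by exact: fine_ge0.
have pE : P (V k @^-1` B) = p%:E by rewrite fineK// fin_num_measure.
pose m1 := mrestr P mVB.
pose m2 := mscale (NngNum p0) P.
have : m1 C = m2 C.
  apply: (@g_sigma_algebra_measure_unique _ R Omega (past_cyl k) _ (fun=> setT)) => //.
  - exact: past_cyl_measurable.
  - by move=> _; exact: past_cyl_setT.
  - by apply/seteqP; split => // x _; exists 0%N.
  - exact: past_cyl_setI.
  - move=> A cA; transitivity (P (A `&` V k @^-1` B)) => //.
    by rewrite (past_cyl_indep cA mB) muleC pE.
  - move=> _; apply: (@le_lt_trans _ _ (P (setT `&` V k @^-1` B))) => //.
    by rewrite setTI pE ltry.
move=> h; transitivity (m1 C) => //; rewrite h.
by rewrite muleC pE.
Qed.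

(** By [past_indep] on rectangles, the joint law of the identity into [past k] and of [V k] is the
    product of their laws; Tonelli then factors the integral. *)
Lemma ge0_past_integralM k (F : past k -> R) (G : T -> R) :
  measurable_fun setT F -> measurable_fun setT G ->
  (forall w, 0 <= F w) -> (forall x, 0 <= G x) ->
  (\int[P]_w (F w * G (V k w))%:E =
   \int[P]_w (F w)%:E * \int[P]_w (G (V k w))%:E)%E.
Proof.
move=> mF mG F0 G0.
pose X : {mfun Omega >-> past k} := mfun_Sub (mem_set (@past_idfun_measurable k)).
pose Y : {mfun Omega >-> T} := mfun_Sub (mem_set (mV k)).
pose m1 := distribution P X; pose m2 := distribution P Y.
have mphi : measurable_fun setT (fun w : Omega => (X w, Y w)).
  by apply: measurable_fun_pair.
pose Z : {mfun Omega >-> (past k * T)%type} := mfun_Sub (mem_set mphi).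
pose m3 := distribution P Z.
pose f (z : past k * T) := ((F z.1)%:E * (G z.2)%:E)%E.
have mf : measurable_fun setT f.
  apply: emeasurable_funM; apply/measurable_EFinP.
    by apply: measurableT_comp mF measurable_fst.
  by apply: measurableT_comp mG measurable_snd.
have f0 z : (0 <= f z)%E by rewrite mule_ge0 ?lee_fin.
have XE w : X w = w by [].
have YE w : Y w = V k w by [].
transitivity (\int[m3]_z f z)%E.
  rewrite ge0_integral_distribution//.
transitivity (\int[m1 \x m2]_z f z)%E.
  apply: eq_measure_integral => A mA _; apply/esym.
  apply: product_measure_unique => // B C mB mC.
  exact: past_indep.
rewrite fubini_tonelli1//.
transitivity (\int[m1]_x ((F x)%:E * \int[m2]_y (G y)%:E))%E.
  apply: eq_integral => x _; rewrite /fubini_F /f /=.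
  by rewrite ge0_integralZl//; [exact/measurable_EFinP|move=> y _; rewrite lee_fin|rewrite lee_fin].
rewrite ge0_integralZr//; last 3 first.
- exact/measurable_EFinP.
- by move=> x _; rewrite lee_fin.
- by apply: integral_ge0 => y _; rewrite lee_fin.
congr (_ * _)%E.
  by rewrite ge0_integral_distribution//; exact/measurable_EFinP.
by rewrite ge0_integral_distribution//; exact/measurable_EFinP.
Qed.

Let ipos (X : Omega -> R) : P.-integrable setT (EFin \o X) ->
  P.-integrable setT (EFin \o (fun w => Num.max (X w) 0)).
Proof.
move=> iX; apply: (rintegrable_le _ (integrable_norm iX)).
  by apply: measurable_maxr => //; case/integrableP : iX => /measurable_EFinP.
by move=> w; rewrite /= ger0_norm ?le_max ?lexx ?orbT// ge_max ler_norm normr_ge0.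
Qed.

Let ge0_M k (F : past k -> R) (G : T -> R) :
  measurable_fun setT F -> measurable_fun setT G ->
  (forall w, 0 <= F w) -> (forall x, 0 <= G x) ->
  P.-integrable setT (EFin \o (F : Omega -> R)) ->
  P.-integrable setT (EFin \o (fun w => G (V k w))) ->
  P.-integrable setT (EFin \o (fun w : Omega => F w * G (V k w))) /\
  \int[P]_w (F w * G (V k w)) = \int[P]_w F w * \int[P]_w (G (V k w)).
Proof.
move=> mF mG F0 G0 iF iG.
have := ge0_past_integralM mF mG F0 G0 => E.
split; last first.
  rewrite /Rintegral E fineM//; exact: integrable_fin_num.
apply/integrableP; split.
  apply/measurable_EFinP; apply: measurable_funM; first exact: (past_fun_measurable mF).
  exact: measurableT_comp.
under eq_integral do rewrite /= ger0_norm ?mulr_ge0//.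
rewrite E ltey_eq fin_numM//; exact: integrable_fin_num.
Qed.

(** The four products of positive and negative parts fall under the nonnegative case. Integrability
    of the product is a conclusion: independence makes first moments of the factors enough. *)
Lemma past_integralM k (F : past k -> R) (G : T -> R) :
  measurable_fun setT F -> measurable_fun setT G ->
  P.-integrable setT (EFin \o (F : Omega -> R)) ->
  P.-integrable setT (EFin \o (fun w => G (V k w))) ->
  P.-integrable setT (EFin \o (fun w : Omega => F w * G (V k w))) /\
  \int[P]_w (F w * G (V k w)) = \int[P]_w F w * \int[P]_w (G (V k w)).
Proof.
move=> mF mG iF iG.
pose Fp w := Num.max (F w) 0; pose Fn w := Num.max (- F w) 0.
pose Gp w := Num.max (G w) 0; pose Gn w := Num.max (- G w) 0.
have maxN (x : R) : x = Num.max x 0 - Num.max (- x) 0.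
  have [x0|x0] := leP x 0.
    by rewrite max_l ?oppr_ge0// opprK add0r.
  by rewrite max_r ?oppr_le0 1?ltW// subr0.
have mFp : measurable_fun setT Fp by exact: measurable_maxr.
have mFn : measurable_fun setT Fn.
  by apply: measurable_maxr => //; exact: measurableT_comp.
have mGp : measurable_fun setT Gp by exact: measurable_maxr.
have mGn : measurable_fun setT Gn.
  by apply: measurable_maxr => //; exact: measurableT_comp.
have iFp : P.-integrable setT (EFin \o (Fp : Omega -> R)) by exact: ipos.
have iFn : P.-integrable setT (EFin \o (Fn : Omega -> R)).
  by apply: (@ipos (fun w => - F w)); exact: rintegrableN.
have iGp : P.-integrable setT (EFin \o (fun w => Gp (V k w))) by exact: ipos.
have iGn : P.-integrable setT (EFin \o (fun w => Gn (V k w))).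
  by apply: (@ipos (fun w => - G (V k w))); exact: rintegrableN.
have Fp0 w : 0 <= Fp w by rewrite le_max lexx orbT.
have Fn0 w : 0 <= Fn w by rewrite le_max lexx orbT.
have Gp0 w : 0 <= Gp w by rewrite le_max lexx orbT.
have Gn0 w : 0 <= Gn w by rewrite le_max lexx orbT.
have [i1 e1] := ge0_M mFp mGp Fp0 Gp0 iFp iGp.
have [i2 e2] := ge0_M mFp mGn Fp0 Gn0 iFp iGn.
have [i3 e3] := ge0_M mFn mGp Fn0 Gp0 iFn iGp.
have [i4 e4] := ge0_M mFn mGn Fn0 Gn0 iFn iGn.
have E : (fun w : Omega => F w * G (V k w)) = (fun w : Omega =>
    (Fp w * Gp (V k w) + Fn w * Gn (V k w)) -
    (Fp w * Gn (V k w) + Fn w * Gp (V k w))).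
  apply/funext => w; rewrite {1}[F w]maxN {1}[G _]maxN -/(Fp w) -/(Fn w).
  by rewrite -/(Gp (V k w)) -/(Gn (V k w)); ring.
rewrite E; split.
  by apply: rintegrableB; exact: rintegrableD.
rewrite RintegralB//; [|exact: rintegrableD|exact: rintegrableD].
rewrite !RintegralD// e1 e2 e3 e4.
have -> : \int[P]_w F w = \int[P]_w Fp w - \int[P]_w Fn w.
  by rewrite -RintegralB//; apply: eq_Rintegral => w _; exact: maxN.
have -> : \int[P]_w (G (V k w)) = \int[P]_w Gp (V k w) - \int[P]_w Gn (V k w).
  by rewrite -RintegralB//; apply: eq_Rintegral => w _; exact: maxN.
ring.
Qed.

End iid.

(** * Chebyshev bounds for i.i.d. sums *)

Section chebyshev.
Context {d : measure_display} {T : measurableType d} {R : realType}.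
Variable P : probability T R.

Lemma measurable_gtr (X : T -> R) (c : R) : measurable_fun setT X ->
  measurable [set w | c < X w].
Proof.
move=> mX; have -> : [set w | c < X w] = setT `&` X @^-1` `]c, +oo[%classic.
  by apply/seteqP; split => w /=; rewrite in_itv /= andbT // => -[].
exact: mX.
Qed.

Lemma measurable_ler (X : T -> R) (c : R) : measurable_fun setT X ->
  measurable [set w | X w <= c].
Proof.
move=> mX; have -> : [set w | X w <= c] = setT `&` X @^-1` `]-oo, c]%classic.
  by apply/seteqP; split => w /=; rewrite in_itv /= // => -[].
exact: mX.
Qed.

Lemma integrable_indic_r (A : set T) : measurable A ->
  P.-integrable setT (EFin \o (\1_A : T -> R)).
Proof.
move=> mA; apply: (rintegrable_le _ (rintegrable_cst P 1)).
  exact: measurable_indic.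
by move=> w; rewrite indicE; case: (_ \in _); rewrite ?normr1 ?normr0.
Qed.

Lemma int_indic (A : set T) : measurable A -> \int[P]_w (\1_A w : R) = fine (P A).
Proof. by move=> mA; rewrite /Rintegral integral_indic// setIT. Qed.

Lemma prob_normr_gt (X : T -> R) (c : R) : 0 < c -> moment P 2 X ->
  (P [set w | (c < `|X w|)%R] <= ((\int[P]_w (X w ^+ 2)) / c ^+ 2)%:E)%E.
Proof.
move=> c0 mX; have c20 : 0 < c ^+ 2 by rewrite exprn_gt0.
have mA : measurable [set w | c < `|X w|].
  apply: measurable_gtr; apply: measurableT_comp => //; exact: moment_measurable mX.
rewrite -(fineK (fin_num_measure P _ mA)) lee_fin ler_pdivlMr// mulrC.
rewrite -int_indic// -RintegralZl//; last exact: integrable_indic_r.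
apply: le_Rintegral => //.
- exact: (rintegrableZ _ (integrable_indic_r mA)).
- exact: moment2_sqr.
move=> w _; rewrite indicE.
case: (boolP (w \in _)) => [|_]; last by rewrite mulr0 sqr_ge0.
rewrite inE /= mulr1 => cX.
by rewrite -(real_normK (num_real (X w))) lerXn2r// ?nnegrE ltW.
Qed.

End chebyshev.

Section iid_sum.
Context {d d' : measure_display} {Omega : measurableType d}
  {T : measurableType d'} {R : realType}.
Variables (P : probability Omega R) (V : nat -> Omega -> T).
Hypothesis mV : forall i, measurable_fun setT (V i).
Hypothesis indV : forall (J : {fset nat}) (B : nat -> set T),
  (forall i, measurable (B i)) ->
  P (\bigcap_(i in [set` J]) V i @^-1` B i) =
  (\prod_(i <- J) P (V i @^-1` B i))%E.
Hypothesis idV : forall i j (B : set T), measurable B ->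
  P (V i @^-1` B) = P (V j @^-1` B).

Lemma ident_ge0_integral i (F : T -> R) : measurable_fun setT F ->
  (forall x, 0 <= F x) ->
  (\int[P]_w (F (V i w))%:E = \int[P]_w (F (V 0%N w))%:E)%E.
Proof.
move=> mF F0.
have H j : (\int[P]_w (F (V j w))%:E = \int[distribution P (mfun_Sub (mem_set (mV j)))]_x (F x)%:E)%E.
  by rewrite ge0_integral_distribution//; exact/measurable_EFinP.
by rewrite !H; apply: eq_measure_integral => A mA _; exact: idV.
Qed.

Lemma ident_integrable i (F : T -> R) : measurable_fun setT F ->
  P.-integrable setT (EFin \o (fun w => F (V 0%N w))) ->
  P.-integrable setT (EFin \o (fun w => F (V i w))).
Proof.
move=> mF /integrableP[_ h]; apply/integrableP; split.
  by apply/measurable_EFinP; exact: measurableT_comp.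
have := @ident_ge0_integral i (fun x => `|F x|).
rewrite /= => -> //.
by apply: measurableT_comp.
Qed.

Lemma ident_integral i (F : T -> R) : measurable_fun setT F ->
  P.-integrable setT (EFin \o (fun w => F (V 0%N w))) ->
  \int[P]_w F (V i w) = \int[P]_w F (V 0%N w).
Proof.
move=> mF iF.
have H j : \int[P]_w F (V j w) =
    fine (\int[distribution P (mfun_Sub (mem_set (mV j)))]_x (F x)%:E)%E.
  rewrite integral_distribution//; first exact/measurable_EFinP.
  by have := @ident_integrable j F mF iF.
rewrite !H; congr fine; apply: eq_measure_integral => A mA _; exact: idV.
Qed.

Lemma ident_moment i k (F : T -> R) : measurable_fun setT F ->
  moment P k (fun w => F (V 0%N w)) -> moment P k (fun w => F (V i w)).
Proof.
move=> mF [_ iF]; split; first exact: measurableT_comp.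
apply: (@ident_integrable i (fun x => `|F x| ^+ k)) => //.
exact: measurable_normX.
Qed.

Lemma measurable_past_sum k (F : T -> R) : measurable_fun setT F ->
  @measurable_fun _ _ (g_sigma_algebraType (past_cyl V k)) R setT
    (fun w => \sum_(i < k) F (V i w)).
Proof.
move=> mF; apply: measurable_sum => i.
exact: (measurableT_comp mF (@measurable_past _ _ _ _ V k i (ltn_ord i))).
Qed.

Lemma moment_iid_sum k n (F : T -> R) : measurable_fun setT F ->
  moment P k (fun w => F (V 0%N w)) -> moment P k (fun w => \sum_(i < n) F (V i w)).
Proof. by move=> mF h; apply: moment_sum => i _; exact: ident_moment. Qed.

(** The sum of the first n terms depends on the past of term n only, so each cross term factors
    through a mean that is zero. *)
Lemma iid_sum_sqr n (F : T -> R) : measurable_fun setT F ->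
  moment P 2 (fun w => F (V 0%N w)) -> \int[P]_w F (V 0%N w) = 0 ->
  \int[P]_w ((\sum_(i < n) F (V i w)) ^+ 2) = n%:R * \int[P]_w (F (V 0%N w) ^+ 2).
Proof.
move=> mF m2 E0; elim: n => [|n IH].
  by rewrite mul0r; under eq_Rintegral do rewrite big_ord0 expr0n; exact: int_cst.
have mS := moment_iid_sum n mF m2.
have mFn := @ident_moment n _ _ mF m2.
have [i1 e1] := past_integralM mV indV (@measurable_past_sum n _ mF) mF
   (moment_integrable (ltn0Sn 1) mS) (moment_integrable (ltn0Sn 1) mFn).
rewrite ident_integral// in e1; last exact: (moment_integrable (ltn0Sn 1) m2).
rewrite E0 mulr0 in e1.
under eq_Rintegral do rewrite big_ord_recr/= sqrrD -mulr_natl.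
rewrite RintegralD//; [|apply: rintegrableD|]; first last.
- exact: moment2_sqr.
- exact: rintegrableZ.
- exact: moment2_sqr.
rewrite RintegralD//; [|exact: moment2_sqr|exact: rintegrableZ].
rewrite RintegralZl// e1 mulr0 addr0 IH.
rewrite (@ident_integral n (fun x => F x ^+ 2))//; last 2 first.
- exact: measurable_funX.
- exact: moment2_sqr.
by rewrite -[in RHS]natr1 mulrDl mul1r.
Qed.

(** The witness is the variance of one summand; the scale sqrt n makes the bound uniform in n. *)
Lemma iid_sum_prob (F : T -> R) : measurable_fun setT F ->
  moment P 2 (fun w => F (V 0%N w)) -> \int[P]_w F (V 0%N w) = 0 ->
  exists2 v, 0 <= v & forall (n : nat) (M : R), (0 < n)%N -> 0 < M ->
  (P [set w | (M * Num.sqrt n%:R < `|(\sum_(i < n) F (V i w))|)%R] <=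
    (v / M ^+ 2)%:E)%E.
Proof.
move=> mF m2 E0; exists (\int[P]_w (F (V 0%N w) ^+ 2)).
  by apply: Rintegral_ge0 => w _; exact: sqr_ge0.
move=> n M n0 M0.
have n0' : 0 < n%:R :> R by rewrite ltr0n.
apply: (le_trans (@prob_normr_gt _ _ _ P _ _ _ (moment_iid_sum n mF m2))).
  by rewrite mulr_gt0// sqrtr_gt0.
rewrite lee_fin iid_sum_sqr// exprMn sqr_sqrtr ?ler0n//.
rewrite [X in X <= _](_ : _ = \int[P]_w (F (V 0%N w) ^+ 2) / M ^+ 2)//.
by field; rewrite ?gt_eqF.
Qed.

End iid_sum.

(** * The Laplace transform of a quadratic form in an i.i.d. sum *)

Section exp_bounds.
Context {R : realType}.
Implicit Types (u v x y r : R) (k : nat).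

(** The mean value theorem raises the order of a bound by one. The factor max(1, e^x) dominates e^c
    for every c between 0 and x, so it survives the passage from g to f, and iteration yields the
    Taylor remainders of the exponential. *)
Lemma derive_bound (f g : R -> R) k :
  (forall x, is_derive x 1 f (g x)) -> f 0 = 0 ->
  (forall x, `|g x| <= `|x| ^+ k * Num.max 1 (expR x)) ->
  forall x, `|f x| <= `|x| ^+ k.+1 * Num.max 1 (expR x).
Proof.
move=> df f0 gb x.
have cf a b : {within `[a, b], continuous f}.
  apply: continuous_subspaceT => z.
  by apply/differentiable_continuous/derivable1_diffP; have [] := df z.
have main c : `|c| <= `|x| -> expR c <= Num.max 1 (expR x) ->
    `|f x| = `|g c| * `|x| -> `|f x| <= `|x| ^+ k.+1 * Num.max 1 (expR x).
  move=> cx ecx ->; rewrite exprSr mulrAC ler_wpM2r//.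
  apply: (le_trans (gb c)); apply: ler_pM; rewrite ?exprn_ge0//.
  - by rewrite lerXn2r ?nnegrE.
  - by rewrite ge_max ecx le_max lexx.
have [x0|x0] := leP 0 x.
  have [c /[!in_itv]/= /andP[c0 cx] E] :=
    @MVT_segment R f g 0 x x0 (fun z _ => df z) (cf 0 x).
  apply: (main c); first by rewrite !ger0_norm.
    by rewrite le_max ler_expR cx orbT.
  by rewrite -normrM -[f x]subr0 -{1}f0 E subr0.
have [c /[!in_itv]/= /andP[cx c0] E] :=
  @MVT_segment R f g x 0 (ltW x0) (fun z _ => df z) (cf x 0).
apply: (main c); first by rewrite !ler0_norm ?lerN2// ltW.
  by rewrite le_max expR_le1 c0.
by rewrite -normrM -[f x]opprK -[- f x]add0r -{1}f0 E sub0r mulrN opprK.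
Qed.

Lemma expR_taylor1 x : `|expR x - 1| <= `|x| * Num.max 1 (expR x).
Proof.
rewrite -[in leRHS](expr1 `|x|).
apply: (@derive_bound (fun x => expR x - 1) expR 0%N) => [y||y].
- by apply: is_derive_eq; rewrite /GRing.scale/=; ring.
- by rewrite expR0 subrr.
- by rewrite expr0 mul1r ger0_norm ?expR_ge0// le_max lexx orbT.
Qed.

Lemma expR_taylor2 x : `|expR x - 1 - x| <= `|x| ^+ 2 * Num.max 1 (expR x).
Proof.
apply: (@derive_bound (fun x => expR x - 1 - x) (fun x => expR x - 1) 1%N) => [y||y].
- by apply: is_derive_eq; rewrite /GRing.scale/=; ring.
- by rewrite expR0 subrr subr0.
- by rewrite expr1; exact: expR_taylor1.
Qed.

Lemma expR_taylor3 x :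
  `|expR x - 1 - x - x ^+ 2 / 2| <= `|x| ^+ 3 * Num.max 1 (expR x).
Proof.
apply: (@derive_bound (fun x => expR x - 1 - x - x ^+ 2 / 2)
   (fun x => expR x - 1 - x) 2%N) => [y||y].
- by apply: is_derive_eq; rewrite /GRing.scale/=; field.
- by rewrite expR0 expr0n /= mul0r subrr !subr0.
- exact: expR_taylor2.
Qed.

Lemma ln1D_bound x : 0 <= x -> `|ln (1 + x) - x| <= x ^+ 2.
Proof.
move=> x0; have x1 : 0 < 1 + x by rewrite ltr_wpDr.
have h1 : ln (1 + x) <= x by apply: le_ln1Dx; lra.
have h2 : x - x ^+ 2 <= ln (1 + x).
  (* At -x/(1+x), where 1 - x/(1+x) = 1/(1+x), the upper bound on the logarithm becomes a lower one:
     ln (1+x) >= x/(1+x) >= x - x^2. *)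
  have := @le_ln1Dx R (- x / (1 + x)).
  have -> : 1 + - x / (1 + x) = (1 + x)^-1 by field; rewrite gt_eqF.
  rewrite lnV ?posrE// => h.
  apply: (@le_trans _ _ (x / (1 + x))).
    rewrite ler_pdivlMr//; nra.
  rewrite -lerN2 -mulNr; apply: h.
  rewrite ltr_pdivlMr//; lra.
by rewrite ler0_norm; lra.
Qed.

Lemma expRN_bound x : 0 <= x -> expR (- x) * (1 + x / 2) ^+ 2 <= 1.
Proof.
move=> x0; have -> : x = x / 2 + x / 2 by field.
rewrite opprD expRD -expr2 -exprMn.
apply: exprn_ile1; first by rewrite mulr_ge0 ?expR_ge0//; lra.
rewrite expRN mulrC ler_pdivrMr ?expR_gt0// mul1r.
by apply: le_trans (expR_ge1Dx _); lra.
Qed.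

(** For r <= 1 the exponent -y^2 moves by at most r (2 |y| + 1) when y moves by r, so a third-order
    remainder carries the cube of 2 |y| + 1. The constant is 10 * 10: both 2t + 1 and its square are
    at most 10 (1 + t^2/2). *)
Lemma gauss_poly_bound x : expR (- x ^+ 2) * (2 * `|x| + 1) ^+ 3 <= 100.
Proof.
have x2 : x ^+ 2 = `|x| ^+ 2 by rewrite real_normK ?num_real.
have := @expRN_bound (x ^+ 2) (sqr_ge0 _).
rewrite x2; move: `|x| (normr_ge0 x) => t t0 h.
have e0 := expR_ge0 (- t ^+ 2).
have h1 : (2 * t + 1) ^+ 2 <= 10 * (1 + t ^+ 2 / 2).
  by rewrite -subr_ge0; apply: (@le_trans _ _ ((t - 2) ^+ 2 + 5)); [nra|lra].
have h2 : 2 * t + 1 <= 10 * (1 + t ^+ 2 / 2).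
  have := sqr_ge0 (t - 1); nra.
have h3 : (2 * t + 1) ^+ 3 <= 100 * (1 + t ^+ 2 / 2) ^+ 2.
  rewrite exprSr; apply: (@le_trans _ _ (10 * (1 + t ^+ 2 / 2) * (10 * (1 + t ^+ 2 / 2)))).
    apply: ler_pM => //; [exact: sqr_ge0|lra].
  by rewrite le_eqVlt; apply/orP; left; apply/eqP; ring.
apply: (@le_trans _ _ (expR (- t ^+ 2) * (100 * (1 + t ^+ 2 / 2) ^+ 2))).
  exact: ler_wpM2l.
by rewrite mulrCA -[leRHS]mulr1 ler_wpM2l.
Qed.

(* With y the coordinate of x along h and r the length of h, this is the Taylor
   estimate of exp(-q) in the direction h; the bound must be quadratic for
   large r since the summands have only two moments. *)
Lemma gauss_taylor y r : 0 <= r ->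
  `|expR (- (y + r) ^+ 2) - expR (- y ^+ 2) * (1 - 2 * (y * r) - r ^+ 2 + 2 * (y * r) ^+ 2)|
   <= 1000 * Num.min (r ^+ 2) (r ^+ 3).
Proof.
move=> r0.
have e0 := expR_ge0 (- y ^+ 2).
have by_ := gauss_poly_bound y.
have byr := gauss_poly_bound (y + r).
have yn := normr_ge0 y.
have cube (z : R) : 2 * `|z| + 1 <= (2 * `|z| + 1) ^+ 3.
  have := normr_ge0 z; move: `|z| => t t0; rewrite -[leLHS]expr1.
  by apply: ler_weXn2l => //; lra.
have by1 : expR (- y ^+ 2) * (2 * `|y| + 1) <= 100.
  by apply: le_trans by_; rewrite ler_wpM2l.
have [r1|r1] := leP r 1.
  have -> : Num.min (r ^+ 2) (r ^+ 3) = r ^+ 3.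
    by rewrite min_r// [leLHS]exprSr ler_piMr// sqr_ge0.
  (* The change of the exponent. The polynomial 1 + u + u^2/2 exceeds the quadratic expansion of the
     statement by r^3 (2 y + r/2). *)
  pose u := - (2 * (y * r)) - r ^+ 2.
  have -> : - (y + r) ^+ 2 = - y ^+ 2 + u by rewrite /u; ring.
  rewrite expRD -mulrBr normrM (ger0_norm e0).
  have -> : expR u - (1 - 2 * (y * r) - r ^+ 2 + 2 * (y * r) ^+ 2) =
    (expR u - 1 - u - u ^+ 2 / 2) + r ^+ 3 * (2 * y + r / 2) by rewrite /u; field.
  have A1 : expR (- y ^+ 2) * `|expR u - 1 - u - u ^+ 2 / 2| <= 100 * r ^+ 3.
    apply: (@le_trans _ _ (expR (- y ^+ 2) * (`|u| ^+ 3 * Num.max 1 (expR u)))).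
      by rewrite ler_wpM2l// expR_taylor3.
    have [eu|eu] := leP (expR u) 1.
      rewrite mulr1; apply: (@le_trans _ _ (expR (- y ^+ 2) * (r * (2 * `|y| + 1)) ^+ 3)).
        rewrite ler_wpM2l// lerXn2r ?nnegrE ?mulr_ge0//.
        rewrite /u -opprD normrN (le_trans (ler_normD _ _))// normrX !normrM (ger0_norm r0).
        rewrite (ger0_norm (ler0n _ 2)); nra.
      rewrite exprMn mulrCA mulrC ler_wpM2r ?exprn_ge0//.
    (* When e^u > 1, the weight e^(-y^2) e^u is the Gaussian at y + r; u is rewritten around y + r
       and the same polynomial bound applies there. *)
    rewrite mulrCA -expRD.
    have -> : - y ^+ 2 + u = - (y + r) ^+ 2 by rewrite /u; ring.
    rewrite mulrC; apply: (@le_trans _ _ (expR (- (y + r) ^+ 2) * (r * (2 * `|y + r| + 1)) ^+ 3)).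
      rewrite ler_wpM2l ?expR_ge0// lerXn2r ?nnegrE ?mulr_ge0//.
      have -> : u = - (2 * ((y + r) * r)) + r ^+ 2 by rewrite /u; ring.
      rewrite (le_trans (ler_normD _ _))// normrN normrX !normrM (ger0_norm r0).
      rewrite (ger0_norm (ler0n _ 2)); nra.
    by rewrite exprMn mulrCA mulrC ler_wpM2r ?exprn_ge0.
  have A2 : expR (- y ^+ 2) * `|r ^+ 3 * (2 * y + r / 2)| <= 100 * r ^+ 3.
    rewrite normrM normrX (ger0_norm r0) mulrCA mulrC ler_wpM2r ?exprn_ge0//.
    apply: le_trans by1; rewrite ler_wpM2l//.
    rewrite (le_trans (ler_normD _ _))// normrM (ger0_norm (ler0n _ 2)) lerD2l.
    by rewrite ger0_norm; lra.
  have r30 : 0 <= r ^+ 3 by rewrite exprn_ge0.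
  apply: (@le_trans _ _ (expR (- y ^+ 2) * (`|expR u - 1 - u - u ^+ 2 / 2|
    + `|r ^+ 3 * (2 * y + r / 2)|))); first by rewrite ler_wpM2l// ler_normD.
  rewrite mulrDr; lra.
have -> : Num.min (r ^+ 2) (r ^+ 3) = r ^+ 2.
  by rewrite min_l// [r ^+ 3]exprSr ler_peMr ?sqr_ge0// ltW.
have r21 : 1 <= r ^+ 2 by rewrite exprn_ege1// ltW.
have A1 : expR (- (y + r) ^+ 2) <= 1 by rewrite expR_le1 oppr_le0 sqr_ge0.
have A2 : `|1 - 2 * (y * r) - r ^+ 2 + 2 * (y * r) ^+ 2| <= r ^+ 2 * (2 * `|y| + 1) ^+ 3 * 2.
  have y2 : y ^+ 2 = `|y| ^+ 2 by rewrite real_normK ?num_real.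
  rewrite exprMn y2.
  have yr : `|y * r| <= `|y| * r ^+ 2.
    by rewrite normrM (ger0_norm r0) ler_wpM2l// expr2 ler_peMr// ltW.
  apply: (@le_trans _ _ (1 + 2 * (`|y| * r ^+ 2) + r ^+ 2 + 2 * (`|y| ^+ 2 * r ^+ 2))).
    move: yr; rewrite !ler_norml => /andP[]; set a := y * r; set b := `|y| * r ^+ 2.
    have : 0 <= `|y| ^+ 2 * r ^+ 2 by rewrite mulr_ge0// sqr_ge0.
    set c' := _ * _ => c0 h1 h2; apply/andP; split; lra.
  move: `|y| yn {yr y2} => t t0; nra.
have A3 : expR (- y ^+ 2) * `|1 - 2 * (y * r) - r ^+ 2 + 2 * (y * r) ^+ 2| <= 200 * r ^+ 2.
  apply: (@le_trans _ _ (expR (- y ^+ 2) * (r ^+ 2 * (2 * `|y| + 1) ^+ 3 * 2))).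
    by rewrite ler_wpM2l.
  rewrite [leLHS](_ : _ = 2 * r ^+ 2 * (expR (- y ^+ 2) * (2 * `|y| + 1) ^+ 3)); last by ring.
  rewrite [leRHS](_ : _ = 2 * r ^+ 2 * 100); last by ring.
  by rewrite ler_wpM2l// mulr_ge0// sqr_ge0.
apply: (le_trans (ler_normB _ _)).
rewrite normrM (ger0_norm e0) (ger0_norm (expR_ge0 _)); lra.
Qed.

Lemma exp_poly_bound x : 0 <= x -> expR (- x) * (1 + x) ^+ 2 <= 4.
Proof.
move=> x0; have := expRN_bound x0; have e0 := expR_ge0 (- x) => h.
apply: (@le_trans _ _ (4 * (expR (- x) * (1 + x / 2) ^+ 2))); last by lra.
rewrite [leRHS]mulrCA ler_wpM2l//; nra.
Qed.

(* First-order expansion in the time increment of the heat flow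
   (1+w)^(-k/2) exp(-q/(1+w)). *)
Lemma heat_taylor (c q w : R) : 0 <= c -> 0 <= q -> 0 <= w <= 1 ->
  `|expR (- (c * ln (1 + w)) - q / (1 + w)) - expR (- q) * (1 - c * w + w * q)|
   <= 100 * (1 + c) ^+ 2 * w ^+ 2.
Proof.
move=> c0 q0 /andP[w0 w1].
have w1' : 0 < 1 + w by rewrite ltr_wpDr.
pose u := w * (q / (1 + w)) - c * ln (1 + w).
have -> : - (c * ln (1 + w)) - q / (1 + w) = - q + u.
  by rewrite /u; field; rewrite gt_eqF.
have lnb := ln1D_bound w0.
have ln0 : 0 <= ln (1 + w) by rewrite ln_ge0// lerDl.
have lnw : ln (1 + w) <= w by apply: le_ln1Dx; lra.
have e0 := expR_ge0 (- q).
have qw1 : q / (1 + w) <= q by rewrite ler_pdivrMr// ler_peMr// lerDl.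
have qw0 : 0 <= q / (1 + w) by rewrite divr_ge0// ltW.
have ub : `|u| <= w * (1 + c) * (1 + q).
  rewrite /u; set Q := q / (1 + w) in qw1 qw0 *.
  rewrite (le_trans (ler_normB _ _))// (normrM w) (normrM c) (ger0_norm w0) (ger0_norm qw0).
  rewrite (ger0_norm c0) (ger0_norm ln0).
  have := ler_wpM2l w0 qw1; have := ler_wpM2l c0 lnw.
  have := mulr_ge0 w0 q0; have := mulr_ge0 w0 (mulr_ge0 c0 q0).
  lra.
have E2 : expR (- q) * `|expR u - 1 - u| <= 64 * (1 + c) ^+ 2 * w ^+ 2.
  apply: (@le_trans _ _ (expR (- q) * (`|u| ^+ 2 * Num.max 1 (expR u)))).
    by rewrite ler_wpM2l// expR_taylor2.
  have u2 : `|u| ^+ 2 <= (w * (1 + c)) ^+ 2 * (1 + q) ^+ 2.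
    by rewrite -exprMn lerXn2r ?nnegrE// !mulr_ge0// addr_ge0.
  (* Since w <= 1, w q/(1+w) <= q/2: half of the decay of e^(-q) survives, and it absorbs the factor
     (1 + q)^2 coming from u^2. *)
  have e2 : expR (- q) * Num.max 1 (expR u) <= expR (- (q / 2)).
    rewrite maxr_pMr// mulr1 -expRD ge_max !ler_expR; apply/andP; split; first by lra.
    have : w * (q / (1 + w)) <= q / 2.
      rewrite mulrA ler_pdivrMr//; nra.
    by have := mulr_ge0 c0 ln0; rewrite /u; lra.
  rewrite mulrCA; apply: (@le_trans _ _ ((w * (1 + c)) ^+ 2 * (1 + q) ^+ 2 * expR (- (q / 2)))).
    by apply: ler_pM => //; rewrite ?mulr_ge0// le_max ler01.
  have q20 : 0 <= q / 2 by lra.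
  have := exp_poly_bound q20; have := expR_ge0 (- (q / 2)).
  move: (expR _) => e e0' he.
  have h3 : (1 + q) ^+ 2 * e <= 16.
    by apply: (@le_trans _ _ (4 * (e * (1 + q / 2) ^+ 2))); [nra|lra].
  rewrite -mulrA; apply: (@le_trans _ _ ((w * (1 + c)) ^+ 2 * 16)).
    by rewrite ler_wpM2l// sqr_ge0.
  rewrite exprMn; have := mulr_ge0 (sqr_ge0 w) (sqr_ge0 (1 + c)); lra.
(* Replacing q/(1+w) by q and ln (1+w) by w costs at most w^2 (q + c), and e^(-q) q <= 1. *)
have E1 : expR (- q) * `|u - (w * q - c * w)| <= 2 * (1 + c) * w ^+ 2.
  have -> : u - (w * q - c * w) = - (w ^+ 2 * (q / (1 + w))) - c * (ln (1 + w) - w).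
    by rewrite /u; field; rewrite gt_eqF.
  apply: (@le_trans _ _ (expR (- q) * (w ^+ 2 * q + c * w ^+ 2))).
    set Q := q / (1 + w) in qw1 qw0 *.
    rewrite ler_wpM2l// (le_trans (ler_normB _ _))// normrN.
    rewrite (normrM (w ^+ 2)) (normrM c) (ger0_norm c0).
    rewrite (ger0_norm (sqr_ge0 _)) (ger0_norm qw0) lerD ?ler_wpM2l ?sqr_ge0//.
  have := sqr_ge0 w; move: (w ^+ 2) => W W0.
  have eq1 : expR (- q) * q <= 1.
    rewrite expRN mulrC ler_pdivrMr ?expR_gt0// mul1r.
    by apply: le_trans (expR_ge1Dx _); lra.
  have e1 : expR (- q) <= 1 by rewrite expR_le1; lra.
  move: (expR _) e0 eq1 e1 => e e0 eq1 e1.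
  rewrite mulrDr mulrCA [e * (c * W)]mulrC.
  have : W * (e * q) <= W by rewrite ler_piMr.
  have : c * W * e <= c * W by rewrite ler_piMr// mulr_ge0.
  by have := mulr_ge0 c0 W0; lra.
rewrite expRD -mulrBr normrM (ger0_norm e0).
have -> : expR u - (1 - c * w + w * q) = (expR u - 1 - u) + (u - (w * q - c * w)) by ring.
apply: (@le_trans _ _ (expR (- q) * (`|expR u - 1 - u| + `|u - (w * q - c * w)|))).
  by rewrite ler_wpM2l// ler_normD.
rewrite mulrDr (le_trans (lerD E2 E1))//.
have := sqr_ge0 w; move: (w ^+ 2) => W W0.
rewrite -mulrDl ler_wpM2r//; nra.
Qed.

End exp_bounds.

Section bilinear.
Context {R : realType} {K : nat}.
Implicit Types (x y h : 'cV[R]_K) (A : 'M[R]_K).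

Definition bil A x y : R := (x^T *m A *m y) 0 0.

Lemma bilE A x y : bil A x y = \sum_b (x^T *m A) 0 b * y b 0.
Proof. by rewrite /bil mxE. Qed.

Lemma bilDl A x y h : bil A (x + y) h = bil A x h + bil A y h.
Proof. by rewrite /bil linearD /= !mulmxDl mxE. Qed.

Lemma bilDr A x y h : bil A x (y + h) = bil A x y + bil A x h.
Proof. by rewrite /bil !mulmxDr mxE. Qed.

Lemma bilZl A (c : R) x y : bil A (c *: x) y = c * bil A x y.
Proof. by rewrite /bil linearZ /= -!scalemxAl mxE. Qed.

Lemma bilZr A (c : R) x y : bil A x (c *: y) = c * bil A x y.
Proof. by rewrite /bil -!scalemxAr mxE. Qed.

Lemma bil0l A y : bil A 0 y = 0.
Proof. by rewrite /bil trmx0 !mul0mx mxE. Qed.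

Lemma bilC A x y : A^T = A -> bil A x y = bil A y x.
Proof.
move=> sA; rewrite /bil -[in LHS](trmxK (x^T *m A *m y)) mxE.
by rewrite !trmx_mul sA trmxK mulmxA.
Qed.

Lemma bilD A x h : A^T = A ->
  bil A (x + h) (x + h) = bil A x x + 2 * bil A x h + bil A h h.
Proof. by move=> sA; rewrite bilDl !bilDr [bil A h x]bilC//; ring. Qed.

Lemma discr_le (a b c : R) : (forall t, 0 <= a + 2 * (t * b) + t ^+ 2 * c) ->
  0 <= a -> 0 <= c -> b ^+ 2 <= a * c.
Proof.
move=> h a0; rewrite le_eqVlt => /predU1P[c0|c0].
  rewrite -c0 mulr0; have [->|b0] := eqVneq b 0; first by rewrite expr0n.
  (* For c = 0 the expression is affine in t, and this t gives it the value -1. *)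
  have := h (- (a + 1) / (2 * b)); rewrite -c0 mulr0 addr0.
  by rewrite (_ : a + _ = -1) ?oppr_ge0 ?ler10//; field.
have := h (- b / c).
rewrite (_ : a + _ + _ = (a * c - b ^+ 2) / c); last by field; rewrite gt_eqF.
by rewrite pmulr_lge0 ?invr_gt0// subr_ge0.
Qed.

Lemma bil_CS A x y : A^T = A -> (forall z, 0 <= bil A z z) ->
  bil A x y ^+ 2 <= bil A x x * bil A y y.
Proof.
move=> sA pA; apply: discr_le => // t.
have := pA (x + t *: y); rewrite bilD// !bilZr bilZl.
by congr (0 <= _); ring.
Qed.

End bilinear.

Section gauss_step.
Context {R : realType}.

Lemma cvg_natV : (n%:R^-1 : R) @[n --> \oo] --> (0 : R).
Proof.
by rewrite -(cvg_shiftS (fun n : nat => n%:R^-1 : R)); exact: cvg_harmonic.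
Qed.

Lemma cvg_sqrt_natV : (Num.sqrt (n%:R^-1) : R) @[n --> \oo] --> (0 : R).
Proof.
rewrite -[X in _ --> X]sqrtr0.
exact: (continuous_cvg _ (@sqrt_continuous R 0) cvg_natV).
Qed.

(** As a function of a squared length r = |h|^2, this is min(|h|^2, |h|^3). *)
Definition mincube (r : R) : R := Num.min r (r * Num.sqrt r).

Lemma mincube_ge0 r : 0 <= r -> 0 <= mincube r.
Proof. by move=> r0; rewrite le_min r0 mulr_ge0// sqrtr_ge0. Qed.

Lemma le_mincube r r' : 0 <= r -> r <= r' -> mincube r <= mincube r'.
Proof.
move=> r0 rr; rewrite le_min !ge_min rr /=; apply/orP; right.
by apply: ler_pM => //; rewrite ?sqrtr_ge0// ler_sqrt// (le_trans r0).
Qed.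

Lemma measurable_mincube : measurable_fun setT mincube.
Proof.
apply: measurable_minr => //; apply: measurable_funM => //.
exact: (continuous_measurable_fun (@sqrt_continuous R)).
Qed.

(** Q, b and p stand for a quadratic form at (x, x), (x, h) and (h, h). Only the coordinate y = b /
    sqrt p of x along h moves; the rest Q - y^2, nonnegative by Cauchy-Schwarz, factors out as a
    number at most 1 and leaves the one-dimensional estimate. *)
Lemma gauss_step (Q b p : R) : 0 <= Q -> 0 <= p -> b ^+ 2 <= Q * p ->
  `|expR (- (Q + 2 * b + p)) - expR (- Q) * (1 - 2 * b - p + 2 * b ^+ 2)|
  <= 1000 * mincube p.
Proof.
move=> Q0; rewrite le_eqVlt => /predU1P[<-|p0] bQ.
  have b0 : b = 0 by apply/eqP; rewrite -sqrf_eq0 eq_le sqr_ge0 andbT -(mulr0 Q).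
  have -> : - (Q + 2 * b + 0) = - Q by rewrite b0; ring.
  have -> : 1 - 2 * b - 0 + 2 * b ^+ 2 = 1 by rewrite b0; ring.
  rewrite [_ * 1]mulr1 subrr normr0.
  by apply: mulr_ge0; [exact: ler0n|exact: mincube_ge0].
pose r := Num.sqrt p.
have r0 : 0 < r by rewrite sqrtr_gt0.
have r2 : r ^+ 2 = p by rewrite sqr_sqrtr// ltW.
pose y := b / r.
have yr : y * r = b by rewrite /y mulfVK// gt_eqF.
have yQ : y ^+ 2 <= Q by rewrite /y expr_div_n r2 ler_pdivrMr.
have := @gauss_taylor _ y r (ltW r0); rewrite yr r2.
have -> : Num.min p (r ^+ 3) = mincube p by rewrite exprSr r2.
have -> : - (Q + 2 * b + p) = - (Q - y ^+ 2) - (y + r) ^+ 2.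
  by rewrite -yr -r2; ring.
have -> : - Q = - (Q - y ^+ 2) - y ^+ 2 by ring.
rewrite !expRD -mulrA -mulrBr normrM (ger0_norm (expR_ge0 _)) => h.
rewrite -[leRHS]mul1r; apply: ler_pM => //.
by rewrite expR_le1 oppr_le0 subr_ge0.
Qed.

End gauss_step.

(** * Replacement of the summands along the heat flow *)

Section lindeberg.
Context {d d' : measure_display} {Omega : measurableType d}
  {T : measurableType d'} {R : realType}.
Variables (P : probability Omega R) (V : nat -> Omega -> T).
Hypothesis mV : forall i, measurable_fun setT (V i).
Hypothesis indV : forall (J : {fset nat}) (B : nat -> set T),
  (forall i, measurable (B i)) ->
  P (\bigcap_(i in [set` J]) V i @^-1` B i) =
  (\prod_(i <- J) P (V i @^-1` B i))%E.
Hypothesis idV : forall i j (B : set T), measurable B ->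
  P (V i @^-1` B) = P (V j @^-1` B).
Variables (K : nat) (zeta : T -> 'cV[R]_K) (Sg : 'M[R]_K).
Hypothesis mz : forall a, measurable_fun setT (fun x => zeta x a 0).
Hypothesis z2 : forall a, moment P 2 (fun w => zeta (V 0%N w) a 0).
Hypothesis z0 : forall a, \int[P]_w zeta (V 0%N w) a 0 = 0.
Hypothesis zV : forall a b,
  \int[P]_w (zeta (V 0%N w) a 0 * zeta (V 0%N w) b 0) = Sg a b.
Hypothesis uSg : Sg \in unitmx.

Local Notation A := (invmx Sg).
Local Notation q x := (bil A x x).

Lemma cov_sym : Sg^T = Sg.
Proof.
apply/matrixP => a b; rewrite mxE -!zV; apply: eq_Rintegral => w _.
by rewrite mulrC.
Qed.

Lemma invcov_sym : A^T = A.
Proof. by rewrite trmx_inv cov_sym. Qed.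

Lemma cov_integrable a b :
  P.-integrable setT (EFin \o (fun w => zeta (V 0%N w) a 0 * zeta (V 0%N w) b 0)).
Proof. by apply/moment1_integrable; exact: momentM. Qed.

Lemma cov_psd (c : 'cV[R]_K) : 0 <= bil Sg c c.
Proof.
have -> : bil Sg c c = \int[P]_w (\sum_a c a 0 * zeta (V 0%N w) a 0) ^+ 2.
  under eq_Rintegral do rewrite expr2 mulr_suml.
  rewrite (int_sum _ _).1; last first.
    move=> a _; apply/moment1_integrable.
    by apply: momentM; [exact: momentZ|apply: moment_sum => b _; exact: momentZ].
  rewrite /bil -mulmxA mxE; apply: eq_bigr => a _; rewrite mxE.
  under eq_Rintegral do rewrite mulr_sumr.
  rewrite (int_sum _ _).1; last first.
    by move=> b _; apply/moment1_integrable; apply: momentM; exact: momentZ.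
  rewrite mxE mulr_sumr; apply: eq_bigr => b _.
  under [RHS]eq_Rintegral do rewrite mulrACA.
  by rewrite RintegralZl ?zV//; [ring|exact: cov_integrable].
by apply: Rintegral_ge0 => w _; exact: sqr_ge0.
Qed.

Lemma invcov_psd x : 0 <= q x.
Proof.
have -> : q x = bil Sg (A *m x) (A *m x).
  rewrite /bil trmx_mul invcov_sym !mulmxA; congr ((_ *m _) 0 0).
  by rewrite -!mulmxA [Sg *m A]mulmxV// mulmx1.
exact: cov_psd.
Qed.

Lemma q_ind_integrable : P.-integrable setT (EFin \o (fun w => q (zeta (V 0%N w)))).
Proof.
apply/moment1_integrable.
have -> : (fun w => q (zeta (V 0%N w))) = (fun w => \sum_b \sum_a
    A a b * (zeta (V 0%N w) a 0 * zeta (V 0%N w) b 0)).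
  apply/funext => w; rewrite bilE; apply: eq_bigr => b _.
  by rewrite mxE mulr_suml; apply: eq_bigr => a _; rewrite mxE; ring.
by apply: moment_sum => b _; apply: moment_sum => a _; apply: momentZ; exact: momentM.
Qed.

(** The mean is the trace of [Sg] times its inverse; this is where the number of degrees of freedom
    enters. *)
Lemma q_expect : \int[P]_w q (zeta (V 0%N w)) = K%:R.
Proof.
have E w : q (zeta (V 0%N w)) = \sum_b \sum_a
    A a b * (zeta (V 0%N w) a 0 * zeta (V 0%N w) b 0).
  rewrite bilE; apply: eq_bigr => b _.
  by rewrite mxE mulr_suml; apply: eq_bigr => a _; rewrite mxE; ring.
under eq_Rintegral do rewrite E.
rewrite (int_sum _ _).1; last first.
  move=> b _; apply/moment1_integrable; apply: moment_sum => a _.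
  by apply: momentZ; exact: momentM.
transitivity (\tr (Sg *m A)).
  rewrite /mxtrace; apply: eq_bigr => b _.
  rewrite (int_sum _ _).1; last first.
    by move=> a _; apply/moment1_integrable; apply: momentZ; exact: momentM.
  rewrite mxE; apply: eq_bigr => a _.
  by rewrite RintegralZl ?zV//; [rewrite mulrC; congr (_ * _); rewrite -[in RHS]cov_sym mxE|exact: cov_integrable].
by rewrite mulmxV// mxtrace1.
Qed.

Definition psum (n : nat) (w : Omega) : 'cV[R]_K := \sum_(i < n) zeta (V i w).

Local Notation past k := (g_sigma_algebraType (past_cyl V k)).

Let mpast k (f : Omega -> R) := @measurable_fun _ _ (past k) R setT f.

Lemma psumE n w a : psum n w a 0 = \sum_(i < n) zeta (V i w) a 0.
Proof. by rewrite /psum summxE. Qed.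

Lemma mpast_psum k a : mpast k (fun w => psum k w a 0).
Proof.
rewrite /mpast; under eq_fun do rewrite psumE.
exact: (@measurable_past_sum _ _ _ _ R V k (fun x => zeta x a 0) (mz a)).
Qed.

Lemma moment_psum k a : moment P 2 (fun w => psum k w a 0).
Proof.
under eq_fun do rewrite psumE.
exact: (@moment_iid_sum _ _ _ _ R P V mV idV 2 k (fun x => zeta x a 0)).
Qed.

Let yv k b (w : Omega) : R := ((psum k w)^T *m A) 0 b.

Let yvE k b w : yv k b w = \sum_a A a b * psum k w a 0.
Proof. by rewrite /yv mxE; apply: eq_bigr => a _; rewrite mxE mulrC. Qed.

Let mpast_yv k b : mpast k (yv k b).
Proof.
rewrite /mpast (_ : yv k b = fun w => \sum_a A a b * psum k w a 0); last first.
  by apply/funext => w; rewrite yvE.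
apply: measurable_sum => a; apply: measurable_funM => //; exact: mpast_psum.
Qed.

Let moment_yv k b : moment P 2 (yv k b).
Proof.
rewrite (_ : yv k b = fun w => \sum_a A a b * psum k w a 0); last first.
  by apply/funext => w; rewrite yvE.
by apply: moment_sum => a _; apply: momentZ; exact: moment_psum.
Qed.

Let qpsumE k w : q (psum k w) = \sum_b yv k b w * psum k w b 0.
Proof. by rewrite bilE. Qed.

Let mpast_q k : mpast k (fun w => q (psum k w)).
Proof.
rewrite /mpast; under eq_fun do rewrite qpsumE.
apply: measurable_sum => b; apply: measurable_funM.
  exact: mpast_yv.
exact: mpast_psum.
Qed.

Lemma measurable_qpsum k : measurable_fun setT (fun w => q (psum k w)).
Proof. exact: (past_fun_measurable mV (@mpast_q k)). Qed.

Let q_integrable k : P.-integrable setT (EFin \o (fun w => q (psum k w))).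
Proof.
apply/moment1_integrable; under eq_fun do rewrite qpsumE.
apply: moment_sum => b _; apply: momentM; [exact: moment_yv|exact: moment_psum].
Qed.

(** Expanding in coordinates, every term of a second-order expansion in the new summand is a finite
    sum of products (past factor) * (function of [V k]), and such a sum decouples. *)
Lemma past_sum_integralM k (I : finType) (X : I -> Omega -> R) (G : I -> T -> R) :
  (forall i, mpast k (X i)) -> (forall i, measurable_fun setT (G i)) ->
  (forall i, P.-integrable setT (EFin \o X i)) ->
  (forall i, P.-integrable setT (EFin \o (fun w => G i (V 0%N w)))) ->
  P.-integrable setT (EFin \o (fun w => \sum_i X i w * G i (V k w))) /\
  \int[P]_w (\sum_i X i w * G i (V k w)) =
  \sum_i (\int[P]_w X i w) * \int[P]_w G i (V 0%N w).
Proof.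
move=> mX mG iX iG.
have iGk i := @ident_integrable _ _ _ _ R P V mV idV k (G i) (mG i) (iG i).
have h i := @past_integralM _ _ _ _ R P V mV indV k (X i) (G i) (mX i) (mG i) (iX i) (iGk i).
have [e1 e2] := @int_sum _ _ _ P I (index_enum I) xpredT
  (fun i w => X i w * G i (V k w)) (fun i _ => (h i).1).
split=> //; rewrite e1; apply: eq_bigr => i _; rewrite (h i).2.
by rewrite (@ident_integral _ _ _ _ R P V mV idV k (G i)).
Qed.

Let measurable_qzeta : measurable_fun setT (fun x => q (zeta x)).
Proof.
rewrite (_ : (fun x => q (zeta x)) = fun x => \sum_b (\sum_a A a b * zeta x a 0) * zeta x b 0).
  apply: measurable_sum => b; apply: measurable_funM => //.
  by apply: measurable_sum => a; apply: measurable_funM.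
apply/funext => x; rewrite bilE; apply: eq_bigr => b _; congr (_ * _).
by rewrite mxE; apply: eq_bigr => a _; rewrite mxE mulrC.
Qed.

Section step.
Variables (k : nat) (phi : Omega -> R).
Hypothesis mphi : mpast k phi.
Hypothesis phi01 : forall w, 0 <= phi w <= 1.

Let mphi' : measurable_fun setT phi.
Proof. exact: (past_fun_measurable mV mphi). Qed.

Let phi_abs w : `|phi w| <= 1.
Proof. by case/andP: (phi01 w) => p0 p1; rewrite ger0_norm. Qed.

Lemma step_phi : P.-integrable setT (EFin \o phi).
Proof.
by apply/moment1_integrable; apply: (moment_bounded P 1 mphi' phi_abs).
Qed.

Lemma step_lin :
  P.-integrable setT (EFin \o (fun w => phi w * bil A (psum k w) (zeta (V k w)))) /\
  \int[P]_w (phi w * bil A (psum k w) (zeta (V k w))) = 0.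
Proof.
have [|b|b|b|] := @past_sum_integralM k 'I_K (fun b w => phi w * yv k b w) (fun b x => zeta x b 0).
- by move=> b; apply: measurable_funM; [exact: mphi|exact: mpast_yv].
- exact: mz.
- apply/moment1_integrable; apply: (momentM_bounded mphi' phi_abs).
  exact: (moment_leq _ (moment_yv k b)).
- exact: (moment_integrable _ (z2 b)).
have E : (fun w => phi w * bil A (psum k w) (zeta (V k w))) =
  (fun w => \sum_b phi w * yv k b w * zeta (V k w) b 0).
  by apply/funext => w; rewrite bilE mulr_sumr; apply: eq_bigr => b _; rewrite mulrA.
rewrite E => i ->; split=> //.
by apply: big1 => b _; rewrite z0 mulr0.
Qed.

Lemma step_quad :
  P.-integrable setT (EFin \o (fun w => phi w * q (zeta (V k w)))) /\
  \int[P]_w (phi w * q (zeta (V k w))) = K%:R * \int[P]_w phi w.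
Proof.
have [||||] := @past_sum_integralM k 'I_1 (fun _ => phi) (fun _ x => q (zeta x)).
- by move=> _; exact: mphi.
- by move=> _; exact: measurable_qzeta.
- by move=> _; exact: step_phi.
- by move=> _; exact: q_ind_integrable.
have E : (fun w => \sum_(i < 1) phi w * q (zeta (V k w))) =
         (fun w => phi w * q (zeta (V k w))).
  by apply/funext => w; rewrite big_ord1.
by rewrite E big_ord1 q_expect [RHS]mulrC.
Qed.

(** Given the past, (S' A zeta)^2 has mean S' A Sg A S = S' A S. The second-order term thus
    reproduces the form itself, and the recursion closes on functions of q alone. *)
Lemma step_sqr :
  P.-integrable setT (EFin \o (fun w => phi w * bil A (psum k w) (zeta (V k w)) ^+ 2)) /\
  \int[P]_w (phi w * bil A (psum k w) (zeta (V k w)) ^+ 2) =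
  \int[P]_w (phi w * q (psum k w)).
Proof.
have iyy (b : 'I_K * 'I_K) :
    P.-integrable setT (EFin \o (fun w => phi w * (yv k b.1 w * yv k b.2 w))).
  apply/moment1_integrable; apply: (momentM_bounded mphi' phi_abs).
  by apply: momentM; exact: moment_yv.
have [|b|b|b|] := @past_sum_integralM k ('I_K * 'I_K)%type
  (fun b w => phi w * (yv k b.1 w * yv k b.2 w)) (fun b x => zeta x b.1 0 * zeta x b.2 0).
- move=> b; apply: measurable_funM; first exact: mphi.
  by apply: measurable_funM; exact: mpast_yv.
- exact: measurable_funM.
- exact: iyy.
- exact: cov_integrable.
have E : (fun w => phi w * bil A (psum k w) (zeta (V k w)) ^+ 2) =
  (fun w => \sum_(b : 'I_K * 'I_K) phi w * (yv k b.1 w * yv k b.2 w) *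
      (zeta (V k w) b.1 0 * zeta (V k w) b.2 0)).
  apply/funext => w; rewrite bilE expr2 big_distrlr /= pair_big /= mulr_sumr.
  by apply: eq_bigr => b _; rewrite -/(yv k b.1 w) -/(yv k b.2 w); ring.
rewrite E => i ->; split=> //.
have qE w : q (psum k w) = \sum_(b : 'I_K * 'I_K) yv k b.1 w * yv k b.2 w * Sg b.1 b.2.
  have -> : q (psum k w) = bil Sg (A *m psum k w) (A *m psum k w).
    rewrite /bil trmx_mul invcov_sym !mulmxA; congr ((_ *m _) 0 0).
    by rewrite -!mulmxA [Sg *m A]mulmxV// mulmx1.
  have yE b : (A *m psum k w) b 0 = yv k b w.
    transitivity ((A *m psum k w)^T 0 b); first by rewrite [RHS]mxE.
    by rewrite trmx_mul invcov_sym.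
  rewrite bilE.
  rewrite -(pair_big xpredT xpredT (fun b c => yv k b w * yv k c w * Sg b c)) /= exchange_big /=.
  apply: eq_bigr => b _; rewrite mxE mulr_suml yE; apply: eq_bigr => a _.
  by rewrite mxE yE; ring.
under [RHS]eq_Rintegral do rewrite qE mulr_sumr.
rewrite (int_sum _ _).1.
  apply: eq_bigr => b _; rewrite zV -RintegralZr//.
  by apply: eq_Rintegral => w _; ring.
move=> b _; have := rintegrableZ (Sg b.1 b.2) (iyy b).
by congr (_.-integrable _ _); apply/funext => w /=; congr EFin; ring.
Qed.

End step.

(** For [Kc] = K/2 and x = q(y), this is the mean of exp(- s q(y + sqrt t G)) with G a centred
    Gaussian vector of covariance [Sg]; t is the fraction of the summands already replaced. *)
Definition heat (s Kc t x : R) : R :=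
  expR (- (Kc * ln (1 + 2 * s * t)) - s / (1 + 2 * s * t) * x).

(** Total remainder over n replacements: n times the mean of min(|h|^2, |h|^3) for one rescaled
    summand h. *)
Definition lindeberg_rest (s : R) (n : nat) : R :=
  \int[P]_w (n%:R * mincube (s * (n%:R^-1 * q (zeta (V 0%N w))))).

Lemma rest_integrable k s n : 0 <= s ->
  P.-integrable setT (EFin \o (fun w => mincube (s * (n%:R^-1 * q (zeta (V k w)))))).
Proof.
move=> s0.
have iq := @ident_integrable _ _ _ _ R P V mV idV k _ measurable_qzeta q_ind_integrable.
apply: (rintegrable_le _ (rintegrableZ s (rintegrableZ n%:R^-1 iq))).
  apply: (measurableT_comp measurable_mincube); apply: measurable_funM => //; apply: measurable_funM => //.
  by case/integrableP : iq => /measurable_EFinP.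
move=> w; have h : 0 <= s * (n%:R^-1 * q (zeta (V k w))).
  by rewrite !mulr_ge0// ?invr_ge0//; exact: invcov_psd.
by rewrite ger0_norm ?mincube_ge0// ge_min lexx.
Qed.

Lemma rest_integral k s n : 0 <= s -> (0 < n)%N ->
  \int[P]_w mincube (s * (n%:R^-1 * q (zeta (V k w)))) = n%:R^-1 * lindeberg_rest s n.
Proof.
move=> s0 n0; rewrite /lindeberg_rest RintegralZl//; last exact: rest_integrable.
rewrite mulKf; last by rewrite pnatr_eq0 -lt0n.
apply: (@ident_integral _ _ _ _ R P V mV idV k
  (fun x => mincube (s * (n%:R^-1 * q (zeta x))))); last exact: rest_integrable.
apply: (measurableT_comp measurable_mincube).
by do 2!apply: measurable_funM => //; exact: measurable_qzeta.
Qed.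

Lemma heat_bound s c t x : 0 <= s -> 0 <= c -> 0 <= t -> 0 <= x ->
  0 <= heat s c t x <= 1.
Proof.
move=> s0 c0 t0 x0; rewrite expR_ge0 /= expR_le1.
have h : 0 <= 2 * s * t by rewrite !mulr_ge0.
have := mulr_ge0 c0 (@ln_ge0 _ (1 + 2 * s * t) _); rewrite lerDl => /(_ h) h1.
have : 0 <= s / (1 + 2 * s * t) * x by rewrite mulr_ge0// divr_ge0//; lra.
lra.
Qed.

Lemma mpast_heat s c t (r : R) k : mpast k (fun w => heat s c t (r * q (psum k w))).
Proof.
apply: (@measurableT_comp _ _ _ _ _ _ (fun x : R => expR (- (c * ln (1 + 2 * s * t))
   - s / (1 + 2 * s * t) * (r * x)))); last exact: mpast_q.
apply: measurableT_comp => //; apply: measurable_funB => //.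
by do 2!apply: measurable_funM => //.
Qed.

Lemma heat_integrable s c t r k : 0 <= s -> 0 <= c -> 0 <= t -> 0 <= r ->
  P.-integrable setT (EFin \o (fun w => heat s c t (r * q (psum k w)))).
Proof.
move=> s0 c0 t0 r0; apply/moment1_integrable.
apply: (@moment_bounded _ _ _ P 1 _ 1); first exact: (past_fun_measurable mV (@mpast_heat s c t r k)).
move=> w; have /andP[h1 h2] := heat_bound s0 c0 t0 (mulr_ge0 r0 (invcov_psd (psum k w))).
by rewrite ger0_norm.
Qed.

(** Summand k is traded for a time increment 1/n. Both integrals are compared with second-order
    expansions, [Tm] in space and [Tm'] in time, whose means coincide. The condition 2 s <= n keeps
    the relative time increment below 1. *)
Lemma lindeberg_step s (n j k : nat) : 0 <= s -> (j < n)%N -> 2 * s <= n%:R ->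
  forall c r, c = K%:R / 2 -> r = n%:R^-1 ->
  `|\int[P]_w heat s c (j%:R * r) (r * q (psum k.+1 w)) -
    \int[P]_w heat s c (j.+1%:R * r) (r * q (psum k w))| <=
  1000 * (r * lindeberg_rest s n) + 100 * (1 + c) ^+ 2 * (2 * s * r) ^+ 2.
Proof.
move=> s0 jn sn _ _ -> ->; set c := K%:R / 2; set r := n%:R^-1.
have n0 : (0 < n)%N by apply: leq_ltn_trans (leq0n j) jn.
have nR0 : 0 < n%:R :> R by rewrite ltr0n.
have r0 : 0 < r by rewrite invr_gt0.
have c0 : 0 <= c by rewrite divr_ge0.
have t0 : 0 <= j%:R * r by rewrite mulr_ge0// ltW.
have t0' : 0 <= j.+1%:R * r by rewrite mulr_ge0// ltW.
pose dn := 1 + 2 * s * (j%:R * r).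
have dn1 : 1 <= dn by rewrite lerDl !mulr_ge0// ltW.
have dn0 : 0 < dn by lra.
pose a := s / dn.
have a0 : 0 <= a by rewrite divr_ge0// ltW.
have as_ : a <= s by rewrite ler_pdivrMr// ler_peMr.
(* Relative increment of 1 + 2 s t when t grows by 1/n: 1 + 2 s (j+1)/n = dn (1 + w_). *)
pose w_ := 2 * a * r.
have w0 : 0 <= w_ by apply: mulr_ge0 (ltW r0); exact: mulr_ge0.
have ws : w_ <= 2 * s * r by apply: ler_wpM2r (ltW r0) _ _ _; exact: ler_wpM2l.
have w1 : w_ <= 1.
  by apply: (le_trans ws); rewrite /r ler_pdivrMr// mul1r.
pose C0 := expR (- (c * ln dn)).
have C00 : 0 <= C0 by exact: expR_ge0.
have C01 : C0 <= 1.
  by rewrite expR_le1 oppr_le0 mulr_ge0// ln_ge0.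
pose Q w := r * q (psum k w).
have Q0 w : 0 <= Q w by rewrite mulr_ge0 ?(ltW r0)//; exact: invcov_psd.
pose phi w := expR (- (a * Q w)).
have phi01 w : 0 <= phi w <= 1.
  by rewrite expR_ge0 expR_le1 oppr_le0 mulr_ge0.
have mphi : mpast k phi.
  apply: (@measurableT_comp _ _ _ _ _ _ (fun x : R => expR (- (a * (r * x))))); last exact: mpast_q.
  apply: measurableT_comp => //; apply: measurableT_comp => //.
  by do 2!apply: measurable_funM => //.
pose b w := bil A (psum k w) (zeta (V k w)).
pose p w := q (zeta (V k w)).
have [i1 e1] := step_lin mphi phi01.
have [i2 e2] := step_quad mphi phi01.
have [i3 e3] := step_sqr mphi phi01.
have i0 := step_phi mphi phi01.
have iphiq : P.-integrable setT (EFin \o (fun w => phi w * q (psum k w))).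
  apply/moment1_integrable; apply: (@momentM_bounded _ _ _ P 1 _ _ 1).
  - exact: (past_fun_measurable mV mphi).
  - by move=> w; case/andP: (phi01 w) => h1 h2; rewrite ger0_norm.
  - by apply/moment1_integrable; exact: q_integrable.
pose Tm w := C0 * (phi w * (1 - 2 * (a * (r * b w)) - a * (r * p w)
                + 2 * (a * (r * b w)) ^+ 2)).
pose Tm' w := C0 * (phi w * (1 - c * w_ + w_ * (a * Q w))).
have TmE : Tm = fun w => (C0 * phi w + (- (2 * a * r) * C0) * (phi w * b w)) +
    ((- (a * r * C0)) * (phi w * p w) + (2 * a ^+ 2 * r ^+ 2 * C0) * (phi w * b w ^+ 2)).
  by apply/funext => w; rewrite /Tm; ring.
have TmE' : Tm' = fun w => (C0 * (1 - c * w_)) * phi w + (C0 * w_ * a * r) * (phi w * q (psum k w)).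
  by apply/funext => w; rewrite /Tm' /Q; ring.
have iTm : P.-integrable setT (EFin \o Tm).
  rewrite TmE; apply: rintegrableD; apply: rintegrableD; exact: rintegrableZ.
have iTm' : P.-integrable setT (EFin \o Tm').
  rewrite TmE'; apply: rintegrableD; exact: rintegrableZ.
(* In mean the linear term is 0, the quadratic one gives K and the square gives q. The coefficients
   then match: a r K = c w_ and 2 a^2 r^2 = w_ a r. *)
have ETm : \int[P]_w Tm w = \int[P]_w Tm' w.
  rewrite TmE TmE' !RintegralD//; try (apply: rintegrableD); try exact: rintegrableZ.
  by rewrite !RintegralZl// e1 e2 e3 /w_ /c; field.
have i4 := heat_integrable k.+1 s0 c0 t0 (ltW r0).
have i5 := heat_integrable k s0 c0 t0' (ltW r0).
have B1 : `|\int[P]_w heat s c (j%:R * r) (r * q (psum k.+1 w)) - \int[P]_w Tm w|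
   <= 1000 * (r * lindeberg_rest s n).
  rewrite -RintegralB// -(rest_integral k s0 n0) -RintegralZl//; last exact: rest_integrable.
  apply: le_trans (le_normr_Rintegral _ _) _ => //; first exact: rintegrableB.
  apply: le_Rintegral => //.
  - by apply: integrable_norm; exact: rintegrableB.
  - by apply: rintegrableZ; exact: rest_integrable.
  move=> w _.
  have qk1 : q (psum k.+1 w) = q (psum k w) + 2 * b w + p w.
    by rewrite /psum big_ord_recr /= bilD//; exact: invcov_sym.
  have -> : heat s c (j%:R * r) (r * q (psum k.+1 w)) =
      C0 * expR (- (a * Q w + 2 * (a * (r * b w)) + a * (r * p w))).
    by rewrite -expRD /heat qk1 -/dn /a /Q; congr expR; ring.
  rewrite /Tm -mulrBr normrM (ger0_norm C00) -[leRHS]mul1r.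
  have p0 : 0 <= p w by exact: invcov_psd.
  apply: ler_pM => //; apply: le_trans (@gauss_step _ _ _ _ _ _ _) _.
  - exact: mulr_ge0 a0 (Q0 w).
  - exact: mulr_ge0 a0 (mulr_ge0 (ltW r0) p0).
  - rewrite (_ : (a * (r * b w)) ^+ 2 = a ^+ 2 * r ^+ 2 * b w ^+ 2); last by ring.
    rewrite [leRHS](_ : _ = a ^+ 2 * r ^+ 2 * (q (psum k w) * p w)); last by rewrite /Q; ring.
    rewrite ler_wpM2l//; first by rewrite mulr_ge0// sqr_ge0.
    by apply: bil_CS; [exact: invcov_sym|exact: invcov_psd].
  apply: ler_wpM2l; first exact: ler0n.
  apply: le_mincube; first exact: mulr_ge0 a0 (mulr_ge0 (ltW r0) p0).
  by apply: ler_wpM2r => //; exact: mulr_ge0 (ltW r0) p0.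
have B2 : `|\int[P]_w heat s c (j.+1%:R * r) (r * q (psum k w)) - \int[P]_w Tm' w|
   <= 100 * (1 + c) ^+ 2 * (2 * s * r) ^+ 2.
  rewrite -RintegralB//.
  rewrite -[leRHS](int_cst P).
  apply: le_trans (le_normr_Rintegral _ _) _ => //; first exact: rintegrableB.
  apply: le_Rintegral => //.
  - by apply: integrable_norm; exact: rintegrableB.
  - exact: rintegrable_cst.
  move=> w _.
  have dE : 1 + 2 * s * (j.+1%:R * r) = dn * (1 + w_).
    by rewrite /w_ /a -natr1 /dn; field; rewrite -/dn gt_eqF.
  have w1' : 0 < 1 + w_ by rewrite ltr_wpDr.
  have -> : heat s c (j.+1%:R * r) (r * q (psum k w)) =
      C0 * expR (- (c * ln (1 + w_)) - a * Q w / (1 + w_)).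
    rewrite -expRD /heat dE lnM ?posrE// /a -/(Q w); congr expR; field.
    by rewrite !gt_eqF.
  rewrite /Tm' /phi -mulrBr normrM (ger0_norm C00) -[leRHS]mul1r.
  apply: ler_pM => //; apply: le_trans (@heat_taylor _ _ _ _ _ _ _) _ => //.
  - exact: mulr_ge0 a0 (Q0 w).
  - by rewrite w0.
  apply: ler_wpM2l; first by apply: mulr_ge0; [exact: ler0n|exact: sqr_ge0].
  by rewrite lerXn2r ?nnegrE//; exact: le_trans w0 ws.
rewrite ETm in B1; move: B1 B2.
set X := Rintegral _ _ _; set Z := Rintegral _ _ _; set Y := Rintegral _ _ _ => B1 B2.
have -> : X - Y = (X - Z) - (Y - Z) by ring.
by rewrite (le_trans (ler_normB _ _))// lerD.
Qed.

(** Dominated convergence: the first branch of the minimum gives the integrable bound s q, the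
    second gives a pointwise bound of order n^(-1/2). Only second moments of zeta are involved. *)
Lemma lindeberg_rest_cvg s : 0 <= s -> lindeberg_rest s n @[n --> \oo] --> 0.
Proof.
move=> s0.
pose f (n : nat) (w : Omega) : R := n%:R * mincube (s * (n%:R^-1 * q (zeta (V 0%N w)))).
have qp w : 0 <= q (zeta (V 0%N w)) by exact: invcov_psd.
have iq := q_ind_integrable.
have mqz : measurable_fun setT (fun w => q (zeta (V 0%N w))).
  by case/integrableP : iq => /measurable_EFinP.
have f0 n w : 0 <= f n w.
  by apply: mulr_ge0 => //; apply: mincube_ge0; rewrite mulr_ge0// mulr_ge0// invr_ge0.
have fn0 w : f 0%N w = 0 by rewrite /f mul0r.
have fle n w : f n w <= s * q (zeta (V 0%N w)).
  case: n => [|n]; first by rewrite fn0 mulr_ge0.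
  apply: (@le_trans _ _ (n.+1%:R * (s * (n.+1%:R^-1 * q (zeta (V 0%N w)))))).
    by rewrite ler_wpM2l// ge_min lexx.
  by rewrite mulrCA mulVKf ?pnatr_eq0.
have fle2 n w : (0 < n)%N -> f n w <=
    s * q (zeta (V 0%N w)) * Num.sqrt (s * q (zeta (V 0%N w))) * Num.sqrt n%:R^-1.
  move=> n0; apply: (@le_trans _ _ (n%:R * (s * (n%:R^-1 * q (zeta (V 0%N w))) *
      Num.sqrt (s * (n%:R^-1 * q (zeta (V 0%N w))))))).
    by rewrite ler_wpM2l// ge_min lexx orbT.
  set x := q _; have x0 : 0 <= x by exact: qp.
  rewrite [s * (_ * x) in X in Num.sqrt X](_ : _ = (s * x) * n%:R^-1); last by ring.
  rewrite sqrtrM ?mulr_ge0// le_eqVlt; apply/orP; left; apply/eqP.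
  by field; rewrite pnatr_eq0 -lt0n.
have [||||| _ _] := @dominated_convergence _ _ R P setT measurableT
  (fun n w => (f n w)%:E) (fun=> 0%:E) (fun w => (s * q (zeta (V 0%N w)))%:E).
- move=> n; apply/measurable_EFinP; apply: measurable_funM => //.
  apply: (measurableT_comp measurable_mincube).
  by do 2!apply: measurable_funM => //.
- exact: measurable_cst.
- apply/aeW => w _; apply/cvg_EFin; first by near=> n.
  set y := s * q (zeta (V 0%N w)) * Num.sqrt (s * q (zeta (V 0%N w))).
  apply: (@squeeze_cvgr nat \oo _ R (fun=> 0) (fun n => y * Num.sqrt n%:R^-1)
    (fun n => f n w)).
  + near=> n; rewrite f0 fle2//; near: n; exact: nbhs_infty_gt.
  + exact: cvg_cst.
  + rewrite -[X in _ --> X](mulr0 y); apply: cvgMr.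
    exact: cvg_sqrt_natV.
- exact: rintegrableZ.
- by apply/aeW => w n _; rewrite gee0_abs ?lee_fin.
by rewrite integral0 => /fine_cvg.
Unshelve. all: by end_near.
Qed.

Theorem lindeberg_laplace s : 0 <= s ->
  \int[P]_w expR (- (s * (n%:R^-1 * q (psum n w)))) @[n --> \oo] -->
  expR (- (K%:R / 2 * ln (1 + 2 * s))).
Proof.
move=> s0; set c := K%:R / 2.
pose B n : R := 1000 * lindeberg_rest s n + 100 * (1 + c) ^+ 2 * (2 * s) ^+ 2 * n%:R^-1.
have BE n : B n = 1000 * lindeberg_rest s n + 100 * (1 + c) ^+ 2 * (2 * s) ^+ 2 * n%:R^-1 by [].
have B0 : B n @[n --> \oo] --> 0.
  rewrite (_ : 0 = 1000 * 0 + 100 * (1 + c) ^+ 2 * (2 * s) ^+ 2 * 0); last by ring.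
  apply: cvgD; apply: cvgMr; first exact: lindeberg_rest_cvg.
  exact: cvg_natV.
have main n : (0 < n)%N -> 2 * s <= n%:R ->
    `|\int[P]_w expR (- (s * (n%:R^-1 * q (psum n w)))) - expR (- (c * ln (1 + 2 * s)))| <= B n.
  move=> n0 sn; have nR0 : n%:R != 0 :> R by rewrite pnatr_eq0 -lt0n.
  pose b : R := 1000 * (n%:R^-1 * lindeberg_rest s n) + 100 * (1 + c) ^+ 2 * (2 * s * n%:R^-1) ^+ 2.
  have Bb : B n = n%:R * b by rewrite BE /b; field.
  (* With k summands left, the time is (n - k)/n. At k = 0 the heat value at time 1 and x = 0 is the
     limit itself; at k = n the time is 0 and the integral is the Laplace transform. *)
  have ind k : (k <= n)%N ->
    `|\int[P]_w heat s c ((n - k)%:R * n%:R^-1) (n%:R^-1 * q (psum k w)) -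
      expR (- (c * ln (1 + 2 * s)))| <= k%:R * b.
    elim: k => [|k IH] kn.
      rewrite subn0 mul0r mulfV//.
      under eq_Rintegral do rewrite /psum big_ord0 bil0l /heat !mulr0 subr0 mulr1.
      by rewrite int_cst subrr normr0.
    have kn' : (n - k.+1 < n)%N by rewrite ltn_subrL.
    have := lindeberg_step k s0 kn' sn (erefl c) (erefl _).
    rewrite -subSn// subSS => st; have := IH (ltnW kn).
    rewrite -/b in st.
    have -> : k.+1%:R * b = k%:R * b + b by rewrite -natr1 mulrDl mul1r.
    move: st; set X := Rintegral _ _ _; set Y := Rintegral _ _ _; set Z := expR _ => h1 h2.
    have -> : X - Z = (Y - Z) + (X - Y) by ring.
    by rewrite (le_trans (ler_normD _ _))// lerD.
  have := ind n (leqnn n); rewrite subnn mul0r -Bb.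
  under eq_Rintegral do rewrite /heat mulr0 addr0 ln1 mulr0 oppr0 sub0r divr1.
  by [].
apply/cvgrPdist_le => e e0; near=> n.
rewrite distrC; apply: (le_trans (main n _ _)).
- near: n; exact: nbhs_infty_gt.
- near: n; exact: nbhs_infty_ger.
- rewrite (le_trans (ler_norm _))//; near: n.
  by move/cvgr0Pnorm_le : B0; apply.
Unshelve. all: by end_near.
Qed.

End lindeberg.

(** * From Laplace transforms to distribution functions *)

Section bernstein.
Context {R : realType}.

(* [bernstein N g u] is E[g(k)] for k binomial (N, u): conditioning on one trial
   gives the recursion, so no binomial coefficient is needed. *)
Fixpoint bernstein (N : nat) (g : nat -> R) : {poly R} :=
  if N is N'.+1 then
    'X * bernstein N' (fun k => g k.+1) + (1 - 'X) * bernstein N' g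
  else (g 0%N)%:P.

Lemma bernsteinS N g u : (bernstein N.+1 g).[u] =
  u * (bernstein N (fun k => g k.+1)).[u] + (1 - u) * (bernstein N g).[u].
Proof. by rewrite /= !hornerE. Qed.

Lemma bernstein_dist N (g h : nat -> R) c u : 0 <= u <= 1 ->
  (forall k, `|g k - c| <= h k) -> `|(bernstein N g).[u] - c| <= (bernstein N h).[u].
Proof.
move=> /andP[u0 u1]; elim: N g h => [|N IH] g h gh; first by rewrite /= !hornerC.
rewrite !bernsteinS.
have h1 := IH _ _ gh; have h2 := IH _ _ (fun k => gh k.+1).
set a := (bernstein N (fun k => g k.+1)).[u] in h2 *.
set b := (bernstein N g).[u] in h1 *.
have -> : u * a + (1 - u) * b - c = u * (a - c) + (1 - u) * (b - c) by ring.
have u1' : 0 <= 1 - u by rewrite subr_ge0.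
rewrite (le_trans (ler_normD _ _))// !normrM (ger0_norm u0) (ger0_norm u1').
by rewrite lerD// ler_wpM2l.
Qed.

(** The binomial variance. The shift [c] makes the induction go through: one trial changes it by 1 -
    u or by - u, and the average of the squares adds u (1 - u). *)
Lemma bernstein_sqr N (a b c : R) u :
  (bernstein N (fun k => a + b * (k%:R + c - N%:R * u) ^+ 2)).[u] =
  a + b * (N%:R * (u * (1 - u)) + c ^+ 2).
Proof.
elim: N c => [|N IH] c; first by rewrite /= hornerC; ring.
rewrite bernsteinS.
have -> : (fun k : nat => a + b * (k.+1%:R + c - N.+1%:R * u) ^+ 2) =
  (fun k => a + b * (k%:R + (1 + c - u) - N%:R * u) ^+ 2).
  by apply/funext => k; congr (_ + _ * _ ^+ 2); rewrite -!natr1; ring.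
have -> : (fun k : nat => a + b * (k%:R + c - N.+1%:R * u) ^+ 2) =
  (fun k => a + b * (k%:R + (c - u) - N%:R * u) ^+ 2).
  by apply/funext => k; congr (_ + _ * _ ^+ 2); rewrite -!natr1; ring.
by rewrite !IH -natr1; ring.
Qed.

(** With t = k/N - u, the inequality |t| <= dl + t^2/dl bounds the Lipschitz error by a quadratic
    whose binomial mean is exact. The choice of [dl] makes the first part e/2, that of [N] makes the
    variance part at most e/2. *)
Lemma lipschitz_poly_approx (f : R -> R) (L e : R) : 0 < e -> 0 < L ->
  (forall x y, `|f x - f y| <= L * `|x - y|) ->
  exists p : {poly R}, forall u, 0 <= u <= 1 -> `|p.[u] - f u| <= e.
Proof.
move=> e0 L0 fL.
pose dl := e / (2 * L).
have dl0 : 0 < dl by rewrite divr_gt0// mulr_gt0.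
have dle0 : 0 < dl * e / 2 by rewrite divr_gt0// mulr_gt0.
have [N NE] : exists N : nat, L / (dl * e / 2) < N%:R.
  exists (Num.bound (L / (dl * e / 2))).
  by apply: archi_boundP; rewrite divr_ge0// ltW.
have N0 : 0 < N%:R :> R by apply: le_lt_trans NE; rewrite divr_ge0// ltW.
exists (bernstein N (fun k => f (k%:R / N%:R))) => u u01.
apply: (le_trans (@bernstein_dist _ _
   (fun k => L * dl + L / (dl * N%:R ^+ 2) * (k%:R + 0 - N%:R * u) ^+ 2) _ _ u01 _)).
  move=> k; apply: (le_trans (fL _ _)).
  set t := _ - u.
  have -> : (k%:R + 0 - N%:R * u) ^+ 2 = N%:R ^+ 2 * t ^+ 2.
    by rewrite /t; field; rewrite gt_eqF.
  have -> : L / (dl * N%:R ^+ 2) * (N%:R ^+ 2 * t ^+ 2) = L * (t ^+ 2 / dl).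
    by field; rewrite !gt_eqF.
  rewrite -mulrDr ler_wpM2l ?(ltW L0)//.
  rewrite -(@ler_pM2r _ dl)// mulrDl divfK ?gt_eqF//.
  rewrite -(real_normK (num_real t)); have := normr_ge0 t; move: `|t| => s s0.
  have := sqr_ge0 (dl - s); nra.
rewrite bernstein_sqr.
have -> : L * dl = e / 2 by rewrite /dl; field; rewrite gt_eqF.
have -> : L / (dl * N%:R ^+ 2) * (N%:R * (u * (1 - u)) + 0 ^+ 2) =
    (L / dl / N%:R) * (u * (1 - u)) by field; rewrite !gt_eqF.
have uu : u * (1 - u) <= 1 by case/andP: u01; nra.
have uu0 : 0 <= u * (1 - u) by case/andP: u01 => ? ?; rewrite mulr_ge0// subr_ge0.
have h : L / dl / N%:R <= e / 2.
  rewrite ler_pdivrMr// ler_pdivrMr//.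
  by move: NE; rewrite ltr_pdivrMr// => /ltW; lra.
have h0 : 0 <= L / dl / N%:R by rewrite divr_ge0// divr_ge0 ?ltW.
have : L / dl / N%:R * (u * (1 - u)) <= L / dl / N%:R by rewrite ler_piMr.
lra.
Qed.

End bernstein.

Section laplace_cdf.
Context {d d' : measure_display} {Omega : measurableType d}
  {Omega' : measurableType d'} {R : realType}.
Variables (P : probability Omega R) (P' : probability Omega' R).
Variables (Y : nat -> Omega -> R) (Z : Omega' -> R).
Hypothesis mY : forall n, measurable_fun setT (Y n).
Hypothesis mZ : measurable_fun setT Z.
Hypothesis Y0 : forall n w, 0 <= Y n w.
Hypothesis Z0 : forall w, 0 <= Z w.
Hypothesis lap : forall k : nat,
  \int[P]_w expR (- (k%:R * Y n w)) @[n --> \oo] --> \int[P']_w expR (- (k%:R * Z w)).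

Let u01 (y : R) : 0 <= y -> 0 <= expR (- y) <= 1.
Proof. by move=> y0; rewrite expR_ge0 expR_le1 oppr_le0. Qed.

Lemma exp_power_integrable d0 (T : measurableType d0) (Q : probability T R) (X : T -> R) k :
  measurable_fun setT X -> (forall w, 0 <= X w) ->
  Q.-integrable setT (EFin \o (fun w => expR (- X w) ^+ k)).
Proof.
move=> mX X0; apply/moment1_integrable; apply: (@moment_bounded _ _ _ Q 1 _ 1).
  apply: measurable_funX; apply: measurableT_comp => //; exact: measurableT_comp.
move=> w; have /andP[h0 h1] := u01 (X0 w).
by rewrite ger0_norm ?exprn_ge0// exprn_ile1.
Qed.

Lemma poly_exp_integral d0 (T : measurableType d0) (Q : probability T R) (X : T -> R) (p : {poly R}) :
  measurable_fun setT X -> (forall w, 0 <= X w) ->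
  Q.-integrable setT (EFin \o (fun w => p.[expR (- X w)])) /\
  \int[Q]_w p.[expR (- X w)] = \sum_(i < size p) p`_i * \int[Q]_w expR (- (i%:R * X w)).
Proof.
move=> mX X0.
have [e1 e2] := @int_sum _ _ _ Q 'I_(size p) (index_enum _) xpredT
  (fun i w => p`_i * expR (- X w) ^+ i)
  (fun i _ => rintegrableZ _ (exp_power_integrable Q i mX X0)).
have E : (fun w => p.[expR (- X w)]) = (fun w => \sum_(i < size p) p`_i * expR (- X w) ^+ i).
  by apply/funext => w; rewrite horner_coef.
split; first by rewrite E.
rewrite E e1; apply: eq_bigr => i _.
rewrite RintegralZl//; last exact: exp_power_integrable.
by congr (_ * _); apply: eq_Rintegral => w _; rewrite -expRM_natl mulrN.
Qed.

Lemma poly_exp_cvg (p : {poly R}) :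
  \int[P]_w p.[expR (- Y n w)] @[n --> \oo] --> \int[P']_w p.[expR (- Z w)].
Proof.
rewrite (poly_exp_integral P' p mZ Z0).2.
under eq_fun do rewrite (poly_exp_integral P p (mY _) (Y0 _)).2.
apply: cvg_big => // [|i _]; last by apply: cvgMr; exact: lap.
exact: add_continuous.
Qed.

Lemma lipschitz_integrable d0 (T : measurableType d0) (Q : probability T R) (X : T -> R)
    (f : R -> R) :
  measurable_fun setT X -> measurable_fun setT f -> (forall u, 0 <= f u <= 1) ->
  Q.-integrable setT (EFin \o (fun w => f (expR (- X w)))).
Proof.
move=> mX mf f01; apply/moment1_integrable; apply: (@moment_bounded _ _ _ Q 1 _ 1).
  apply: measurableT_comp => //; apply: measurableT_comp => //; exact: measurableT_comp.
by move=> w; case/andP: (f01 (expR (- X w))) => h0 h1; rewrite ger0_norm.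
Qed.

Lemma lipschitz_exp_cvg (f : R -> R) (L : R) : 0 < L -> measurable_fun setT f ->
  (forall u, 0 <= f u <= 1) -> (forall x y, `|f x - f y| <= L * `|x - y|) ->
  \int[P]_w f (expR (- Y n w)) @[n --> \oo] --> \int[P']_w f (expR (- Z w)).
Proof.
move=> L0 mf f01 fL; apply/cvgrPdist_le => e e0.
have [p pf] := @lipschitz_poly_approx R f L (e / 3) (divr_gt0 e0 (ltr0Sn _ _)) L0 fL.
have close d0 (T : measurableType d0) (Q : probability T R) (X : T -> R) :
    measurable_fun setT X -> (forall w, 0 <= X w) ->
    `|\int[Q]_w p.[expR (- X w)] - \int[Q]_w f (expR (- X w))| <= e / 3.
  move=> mX X0; have ip := (poly_exp_integral Q p mX X0).1.
  have i_f := lipschitz_integrable Q mX mf f01.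
  rewrite -RintegralB// -[leRHS](int_cst Q).
  apply: le_trans (le_normr_Rintegral _ _) _ => //; first exact: rintegrableB.
  apply: le_Rintegral => //.
  - by apply: integrable_norm; exact: rintegrableB.
  - exact: rintegrable_cst.
  - by move=> w _; exact: pf (u01 (X0 w)).
have e3 : 0 < e / 3 by rewrite divr_gt0.
near=> n.
have h1 := close _ _ P (Y n) (mY n) (Y0 n).
have h2 := close _ _ P' Z mZ Z0.
have h3 : `|\int[P']_w p.[expR (- Z w)] - \int[P]_w p.[expR (- Y n w)]| <= e / 3.
  near: n; by move/cvgrPdist_le : (@poly_exp_cvg p); apply.
move: h1 h2 h3; rewrite !ler_norml => /andP[? ?] /andP[? ?] /andP[? ?].
by apply/andP; split; lra.
Unshelve. all: by end_near.
Qed.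

(** Rises linearly from 0 at a to 1 at a + h: a Lipschitz substitute for the indicator of a
    half-line. *)
Definition ramp (a h u : R) : R := Num.min 1 (Num.max 0 ((u - a) / h)).

Lemma ramp01 a h u : 0 <= ramp a h u <= 1.
Proof. by rewrite /ramp le_min ler01 le_max lexx ge_min lexx. Qed.

Lemma measurable_ramp a h : measurable_fun setT (ramp a h).
Proof.
apply: measurable_minr => //; apply: measurable_maxr => //.
by apply: measurable_funM => //; exact: measurable_funB.
Qed.

Lemma ramp_lipschitz a h x y : 0 < h -> `|ramp a h x - ramp a h y| <= h^-1 * `|x - y|.
Proof.
move=> h0; wlog xy : x y / y <= x.
  move=> H; case: (leP y x) => [/H//|/ltW/H].
  by rewrite distrC [X in _ <= _ * X]distrC.
have hV : 0 < h^-1 by rewrite invr_gt0.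
have E : (x - a) / h - (y - a) / h = h^-1 * (x - y) by field; rewrite gt_eqF.
have m : (y - a) / h <= (x - a) / h by rewrite ler_pM2r// lerD2r.
have xy0 : 0 <= x - y by rewrite subr_ge0.
rewrite (ger0_norm xy0) -E /ramp.
move: m {E}; move: ((y - a) / h) ((x - a) / h) => s t ts.
have C (z : R) : (Num.min 1 (Num.max 0 z) = 0 /\ z <= 0) \/
    (Num.min 1 (Num.max 0 z) = z /\ 0 <= z <= 1) \/
    (Num.min 1 (Num.max 0 z) = 1 /\ 1 <= z).
  have [t0|t0] := leP z 0; first by left; rewrite min_r.
  have [t1|t1] := leP z 1; first by right; left; rewrite ltW.
  by right; right; rewrite ltW.
case: (C s) => [[-> ?]|[[-> /andP[? ?]]|[-> ?]]];
  case: (C t) => [[-> ?]|[[-> /andP[? ?]]|[-> ?]]]; rewrite ger0_norm; lra.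
Qed.

Lemma indic_integral_cvg (f : nat -> Omega' -> R) (A : set Omega') : measurable A ->
  (forall m, measurable_fun setT (f m)) -> (forall m w, 0 <= f m w <= 1) ->
  (forall w, \forall m \near \oo, f m w = \1_A w) ->
  \int[P']_w f m w @[m --> \oo] --> fine (P' A).
Proof.
move=> mA mf f01 fA.
have [||||| _ _] := @dominated_convergence _ _ R P' setT measurableT
  (fun m w => (f m w)%:E) (fun w => (\1_A w)%:E) (fun=> 1%:E).
- by move=> m; exact/measurable_EFinP.
- by apply/measurable_EFinP; exact: measurable_indic.
- apply/aeW => w _; apply/cvg_EFin; first by near=> n.
  apply: cvg_near_cst; near=> m => /=; near: m; exact: fA.
- exact: rintegrable_cst.
- apply/aeW => w m _ /=; rewrite lee_fin; case/andP: (f01 m w) => h0 h1.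
  by rewrite ger0_norm.
rewrite integral_indic// setIT -[X in _ --> X]fineK ?fin_num_measure// => /fine_cvg.
by [].
Unshelve. all: by end_near.
Qed.

Lemma cdf_cvg x : 0 <= x -> P' [set w | Z w = x] = 0%E ->
  fine (P [set w | Y n w <= x]) @[n --> \oo] --> fine (P' [set w | Z w <= x]).
Proof.
move=> x0 Zx.
pose v := expR (- x).
pose h (m : nat) : R := m.+1%:R^-1.
have h0 m : 0 < h m by rewrite invr_gt0.
(* The map y -> e^(-y) reverses the order, so Z <= x reads e^(-Z) >= v. [up] reaches 1 at v and
   dominates that indicator; [lo] leaves 0 at v and is dominated by it. *)
pose up m := ramp (v - h m) (h m); pose lo m := ramp v (h m).
have mle : measurable [set w | Z w <= x] by exact: measurable_ler.
have mlt : measurable [set w | Z w < x].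
  have -> : [set w | Z w < x] = ~` [set w | x <= Z w].
    by apply/seteqP; split => w /=; rewrite ltNge => /negP.
  apply: measurableC; have -> : [set w | x <= Z w] = [set w | - Z w <= - x].
    by apply/seteqP; split => w /=; rewrite lerN2.
  by apply: measurable_ler; exact: measurableT_comp.
have mEZ : measurable_fun setT (fun w => expR (- Z w)).
  by apply: measurableT_comp => //; exact: measurableT_comp.
have hcvg : h m @[m --> \oo] --> (0 : R) by exact: cvg_harmonic.
have hsmall (e : R) : 0 < e -> \forall m \near \oo, h m <= e.
  move=> e0; move/cvgr0Pnorm_le : hcvg => /(_ e e0); apply: filterS => m.
  by rewrite ger0_norm// ltW.
have up1 m u : v <= u -> up m u = 1.
  move=> vu; rewrite /up /ramp min_l// le_max; apply/orP; right.
  by rewrite ler_pdivlMr// mul1r opprB addrCA lerDl subr_ge0.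
have lo0 m u : u <= v -> lo m u = 0.
  move=> uv; rewrite /lo /ramp max_l ?min_r//.
  by rewrite pmulr_lle0 ?invr_gt0// subr_le0.
have cup : \int[P']_w up m (expR (- Z w)) @[m --> \oo] --> fine (P' [set w | Z w <= x]).
  apply: indic_integral_cvg => // [m|m w|w]; [|exact: ramp01|].
    by apply: measurableT_comp => //; exact: measurable_ramp.
  rewrite indicE; have [Zw|Zw] := leP (Z w) x.
    by near=> m; rewrite up1 ?mem_set// ler_expR lerN2.
  rewrite memNset; last by move=> /=; rewrite leNgt Zw.
  have vE : 0 < v - expR (- Z w) by rewrite subr_gt0 ltr_expR ltrN2.
  near=> m; rewrite /up /ramp max_l ?min_r//.
  rewrite pmulr_lle0 ?invr_gt0// subr_le0 lerBrDr -lerBrDl.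
  by near: m; exact: hsmall.
have clo : \int[P']_w lo m (expR (- Z w)) @[m --> \oo] --> fine (P' [set w | Z w < x]).
  apply: indic_integral_cvg => // [m|m w|w]; [|exact: ramp01|].
    by apply: measurableT_comp => //; exact: measurable_ramp.
  rewrite indicE; have [Zw|Zw] := ltP (Z w) x; last first.
    near=> m; rewrite memNset; last by move=> /=; rewrite ltNge Zw.
    by rewrite lo0// ler_expR lerN2.
  rewrite mem_set//.
  have vE : 0 < expR (- Z w) - v by rewrite subr_gt0 ltr_expR ltrN2.
  near=> m; rewrite /lo /ramp min_l// le_max; apply/orP; right.
  rewrite ler_pdivlMr// mul1r; by near: m; exact: hsmall.
(* The upper envelopes tend to the probability of Z <= x, the lower ones to that of Z < x; the
   absence of an atom at x closes the gap. *)
have Plt : P' [set w | Z w < x] = P' [set w | Z w <= x].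
  have -> : [set w | Z w <= x] = [set w | Z w < x] `|` [set w | Z w = x].
    apply/seteqP; split => w /=; rewrite le_eqVlt.
      by case/predU1P; [right|left].
    by case=> [->|->]; rewrite ?orbT ?eqxx.
  rewrite measureU0//.
  have -> : [set w | Z w = x] = Z @^-1` [set x] by [].
  by rewrite -[_ @^-1` _]setTI; exact: mZ.
rewrite Plt in clo.
have Up n m : fine (P [set w | Y n w <= x]) <= \int[P]_w up m (expR (- Y n w)).
  rewrite -int_indic; last exact: measurable_ler.
  apply: le_Rintegral => //.
  - by apply: integrable_indic_r; exact: measurable_ler.
  - apply: lipschitz_integrable => //; [exact: measurable_ramp|exact: ramp01].
  move=> w _; rewrite indicE; have [yx|yx] := boolP (w \in _).
    by rewrite up1// ler_expR lerN2; move: yx; rewrite inE.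
  by case/andP: (ramp01 (v - h m) (h m) (expR (- Y n w))).
have Lo n m : \int[P]_w lo m (expR (- Y n w)) <= fine (P [set w | Y n w <= x]).
  rewrite -int_indic; last exact: measurable_ler.
  apply: le_Rintegral => //.
  - apply: lipschitz_integrable => //; [exact: measurable_ramp|exact: ramp01].
  - by apply: integrable_indic_r; exact: measurable_ler.
  move=> w _; rewrite indicE; have [yx|yx] := boolP (w \in _).
    by case/andP: (ramp01 v (h m) (expR (- Y n w))).
  rewrite lo0// ler_expR lerN2; move: yx; rewrite notin_setE /= => /negP.
  by rewrite -ltNge => /ltW.
apply/cvgrPdist_le => e e0.
have e2 : 0 < e / 2 by rewrite divr_gt0.
have [m [um lm]] : exists m,
    `|fine (P' [set w | Z w <= x]) - \int[P']_w up m (expR (- Z w))| <= e / 2 /\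
    `|fine (P' [set w | Z w <= x]) - \int[P']_w lo m (expR (- Z w))| <= e / 2.
  have : \forall m \near \oo,
    `|fine (P' [set w | Z w <= x]) - \int[P']_w up m (expR (- Z w))| <= e / 2 /\
    `|fine (P' [set w | Z w <= x]) - \int[P']_w lo m (expR (- Z w))| <= e / 2.
    apply: filterI; first by move/cvgrPdist_le : cup; apply.
    by move/cvgrPdist_le : clo; apply.
  by case=> N _ /(_ N (leqnn N)); exists N.
have hm0 : 0 < (h m)^-1 by rewrite invr_gt0.
have ucv := @lipschitz_exp_cvg (up m) (h m)^-1 hm0 (measurable_ramp _ _) (ramp01 _ _)
  (fun y z => ramp_lipschitz _ y z (h0 m)).
have lcv := @lipschitz_exp_cvg (lo m) (h m)^-1 hm0 (measurable_ramp _ _) (ramp01 _ _)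
  (fun y z => ramp_lipschitz _ y z (h0 m)).
near=> n.
have h1 : `|\int[P']_w up m (expR (- Z w)) - \int[P]_w up m (expR (- Y n w))| <= e / 2.
  by near: n; move/cvgrPdist_le : ucv; apply.
have h2 : `|\int[P']_w lo m (expR (- Z w)) - \int[P]_w lo m (expR (- Y n w))| <= e / 2.
  by near: n; move/cvgrPdist_le : lcv; apply.
have := Up n m; have := Lo n m; move: um lm h1 h2.
rewrite !ler_norml => /andP[? ?] /andP[? ?] /andP[? ?] /andP[? ?] ? ?.
by apply/andP; split; lra.
Unshelve. all: by end_near.
Qed.

End laplace_cdf.

(** * Laplace transform of the chi-square law *)

Section chi_square_laplace.
Context {R : realType}.

(** The Radon-Nikodym derivative is determined almost everywhere only; it agrees with [normal_pdf]
    there because both integrate to the normal law over every measurable set. *)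
Lemma normal_prob_integral (f : measurableTypeR R -> \bar R) :
  measurable_fun setT f -> (forall x, (0 <= f x)%E) ->
  (\int[normal_prob 0 1]_x f x =
   \int[lebesgue_measure]_x (f x * (normal_pdf 0 1 x)%:E))%E.
Proof.
move=> mf f0.
have dom := @normal_prob_dominates R 0 1.
rewrite -(Radon_Nikodym_SigmaFinite.change_of_variables dom)//.
have ig := Radon_Nikodym_SigmaFinite.f_integrable dom.
have mg : measurable_fun setT (fun x : measurableTypeR R => (normal_pdf 0 1 x)%:E).
  by apply/measurable_EFinP; exact: measurable_normal_pdf.
have mg' := measurable_int _ ig.
apply: ae_eq_integral => //; [exact: emeasurable_funM|exact: emeasurable_funM|].
apply: ae_eqe_mul2l; apply: integral_ae_eq => // E _ mE.
by rewrite -(Radon_Nikodym_SigmaFinite.f_integral dom).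
Qed.

Let measurable_sqr_exp (s : R) :
  measurable_fun [set: R] (fun x : R => (expR (- (s * x ^+ 2)))%:E).
Proof.
apply/measurable_EFinP; apply: measurableT_comp => //.
by apply: measurableT_comp => //; apply: measurable_funM.
Qed.

Lemma normal_sqr_laplace (s : R) : 0 <= s ->
  (\int[normal_prob 0 1]_x (expR (- (s * x ^+ 2)))%:E =
   (expR (- (2^-1 * ln (1 + 2 * s))))%:E)%E.
Proof.
move=> s0.
have s1 : 0 < 1 + 2 * s by lra.
(* Completing the square: e^(-s x^2) times the standard normal density is [sg] times the centred
   normal density of standard deviation [sg] = (1 + 2 s)^(-1/2). *)
pose sg := expR (- (2^-1 * ln (1 + 2 * s))).
have sg0 : 0 < sg by exact: expR_gt0.
have sg2 : sg ^+ 2 = (1 + 2 * s)^-1.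
  rewrite -expRM_natl mulrN mulrA mulfV// mul1r expRN lnK//.
rewrite normal_prob_integral; last 2 first.
- exact: measurable_sqr_exp.
- by move=> x; rewrite lee_fin expR_ge0.
transitivity (\int[lebesgue_measure]_x (sg%:E * (normal_pdf 0 sg x)%:E))%E; last first.
  rewrite ge0_integralZl//.
  - by rewrite integral_normal_pdf mule1.
  - by apply/measurable_EFinP; exact: measurable_normal_pdf.
  - by move=> x _; rewrite lee_fin normal_pdf_ge0.
  - by rewrite lee_fin ltW.
apply: eq_integral => x _; rewrite -!EFinM; congr EFin.
have pk (t : R) : 0 < t -> normal_peak t = (t * Num.sqrt (pi * 2))^-1.
  move=> t0; rewrite /normal_peak -mulr_natr -mulrA sqrtrM ?sqr_ge0//.
  by rewrite sqrtr_sqr gtr0_norm.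
rewrite !normal_pdfE ?oner_eq0 ?gt_eqF//= !pk// /normal_fun !subr0 expr1n mul1r.
have p0 : 0 < Num.sqrt (pi * 2) :> R by rewrite sqrtr_gt0 mulr_gt0// pi_gt0.
rewrite mulrCA -expRD sg2.
have -> : - (s * x ^+ 2) + - x ^+ 2 / (1 *+ 2) = - x ^+ 2 / ((1 + 2 * s)^-1 *+ 2).
  by rewrite -[_^-1 *+ 2]mulr_natr; field; rewrite gt_eqF.
by rewrite invfM [RHS]mulrA mulVKf// gt_eqF.
Qed.

Lemma chi_square_laplace0 (k : nat) (s : R) : 0 <= s ->
  (\int[chi_square k]_y (expR (- (s * y)))%:E =
   (expR (- (k%:R / 2 * ln (1 + 2 * s))))%:E)%E.
Proof.
move=> s0; have me : measurable_fun setT (fun y : R => (expR (- (s * y)))%:E).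
  apply/measurable_EFinP; apply: measurableT_comp => //.
  by apply: measurableT_comp => //; exact: measurable_funM.
elim: k => [|k IH] /=.
  by rewrite integral_dirac//= diracT mul1e mulr0 !mul0r oppr0.
rewrite ge0_integral_distribution//.
pose f (z : measurableTypeR R * R) : \bar R :=
  ((expR (- (s * z.1 ^+ 2)))%:E * (expR (- (s * z.2)))%:E)%E.
transitivity (\int[(normal_prob 0 1 \x chi_square k)]_z f z)%E.
  apply: eq_integral => z _; rewrite /f -EFinM -expRD /= /add_square.
  by congr ((expR _)%:E); ring.
have m1 : measurable_fun setT (fun x : measurableTypeR R => (expR (- (s * x ^+ 2)))%:E).
  exact: measurable_sqr_exp.
rewrite fubini_tonelli1; last 2 first.
- apply: emeasurable_funM.
    exact: (measurableT_comp m1 measurable_fst).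
  exact: (measurableT_comp me measurable_snd).
- by move=> z; rewrite mule_ge0// lee_fin expR_ge0.
transitivity (\int[normal_prob 0 1]_x ((expR (- (s * x ^+ 2)))%:E *
    (expR (- (k%:R / 2 * ln (1 + 2 * s))))%:E))%E.
  apply: eq_integral => x _; rewrite /fubini_F /f /=.
  by rewrite ge0_integralZl ?IH// ?lee_fin ?expR_ge0// => y _; rewrite lee_fin expR_ge0.
rewrite ge0_integralZr//.
rewrite normal_sqr_laplace// -EFinM -expRD; congr ((expR _)%:E).
by rewrite -[k.+1%:R]natr1; field.
Qed.

Lemma chi_square_lt0 (k : nat) : chi_square k [set y : R | y < 0] = 0%E.
Proof.
have mneg : measurable [set y : R | y < 0].
  have -> : [set y : R | y < 0] = `]-oo, 0[%classic.
    by apply/seteqP; split => y /=; rewrite in_itv.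
  exact: measurable_itv.
elim: k => [|k IH] /=.
  by rewrite diracE memNset//= ltxx.
apply/eqP; rewrite -measure_le0.
have h : (normal_prob 0 1 \x chi_square k)%E (setT `*` [set y : R | y < 0]) = 0%E.
  rewrite product_measure1E//.
  transitivity (normal_prob 0 1 [set: measurableTypeR R] * 0)%E; last by rewrite mule0.
  by congr (_ * _)%E; exact: IH.
rewrite -h; apply: le_measure; rewrite ?inE//.
- by rewrite -[_ @^-1` _]setTI; exact: measurable_add_square.
- exact: measurableX.
- move=> [x y] /=; rewrite /add_square /= => h1; split=> //.
  by have := sqr_ge0 x; lra.
Qed.

(** The passage to distribution functions asks for a pointwise nonnegative variable. The truncation
    is one, and it changes y on a null set only. *)
Lemma chi_square_laplace (k : nat) (s : R) : 0 <= s ->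
  \int[chi_square k]_y expR (- (s * Num.max y 0)) = expR (- (k%:R / 2 * ln (1 + 2 * s))).
Proof.
move=> s0; rewrite /Rintegral.
transitivity (fine (\int[chi_square k]_y (expR (- (s * y)))%:E)); last first.
  by rewrite chi_square_laplace0.
have me : measurable_fun setT (fun y : R => (expR (- (s * y)))%:E).
  apply/measurable_EFinP; apply: measurableT_comp => //.
  by apply: measurableT_comp => //; exact: measurable_funM.
congr fine; apply: ae_eq_integral => //.
  apply/measurable_EFinP; apply: measurableT_comp => //.
  apply: measurableT_comp => //; apply: measurable_funM => //; exact: measurable_maxr.
exists [set y : R | y < 0]; split.
- have -> : [set y : R | y < 0] = `]-oo, 0[%classic.
    by apply/seteqP; split => y /=; rewrite in_itv.
  exact: measurable_itv.
- exact: chi_square_lt0.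
- move=> y /= h; rewrite ltNge; apply/negP => y0; apply: h => _.
  by rewrite max_l.
Qed.

End chi_square_laplace.

(** * Perturbation of the estimators *)

Section matrix_norm.
Context {R : realType}.

Lemma continuous_sumr (U : topologicalType) (I : Type) (r : seq I) (f : I -> U -> R) :
  (forall i, continuous (f i)) -> continuous (fun x => \sum_(i <- r) f i x).
Proof.
move=> cf x; apply: (@cvg_big R I +%R 0 xpredT _ U (nbhs x) r f (fun i => f i x)).
  exact: add_continuous.
by move=> i _; exact: cf.
Qed.

Lemma continuous_dist (U : topologicalType) (V : normedModType R) (f : U -> V) (c : V) :
  continuous f -> continuous (fun x => `|f x - c|).
Proof.
move=> cf x; apply: cvg_norm; apply: cvgB; [exact: cf|exact: cvg_cst].
Qed.

Lemma mx_entry_le m n (A : 'M[R]_(m, n)) i j : `|A i j| <= `|A|.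
Proof.
rewrite [leRHS]mx_normrE.
exact: (le_trans _ (@le_bigmax _ _ _ 0 (fun ij => `|A ij.1 ij.2|) (i, j))).
Qed.

Lemma mx_norm_le m n (A : 'M[R]_(m, n)) (c : R) : 0 <= c ->
  (forall i j, `|A i j| <= c) -> `|A| <= c.
Proof.
move=> c0 Ac; rewrite [leLHS]mx_normrE.
by apply: bigmax_le => // -[i j] _; exact: Ac.
Qed.

Lemma mulmx_norm_le m n p (A : 'M[R]_(m, n)) (B : 'M[R]_(n, p)) :
  `|A *m B| <= n%:R * (`|A| * `|B|).
Proof.
apply: mx_norm_le => [|i j]; first by rewrite !mulr_ge0.
rewrite mxE (le_trans (ler_norm_sum _ _ _))//.
have -> : n%:R * (`|A| * `|B|) = \sum_(k < n) (`|A| * `|B|).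
  by rewrite sumr_const card_ord mulr_natl.
apply: ler_sum => k _; rewrite normrM.
by apply: ler_pM => //; exact: mx_entry_le.
Qed.

Lemma trmx_norm m n (A : 'M[R]_(m, n)) : `|A^T| = `|A|.
Proof.
apply/eqP; rewrite eq_le; apply/andP; split; apply: mx_norm_le => // i j.
  by rewrite mxE mx_entry_le.
by rewrite -[A]trmxK mxE trmxK mx_entry_le.
Qed.

Lemma dot_norm_le n (x y : 'cV[R]_n) : `|(x^T *m y) 0 0| <= n%:R * (`|x| * `|y|).
Proof. by rewrite (le_trans (mx_entry_le _ _ _))// (le_trans (mulmx_norm_le _ _))// trmx_norm. Qed.

Lemma bilB_mx n (A B : 'M[R]_n) (x y : 'cV[R]_n) :
  bil (A - B) x y = bil A x y - bil B x y.
Proof. by rewrite /bil mulmxBr mulmxBl !mxE. Qed.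

Lemma bil_norm_le n (A : 'M[R]_n) (x y : 'cV[R]_n) :
  `|bil A x y| <= n%:R ^+ 2 * `|A| * (`|x| * `|y|).
Proof.
rewrite /bil -mulmxA (le_trans (dot_norm_le _ _))//.
have := mulmx_norm_le A y => h.
apply: (@le_trans _ _ (n%:R * (`|x| * (n%:R * (`|A| * `|y|))))).
  by rewrite !ler_wpM2l.
by rewrite le_eqVlt; apply/orP; left; apply/eqP; ring.
Qed.

Lemma sqr_norm_le_dot n (x : 'cV[R]_n) : `|x| ^+ 2 <= (x^T *m x) 0 0.
Proof.
have E : (x^T *m x) 0 0 = \sum_i x i 0 ^+ 2.
  by rewrite mxE; apply: eq_bigr => i _; rewrite mxE -expr2.
have s0 : 0 <= (x^T *m x) 0 0 by rewrite E; apply: sumr_ge0 => i _; exact: sqr_ge0.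
rewrite -[leRHS]sqr_sqrtr// lerXn2r ?nnegrE ?sqrtr_ge0//.
apply: mx_norm_le => [|i j]; first exact: sqrtr_ge0.
rewrite ord1 -sqrtr_sqr ler_sqrt// E (bigD1 i)//= lerDl.
by apply: sumr_ge0 => k _; exact: sqr_ge0.
Qed.

(** No spectral theory: Cauchy-Schwarz for the form A at x and A^-1 x gives (x' x)^2 <= (x' A x) (x'
    A^-1 x), and the last factor is at most a constant times |x|^2. *)
Lemma psd_unit_coercive n (A : 'M[R]_n) : A^T = A -> (forall x, 0 <= bil A x x) ->
  A \in unitmx -> exists2 k, 0 < k & forall x, k * `|x| ^+ 2 <= bil A x x.
Proof.
move=> sA pA uA.
pose C := n%:R ^+ 2 * `|invmx A| + 1.
have C0 : 0 < C by rewrite ltr_wpDl// mulr_ge0// sqr_ge0.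
exists C^-1; first by rewrite invr_gt0.
move=> x; rewrite mulrC ler_pdivrMr//.
have := bil_CS x (invmx A *m x) sA pA.
have -> : bil A x (invmx A *m x) = (x^T *m x) 0 0.
  by rewrite /bil -!mulmxA mulKVmx.
have -> : bil A (invmx A *m x) (invmx A *m x) = bil (invmx A) x x.
  by rewrite /bil trmx_mul trmx_inv sA -!mulmxA mulKVmx.
have := ler_norm (bil (invmx A) x x); have := bil_norm_le (invmx A) x x.
have := sqr_norm_le_dot x; have := pA x.
have := normr_ge0 x; rewrite -expr2 /C.
set a := `|x|; set s := (_ *m _) 0 0; set b := bil A x x; set c := bil _ x x.
set K := _ * `|invmx A| => a0 b0 as_ cn cc h.
have K0 : 0 <= K by rewrite mulr_ge0// sqr_ge0.
have a20 : 0 <= a ^+ 2 by exact: sqr_ge0.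
have h1 : (a ^+ 2) ^+ 2 <= b * (K * a ^+ 2).
  apply: (@le_trans _ _ (s ^+ 2)); first by rewrite lerXn2r ?nnegrE// (le_trans a20).
  by apply: (le_trans h); rewrite ler_wpM2l//; lra.
have [a2|a2] := eqVneq (a ^+ 2) 0.
  by rewrite a2 mulr_ge0//; lra.
have a2p : 0 < a ^+ 2 by rewrite lt_neqAle eq_sym a2.
have : a ^+ 2 <= b * K by rewrite -(@ler_pM2r _ (a ^+ 2))// -expr2 -mulrA.
lra.
Qed.

End matrix_norm.

(** * Minimisers of the least-squares criterion *)

Section argmin.
Context {R : realType} {T1 K m : nat}.
Local Notation T := (1 + T1)%N.
Local Notation p := (K + (m + T1))%N.
Variables (S : 'I_T -> 'M[R]_(m, K)).
Variables (b0 : 'cV[R]_K) (th0 : 'cV[R]_m) (l0 : 'cV[R]_T1).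
Local Notation ps0 := (col_mx b0 (col_mx th0 l0)).

Definition dpi (t : 'I_T) (psi : 'cV[R]_p) : 'cV[R]_m := pi_t S t psi - pi_t S t ps0.

(** Derivative of [pi_t] at the true parameter, in the directions beta, theta and lambda. The last
    block uses row t of the matrix (0; I), whose first row is zero because the first loading is
    fixed at 1. *)
Definition jac (t : 'I_T) : 'M[R]_(m, p) :=
  row_mx (S t) (row_mx (Lambda_of l0 t 0)%:M
    (th0 *m row t (col_mx 0 1%:M : 'M[R]_(1 + T1, T1)))).

Definition quadr (t : 'I_T) (D : 'cV[R]_p) : 'cV[R]_m :=
  (col_mx (0 : 'cV[R]_1) (psi_lambda D)) t 0 *: psi_theta D.

Lemma psi_split (D : 'cV[R]_p) :
  D = col_mx (psi_beta D) (col_mx (psi_theta D) (psi_lambda D)).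
Proof. by rewrite /psi_theta /psi_lambda !vsubmxK. Qed.

Lemma pi_t_col (t : 'I_T) b th l :
  pi_t S t (col_mx b (col_mx th l)) = S t *m b + Lambda_of l t 0 *: th.
Proof. by rewrite /pi_t /psi_beta /psi_theta /psi_lambda !(col_mxKu, col_mxKd). Qed.

Lemma Lambda_ofD (t : 'I_T) (l d : 'cV[R]_T1) :
  Lambda_of (l + d) t 0 = Lambda_of l t 0 + (col_mx (0 : 'cV[R]_1) d) t 0.
Proof.
have -> : Lambda_of (l + d) = Lambda_of l + col_mx (0 : 'cV[R]_1) d.
  by rewrite /Lambda_of add_col_mx addr0.
by rewrite mxE.
Qed.

Lemma jac_mul (t : 'I_T) b th l :
  jac t *m col_mx b (col_mx th l) =
  S t *m b + Lambda_of l0 t 0 *: th + (col_mx (0 : 'cV[R]_1) l) t 0 *: th0.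
Proof.
rewrite /jac !mul_row_col mul_scalar_mx addrA; congr (_ + _).
rewrite -mulmxA -row_mul mul_col_mx mul0mx mul1mx.
set c := col_mx _ _; apply/matrixP => i j.
by rewrite ord1 mxE big_ord1 !mxE mulrC.
Qed.

(** [pi_t] is linear up to the single product lambda_t theta, so its expansion stops exactly at the
    second order. *)
Lemma dpiE (t : 'I_T) (D : 'cV[R]_p) : dpi t (ps0 + D) = jac t *m D + quadr t D.
Proof.
rewrite /dpi /quadr [D]psi_split; move: (psi_beta D) (psi_theta D) (psi_lambda D) => b th l.
rewrite jac_mul /psi_theta /psi_lambda !(col_mxKu, col_mxKd).
rewrite !add_col_mx !pi_t_col Lambda_ofD mulmxDr scalerDr !scalerDl.
set x := S t *m b0; set y := S t *m b.
set z := Lambda_of l0 t 0 *: th0; set u := Lambda_of l0 t 0 *: th.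
set c := (col_mx 0 l) t 0; move: (c *: th0) (c *: th) => v w.
apply/matrixP => i j; rewrite !mxE; ring.
Qed.

Lemma quadr_norm (t : 'I_T) (D : 'cV[R]_p) : `|quadr t D| <= `|D| ^+ 2.
Proof.
have hl : `|psi_lambda D| <= `|D|.
  by apply: mx_norm_le => // i j; rewrite !mxE; exact: mx_entry_le.
have ht : `|psi_theta D| <= `|D|.
  by apply: mx_norm_le => // i j; rewrite !mxE; exact: mx_entry_le.
rewrite /quadr normrZ expr2; apply: ler_pM => //.
apply: le_trans hl; apply: (le_trans (mx_entry_le _ _ _)).
apply: mx_norm_le => // i j; rewrite mxE; case: split_ordP => k _.
  by rewrite mxE normr0.
exact: mx_entry_le.
Qed.

(** The objective up to a term free of psi, when Z is the sample second moment of z and [g t] the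
    sample covariance of z with u_t. *)
Definition crit (Z : 'M[R]_m) (g : 'I_T -> 'cV[R]_m) (psi : 'cV[R]_p) : R :=
  \sum_t (2^-1 * bil Z (dpi t psi) (dpi t psi) - ((dpi t psi)^T *m g t) 0 0).

Lemma crit_psi0 Z g : crit Z g ps0 = 0.
Proof.
apply: big1 => t _; rewrite /dpi subrr bil0l trmx0 mul0mx mxE; ring.
Qed.

Variables (Sg : 'M[R]_m) (kS : R).
Hypothesis kS0 : 0 < kS.
Hypothesis Sg_coer : forall x, kS * `|x| ^+ 2 <= bil Sg x x.

(** A nonpositive value means that the linear part, of size M r |x|, outweighs the quadratic part,
    at least kS/4 |x|^2 per period once Z is close to [Sg]. The resulting rate for the fitted
    coefficients holds for every psi, not only near the true one. *)
Lemma crit_rate (M r : R) Z g psi : 0 < M -> 0 < r ->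
  m%:R ^+ 2 * (M * r) <= kS / 2 ->
  `|Z - Sg| <= M * r -> (forall t, `|g t| <= M * r) -> crit Z g psi <= 0 ->
  \sum_t `|dpi t psi| <= 4 * T%:R * (m%:R + 1) * M / kS * r.
Proof.
move=> M0 r0 mr ZS gM c0.
pose a := (m%:R + 1) * (M * r).
have Mr : 0 < M * r by rewrite mulr_gt0.
have m0 : 0 <= m%:R :> R by [].
have a0 : 0 < a by rewrite mulr_gt0//; lra.
(* A completed square: kS/4 |x|^2 + 4 a^2/kS >= 2 a |x|. One half pays for the linear term, the
   other remains on the left. *)
have per t : a * `|dpi t psi| - 4 * a ^+ 2 / kS <=
    2^-1 * bil Z (dpi t psi) (dpi t psi) - ((dpi t psi)^T *m g t) 0 0.
  set x := dpi t psi.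
  have hZ : kS / 2 * `|x| ^+ 2 <= bil Z x x.
    have E : bil Z x x = bil Sg x x + bil (Z - Sg) x x.
      by rewrite bilB_mx; ring.
    have h1 := Sg_coer x; have h2 := bil_norm_le (Z - Sg) x x.
    have h3 : m%:R ^+ 2 * `|Z - Sg| * (`|x| * `|x|) <= kS / 2 * `|x| ^+ 2.
      rewrite -expr2 ler_wpM2r ?sqr_ge0//; apply: le_trans mr.
      by rewrite ler_wpM2l// sqr_ge0.
    have := ler_norm (- bil (Z - Sg) x x); rewrite normrN E; lra.
  have hg : (x^T *m g t) 0 0 <= a * `|x|.
    apply: (le_trans (ler_norm _)); apply: (le_trans (dot_norm_le _ _)).
    rewrite /a mulrCA mulrC ler_wpM2r//.
    by apply: ler_pM => //; lra.
  have : 0 <= (kS / 2 * `|x| - 2 * a) ^+ 2 / kS by rewrite divr_ge0 ?sqr_ge0// ltW.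
  have -> : (kS / 2 * `|x| - 2 * a) ^+ 2 / kS = kS / 4 * `|x| ^+ 2 - 2 * (a * `|x|) + 4 * a ^+ 2 / kS.
    by field; rewrite gt_eqF.
  lra.
have : \sum_t (a * `|dpi t psi| - 4 * a ^+ 2 / kS) <= 0.
  by apply: le_trans c0; apply: ler_sum => t _; exact: per.
rewrite sumrB -mulr_sumr sumr_const card_ord -mulr_natl subr_le0.
rewrite [X in _ <= X -> _](_ : _ = a * (4 * T%:R * a / kS)); last by ring.
rewrite ler_pM2l// => h; apply: (le_trans h).
by rewrite /a le_eqVlt; apply/orP; left; apply/eqP; ring.
Qed.

Variable Psibar : set 'cV[R]_p.
Hypothesis cPsi : compact Psibar.
Hypothesis ident : forall psi, Psibar psi -> psi != ps0 ->
  exists t, pi_t S t psi != pi_t S t ps0.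

Lemma pi_entry_continuous (t : 'I_T) (i : 'I_m) :
  continuous (fun psi : 'cV[R]_p => pi_t S t psi i 0).
Proof.
have -> : (fun psi : 'cV[R]_p => pi_t S t psi i 0) =
  (fun psi => \sum_k S t i k * psi (lshift _ k) 0 +
     Lambda_of (psi_lambda psi) t 0 * psi (rshift _ (lshift _ i)) 0).
  apply/funext => psi; rewrite /pi_t !mxE; congr (_ + _).
  by apply: eq_bigr => k _; rewrite mxE.
have cc (k : 'I_p) : continuous (fun psi : 'cV[R]_p => psi k 0) by exact: coord_continuous.
have h1 : continuous (fun psi : 'cV[R]_p => \sum_k S t i k * psi (lshift _ k) 0).
  apply: (@continuous_sumr R _ 'I_K _ (fun k (psi : 'cV[R]_p) => S t i k * psi (lshift _ k) 0)).
  by move=> k x; apply: cvgMr; [exact: nbhs_filter|exact: cc].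
have h2 : continuous (fun psi : 'cV[R]_p => Lambda_of (psi_lambda psi) t 0).
  rewrite (_ : (fun x : 'cV[R]_p => _) = fun x : 'cV[R]_p =>
    match fintype.split t with inl _ => 1 | inr k => x (rshift _ (rshift _ k)) 0 end); last first.
    apply/funext => x; rewrite /Lambda_of mxE; case: (fintype.split t) => k.
      by rewrite ord1 mxE.
    by rewrite !mxE.
  by case: (fintype.split t) => k x; [exact: cst_continuous|exact: cc].
move=> psi; exact: (cvgD (h1 psi) (cvgM (h2 psi) (cc _ psi))).
Qed.

(** Identification at each parameter becomes uniform by compactness: the continuous distance between
    the fitted coefficients attains a positive minimum on the part of [Psibar] at distance at least
    dl from the truth. *)
Lemma separation (dl : R) : 0 < dl -> exists2 c, 0 < c &
  forall psi, Psibar psi -> \sum_t `|dpi t psi| < c -> `|psi - ps0| < dl.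
Proof.
move=> dl0.
pose f (psi : 'cV[R]_p) := \sum_t \sum_i `|pi_t S t psi i 0 - pi_t S t ps0 i 0|.
have cf : continuous f.
  apply: continuous_sumr => t; apply: continuous_sumr => i.
  by apply: continuous_dist; exact: pi_entry_continuous.
have fle psi : f psi <= (m%:R) * \sum_t `|dpi t psi|.
  rewrite mulr_sumr; apply: ler_sum => t _.
  rewrite mulr_natl -[X in _ *+ X](card_ord m) -sumr_const.
  apply: ler_sum => i _; apply: le_trans (mx_entry_le (dpi t psi) i 0).
  by rewrite /dpi !mxE.
pose A := Psibar `&` [set psi | dl <= `|psi - ps0|].
have clA : closed [set psi : 'cV[R]_p | dl <= `|psi - ps0|].
  have -> : [set psi : 'cV[R]_p | dl <= `|psi - ps0|] =
     (fun psi : 'cV[R]_p => `|psi - ps0|) @^-1` [set x | dl <= x] by [].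
  apply: closed_comp; last exact: closed_ge.
  by move=> psi _; apply: (@continuous_dist _ _ _ idfun ps0) => x; exact: cvg_id.
have cA : compact A by exact: compact_closedI.
have [A0|/set0P A0] := eqVneq A set0.
  exists 1 => // psi Ppsi _; rewrite ltNge; apply/negP => h.
  by have : A psi by []; rewrite A0.
have [c cA' cmin] := @compact_EVT_min _ R f A A0 cA (continuous_subspaceT cf).
move: cA'; rewrite inE => -[Pc dc].
have fc0 : 0 < f c.
  have cn0 : c != ps0.
    by apply/eqP => e; move: dc; rewrite /= e subrr normr0 leNgt dl0.
  have [t /eqP tn] := ident Pc cn0.
  have pos x : 0 <= \sum_i `|pi_t S x c i 0 - pi_t S x ps0 i 0| by apply: sumr_ge0.
  rewrite lt_neqAle; apply/andP; split; last by apply: sumr_ge0.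
  rewrite eq_sym; apply/eqP => f0; apply: tn; apply/matrixP => i j; rewrite ord1.
  have h : \sum_i `|pi_t S t c i 0 - pi_t S t ps0 i 0| = 0.
    exact: (psumr_eq0P (fun x _ => pos x) f0).
  have : `|pi_t S t c i 0 - pi_t S t ps0 i 0| = 0.
    exact: (psumr_eq0P (fun x _ => normr_ge0 _) h).
  move=> /eqP.
  by rewrite normr_eq0 subr_eq0 => /eqP.
exists (f c / (m%:R + 1)); first by rewrite divr_gt0// ltr_wpDl.
move=> psi Ppsi; rewrite ltr_pdivlMr ?ltr_wpDl// => h.
rewrite ltNge; apply/negP => dpsi.
have Apsi : psi \in A by rewrite inE.
have := cmin psi Apsi; have := fle psi.
have : 0 <= \sum_t `|dpi t psi| by apply: sumr_ge0.
lra.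
Qed.

(** Hessian, at the true parameter, of the population criterion, where Z = [Sg] and g = 0. The
    curvature of [pi_t] is multiplied there by [dpi], which vanishes. *)
Definition hess : 'M[R]_p := \sum_t (jac t)^T *m Sg *m jac t.

Lemma bil_hess (x y : 'cV[R]_p) :
  bil hess x y = \sum_t bil Sg (jac t *m x) (jac t *m y).
Proof.
rewrite /bil /hess mulmx_sumr mulmx_suml summxE; apply: eq_bigr => t _.
by rewrite trmx_mul !mulmxA.
Qed.

Hypothesis Sg_sym : Sg^T = Sg.
Hypothesis hess_unit : hess \in unitmx.

Lemma hess_sym : hess^T = hess.
Proof.
rewrite /hess linear_sum /=; apply: eq_bigr => t _.
by rewrite !trmx_mul trmxK Sg_sym mulmxA.
Qed.

Lemma hess_coercive : exists2 k, 0 < k & forall x, k * `|x| ^+ 2 <= bil hess x x.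
Proof.
apply: psd_unit_coercive => //; first exact: hess_sym.
move=> x; rewrite bil_hess; apply: sumr_ge0 => t _.
by apply: le_trans (Sg_coer _); rewrite mulr_ge0 ?sqr_ge0// ltW.
Qed.

Lemma sum_sqr_le (I : finType) (f : I -> R) : (forall i, 0 <= f i) ->
  \sum_i f i ^+ 2 <= (\sum_i f i) ^+ 2.
Proof.
move=> f0; rewrite [leRHS]expr2 mulr_suml; apply: ler_sum => i _.
rewrite expr2 ler_wpM2l// (bigD1 i)//= lerDl; exact: sumr_ge0.
Qed.

(** Coercivity of [hess] bounds |D| by the linear parts [jac t *m D]; the radius c/(2T) lets the
    quadratic parts eat at most half of that bound. *)
Lemma local_inverse : exists2 c, 0 < c & exists2 dl, 0 < dl &
  forall D, `|D| <= dl -> c * `|D| <= \sum_t `|dpi t (ps0 + D)|.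
Proof.
have [k k0 kH] := hess_coercive.
pose A := m%:R ^+ 2 * `|Sg| + 1.
have A0 : 0 < A by rewrite ltr_wpDl// mulr_ge0// sqr_ge0.
pose c := Num.sqrt (k / A).
have c0 : 0 < c by rewrite sqrtr_gt0 divr_gt0.
have c2 : c ^+ 2 = k / A by rewrite sqr_sqrtr// divr_ge0// ltW.
have T0 : 0 < T%:R :> R by rewrite ltr0n.
exists (c / 2); first by rewrite divr_gt0.
exists (c / (2 * T%:R)); first by rewrite divr_gt0// mulr_gt0.
move=> D Dd.
pose X := \sum_t `|jac t *m D|.
have X0 : 0 <= X by apply: sumr_ge0.
have h1 : c * `|D| <= X.
  rewrite -(@ler_pXn2r _ 2)// ?nnegrE ?mulr_ge0 ?(ltW c0)//.
  rewrite exprMn c2 mulrAC ler_pdivrMr//.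
  apply: (le_trans (kH D)); rewrite bil_hess.
  apply: (@le_trans _ _ (A * \sum_t `|jac t *m D| ^+ 2)).
    rewrite mulr_sumr; apply: ler_sum => t _.
    apply: (le_trans (ler_norm _)); apply: (le_trans (bil_norm_le _ _ _)).
    by rewrite -expr2 ler_wpM2r ?sqr_ge0// lerDl.
  by rewrite mulrC ler_wpM2r ?(ltW A0)//; exact: sum_sqr_le.
have h2 : X - T%:R * `|D| ^+ 2 <= \sum_t `|dpi t (ps0 + D)|.
  rewrite lerBlDr.
  have -> : T%:R * `|D| ^+ 2 = \sum_(t < T) `|D| ^+ 2.
    by rewrite sumr_const card_ord mulr_natl.
  rewrite -big_split /=; apply: ler_sum => t _.
  have -> : jac t *m D = dpi t (ps0 + D) - quadr t D by rewrite dpiE addrK.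
  by rewrite (le_trans (ler_normB _ _))// lerD2l quadr_norm.
have h3 : T%:R * `|D| ^+ 2 <= c / 2 * `|D|.
  rewrite expr2 mulrA ler_wpM2r//.
  apply: (@le_trans _ _ (T%:R * (c / (2 * T%:R)))); first by rewrite ler_wpM2l// ltW.
  by rewrite le_eqVlt; apply/orP; left; apply/eqP; field; rewrite gt_eqF.
lra.
Qed.

Definition score (g : 'I_T -> 'cV[R]_m) : 'cV[R]_p := \sum_t (jac t)^T *m g t.

(** The factor p is the inner dimension in |jac t D| <= p |jac t| |D|, the matrix norm being the
    largest entry. *)
Definition jacbound : R := \sum_t p%:R * `|jac t|.

Lemma jacbound_ge0 : 0 <= jacbound.
Proof. by apply: sumr_ge0 => t _; rewrite mulr_ge0. Qed.

Lemma jac_norm_le t : p%:R * `|jac t| <= jacbound.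
Proof.
rewrite /jacbound (bigD1 t)//= lerDl; apply: sumr_ge0 => k _.
by rewrite mulr_ge0.
Qed.

Lemma score_norm (g : 'I_T -> 'cV[R]_m) (c : R) : 0 <= c -> (forall t, `|g t| <= c) ->
  `|score g| <= m%:R * jacbound * c.
Proof.
move=> c0 gc; apply: (le_trans (ler_norm_sum _ _ _)).
rewrite /jacbound mulr_sumr mulr_suml; apply: ler_sum => t _.
apply: (le_trans (mulmx_norm_le _ _)); rewrite trmx_norm -mulrA ler_wpM2l//.
apply: ler_pM => //; rewrite -[leLHS]mul1r.
(* The missing factor p is at least 1, except for p = 0, where the Jacobian has no columns and norm
   0. *)
have [p0|p0] := posnP p.
  have -> : jac t = 0.
    apply/matrixP => i j; exfalso; move: j; rewrite p0; case => //.
  by rewrite normr0 !mulr0.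
by rewrite ler_wpM2r// ler1n.
Qed.

Lemma score_dot (g : 'I_T -> 'cV[R]_m) (D : 'cV[R]_p) : \sum_t ((jac t *m D)^T *m g t) 0 0 = (D^T *m score g) 0 0.
Proof.
rewrite /score mulmx_sumr summxE; apply: eq_bigr => t _.
by rewrite trmx_mul mulmxA.
Qed.

(** For |D| of order r there are two sources of error, both cubic: Z - [Sg], of size r, against two
    factors of size r; and [quadr], of size r^2, against the linear part, itself or g. *)
Lemma crit_expansion (M C : R) : 0 < M -> 0 < C -> exists2 C', 0 < C' &
  forall r Z g D, 0 < r <= 1 -> `|Z - Sg| <= M * r -> (forall t, `|g t| <= M * r) ->
  `|D| <= C * r ->
  `|crit Z g (ps0 + D) - (2^-1 * bil hess D D - (D^T *m score g) 0 0)| <= C' * r ^+ 3.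
Proof.
move=> M0 C0.
pose X := jacbound * C; pose E := C ^+ 2.
pose mm : R := m%:R ^+ 2.
(* One summand per error: Z - [Sg] in the form, [quadr] in the form [Sg], [quadr] against g. The
   final 1 keeps the constant positive. *)
pose C1 := mm * M * (X + E) ^+ 2 + mm * `|Sg| * (2 * X * E + E ^+ 2) + m%:R * E * M + 1.
have X0 : 0 <= X by rewrite mulr_ge0 ?jacbound_ge0 ?ltW.
have E0 : 0 <= E by exact: sqr_ge0.
have mm0 : 0 <= mm by exact: sqr_ge0.
have S0 : 0 <= `|Sg| by [].
have C10 : 0 < C1.
  have a1 : 0 <= mm * M * (X + E) ^+ 2 := mulr_ge0 (mulr_ge0 mm0 (ltW M0)) (sqr_ge0 _).
  have a2 : 0 <= mm * `|Sg| * (2 * X * E + E ^+ 2).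
    apply: mulr_ge0; first exact: mulr_ge0.
    by apply: addr_ge0 (sqr_ge0 _); apply: mulr_ge0 => //; exact: mulr_ge0.
  have a3 : 0 <= m%:R * E * M := mulr_ge0 (mulr_ge0 (ler0n _ m) E0) (ltW M0).
  rewrite /C1; lra.
have T0 : 0 < T%:R :> R by rewrite ltr0n.
exists (T%:R * C1); first by rewrite mulr_gt0.
move=> r Z g D /andP[r0 r1] ZS gM DC.
have per t : `|(2^-1 * bil Z (dpi t (ps0 + D)) (dpi t (ps0 + D))
     - ((dpi t (ps0 + D))^T *m g t) 0 0) -
   (2^-1 * bil Sg (jac t *m D) (jac t *m D) - ((jac t *m D)^T *m g t) 0 0)| <= C1 * r ^+ 3.
  rewrite dpiE.
  have xb : `|jac t *m D| <= X * r.
    apply: (le_trans (mulmx_norm_le _ _)).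
    rewrite mulrA /X -[leRHS]mulrA; apply: ler_pM => //.
    exact: jac_norm_le.
  have eb : `|quadr t D| <= E * r ^+ 2.
    apply: (le_trans (quadr_norm _ _)); rewrite /E -exprMn lerXn2r ?nnegrE//.
    by rewrite mulr_ge0// ltW.
  move: (jac t *m D) (quadr t D) xb eb => x e xb eb.
  have -> : (2^-1 * bil Z (x + e) (x + e) - ((x + e)^T *m g t) 0 0) -
    (2^-1 * bil Sg x x - (x^T *m g t) 0 0) =
    2^-1 * bil (Z - Sg) (x + e) (x + e) +
    2^-1 * (bil Sg x e + bil Sg e x + bil Sg e e) - (e^T *m g t) 0 0.
    have -> : ((x + e)^T *m g t) 0 0 = (x^T *m g t) 0 0 + (e^T *m g t) 0 0.
      by rewrite linearD /= mulmxDl mxE.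
    by rewrite bilB_mx !bilDl !bilDr; ring.
  have r20 : 0 <= r ^+ 2 by exact: sqr_ge0.
  have r2r : r ^+ 2 <= r by rewrite expr2 ler_piMr// ltW.
  have r30 : 0 <= r ^+ 3 by rewrite exprn_ge0// ltW.
  have rr0 : 0 <= r by exact: ltW.
  have r43 : r ^+ 4 <= r ^+ 3 by rewrite [leLHS]exprSr ler_piMr.
  have xe : `|x + e| <= (X + E) * r.
    apply: (le_trans (ler_normD _ _)); rewrite mulrDl lerD//.
    by apply: (le_trans eb); rewrite ler_wpM2l.
  have A1 : `|bil (Z - Sg) (x + e) (x + e)| <= mm * M * (X + E) ^+ 2 * r ^+ 3.
    apply: (le_trans (bil_norm_le _ _ _)); rewrite -/mm.
    apply: (@le_trans _ _ (mm * (M * r) * (((X + E) * r) * ((X + E) * r)))).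
      apply: ler_pM => //; rewrite ?mulr_ge0//.
        by rewrite ler_wpM2l.
      by apply: ler_pM.
    by rewrite le_eqVlt; apply/orP; left; apply/eqP; ring.
  have B x1 x2 a1 a2 : `|x1| <= a1 -> `|x2| <= a2 -> `|bil Sg x1 x2| <= mm * `|Sg| * (a1 * a2).
    move=> h1 h2; apply: (le_trans (bil_norm_le _ _ _)); rewrite -/mm ler_wpM2l ?mulr_ge0//.
    exact: ler_pM.
  have A2 := B _ _ _ _ xb eb; have A3 := B _ _ _ _ eb xb; have A4 := B _ _ _ _ eb eb.
  have A5 : `|(e^T *m g t) 0 0| <= m%:R * E * M * r ^+ 3.
    apply: (le_trans (dot_norm_le _ _)).
    apply: (@le_trans _ _ (m%:R * (E * r ^+ 2 * (M * r)))).
      by rewrite ler_wpM2l// ler_pM.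
    by rewrite le_eqVlt; apply/orP; left; apply/eqP; ring.
  set a := bil (Z - Sg) _ _ in A1 *; set b1 := bil Sg x e in A2 *.
  set b2 := bil Sg e x in A3 *; set b3 := bil Sg e e in A4 *.
  set c := (_ *m g t) 0 0 in A5 *.
  have A4' : `|b3| <= mm * `|Sg| * E ^+ 2 * r ^+ 3.
    apply: (le_trans A4); rewrite -[leRHS]mulrA ler_wpM2l ?mulr_ge0//.
    have -> : E * r ^+ 2 * (E * r ^+ 2) = E ^+ 2 * r ^+ 4 by ring.
    by rewrite ler_wpM2l// sqr_ge0.
  apply: (@le_trans _ _ (2^-1 * `|a| + 2^-1 * (`|b1| + `|b2| + `|b3|) + `|c|)).
    apply: (le_trans (ler_normB _ _)); rewrite lerD2r.
    apply: (le_trans (ler_normD _ _)).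
    rewrite !normrM (ger0_norm (_ : 0 <= 2^-1 :> R)) ?invr_ge0// lerD2l ler_wpM2l ?invr_ge0//.
    by apply: (le_trans (ler_normD _ _)); rewrite lerD2r ler_normD.
  have -> : C1 * r ^+ 3 = mm * M * (X + E) ^+ 2 * r ^+ 3 + (mm * `|Sg| * (X * r * (E * r ^+ 2)))
     + (mm * `|Sg| * (E * r ^+ 2 * (X * r))) + mm * `|Sg| * E ^+ 2 * r ^+ 3
     + m%:R * E * M * r ^+ 3 + r ^+ 3 by rewrite /C1; ring.
  have := normr_ge0 a; have := normr_ge0 b1; have := normr_ge0 b2; have := normr_ge0 b3.
  have := normr_ge0 c; lra.
have -> : crit Z g (ps0 + D) - (2^-1 * bil hess D D - (D^T *m score g) 0 0) =
  \sum_t ((2^-1 * bil Z (dpi t (ps0 + D)) (dpi t (ps0 + D))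
     - ((dpi t (ps0 + D))^T *m g t) 0 0) -
   (2^-1 * bil Sg (jac t *m D) (jac t *m D) - ((jac t *m D)^T *m g t) 0 0)).
  by rewrite sumrB [X in _ = _ - X]sumrB -mulr_sumr -bil_hess score_dot.
apply: (le_trans (ler_norm_sum _ _ _)).
have -> : T%:R * C1 * r ^+ 3 = \sum_(t < T) C1 * r ^+ 3.
  by rewrite sumr_const card_ord -[RHS]mulr_natl mulrA.
by apply: ler_sum => t _; exact: per.
Qed.

Hypothesis Psibar_int : (Psibar^°) ps0.

(* Comparing the minimiser with the one-step candidate ps0 + H^-1 score replaces
   the first-order condition. *)
Theorem argmin_expansion (M : R) : 0 < M -> exists2 C, 0 < C & exists2 r0, 0 < r0 &
  forall r Z g psih, 0 < r <= r0 -> `|Z - Sg| <= M * r -> (forall t, `|g t| <= M * r) ->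
  Psibar psih -> (forall psi, Psibar psi -> crit Z g psih <= crit Z g psi) ->
  `|psih - ps0 - invmx hess *m score g| ^+ 2 <= C * r ^+ 3.
Proof.
move=> M0.
have [k k0 kH] := hess_coercive.
have [c c0 [dl dl0 loc]] := local_inverse.
have [sc sc0 sep] := separation dl0.
have /nbhs_ballP[ep ep0 epP] : nbhs ps0 Psibar by exact: Psibar_int.
pose C1 := 4 * T%:R * (m%:R + 1) * M / kS.
have T0 : 0 < T%:R :> R by rewrite ltr0n.
have m0 : 0 <= m%:R :> R by [].
have m1 : 0 < m%:R + 1 :> R by lra.
have C10 : 0 < C1 := divr_gt0 (mulr_gt0 (mulr_gt0 (mulr_gt0 (ltr0Sn _ 3) T0) m1) M0) kS0.
pose J := p%:R * `|invmx hess| * (m%:R * jacbound * M).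
have J0 : 0 <= J.
  apply: mulr_ge0; first exact: mulr_ge0.
  by apply: mulr_ge0 (ltW M0); apply: mulr_ge0 => //; exact: jacbound_ge0.
pose C2 := C1 / c + J + 1.
have C1c : 0 < C1 / c by rewrite divr_gt0.
have C20 : 0 < C2 by rewrite /C2; lra.
have [C' C'0 ex] := crit_expansion M0 C20.
exists (4 * C' / k); first by rewrite !mulr_gt0// invr_gt0.
pose r1 := kS / 2 / (m%:R ^+ 2 * M + 1).
have d1 : 0 < m%:R ^+ 2 * M + 1 by rewrite ltr_wpDl// mulr_ge0 ?sqr_ge0// ltW.
pose r2 := sc / (2 * C1); pose r3 := ep / (2 * (J + 1)).
(* 1 serves the cubic expansion, r1 keeps half of the coercivity of Z, r2 places the minimiser where
   [local_inverse] holds, and r3 keeps the candidate inside [Psibar]. *)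
exists (Num.min 1 (Num.min r1 (Num.min r2 r3))).
  rewrite !lt_min ltr01 /=; apply/and3P; split; apply: divr_gt0 => //.
  - exact: divr_gt0.
  - exact: mulr_gt0.
  - by rewrite mulr_gt0// ltr_wpDl.
move=> r Z g psih /andP[rp]; rewrite !le_min => /and4P[rl1 rr1 rr2 rr3] ZS gM Pp pmin.
have rp' := ltW rp.
have Pps0 : Psibar ps0 by apply: interior_subset.
have critle : crit Z g psih <= 0 by rewrite -(crit_psi0 Z g); exact: pmin.
have rate : \sum_t `|dpi t psih| <= C1 * r.
  apply: (@crit_rate M r Z g psih) => //.
  move: rr1; rewrite /r1 ler_pdivlMr// => h; apply: le_trans h.
  have -> : m%:R ^+ 2 * (M * r) = r * (m%:R ^+ 2 * M) by ring.
  by apply: ler_wpM2l => //; rewrite lerDl.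
pose D := psih - ps0.
have psiE : psih = ps0 + D by rewrite /D addrC subrK.
have Ddl : `|D| <= dl.
  apply: ltW; apply: sep => //; apply: (le_lt_trans rate).
  apply: (@le_lt_trans _ _ (C1 * r2)); first by rewrite ler_wpM2l// ltW.
  have -> : C1 * r2 = sc / 2 by rewrite /r2; field; rewrite gt_eqF.
  lra.
have D1 : `|D| <= C1 / c * r.
  rewrite mulrAC ler_pdivlMr// mulrC.
  by apply: (le_trans (loc _ Ddl)); rewrite -psiE.
have D2 : `|D| <= C2 * r by apply: (le_trans D1); rewrite ler_wpM2r// /C2; lra.
pose Ds := invmx hess *m score g.
have Ds1 : `|Ds| <= J * r.
  apply: (le_trans (mulmx_norm_le _ _)).
  rewrite mulrA /J -[leRHS]mulrA ler_wpM2l ?mulr_ge0//.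
  rewrite -[leRHS]mulrA; apply: score_norm => //.
  by rewrite mulr_ge0// ltW.
have Ds2 : `|Ds| <= C2 * r by apply: (le_trans Ds1); rewrite ler_wpM2r// /C2; lra.
have PDs : Psibar (ps0 + Ds).
  apply: epP; rewrite -ball_normE /ball_ /=.
  rewrite opprD addrA subrr sub0r normrN; apply: (le_lt_trans Ds1).
  apply: (@le_lt_trans _ _ ((J + 1) * r3)).
    by apply: ler_pM => //; lra.
  have -> : (J + 1) * r3 = ep / 2 by rewrite /r3; field; rewrite gt_eqF// ltr_wpDl.
  have : 0 < ep by []. lra.
have r01 : 0 < r <= 1 by rewrite rp.
have e1 := ex r Z g D r01 ZS gM D2.
have e2 := ex r Z g Ds r01 ZS gM Ds2.
have fle := pmin _ PDs; rewrite psiE in fle.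
(* Since [hess *m Ds] is the score, the excess of the quadratic model over its minimum is exactly
   half the squared [hess]-length of D - Ds. Optimality of D bounds this excess by the two expansion
   errors. *)
have qE : (2^-1 * bil hess D D - (D^T *m score g) 0 0) -
    (2^-1 * bil hess Ds Ds - (Ds^T *m score g) 0 0) = 2^-1 * bil hess (D - Ds) (D - Ds).
  have sE (x : 'cV[R]_p) : (x^T *m score g) 0 0 = bil hess x Ds.
    by rewrite /bil /Ds -mulmxA mulKVmx.
  rewrite !sE.
  have -> : D - Ds = D + (-1) *: Ds by rewrite scaleN1r.
  rewrite bilD; last exact: hess_sym.
  by rewrite !bilZr !bilZl; field.
have kD := kH (D - Ds).
rewrite -/D -/Ds mulrAC ler_pdivlMr// mulrC.
move: e1 e2; rewrite !ler_norml => /andP[a1 a2] /andP[a3 a4].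
lra.
Qed.

End argmin.

(** * Perturbation of a linear system *)

Section within.
Context {R : realType}.

(** The error of the inverse is of order r, and B is itself of order r; hence the quadratic bound.
    The constants come from requiring b r <= 1/2. *)
Lemma perturbed_inverse n (A : 'M[R]_n) (M : R) : A \in unitmx -> 0 < M ->
  exists2 C, 0 < C & exists2 r0, 0 < r0 & forall r (Ah : 'M[R]_n) (B : 'cV[R]_n),
  0 < r <= r0 -> `|Ah - A| <= M * r -> `|B| <= M * r ->
  Ah \in unitmx /\ `|invmx Ah *m B - invmx A *m B| <= C * r ^+ 2.
Proof.
move=> uA M0; pose N := invmx A; pose a := n%:R * `|N|.
have a0 : 0 <= a by exact: mulr_ge0.
have nn0 : 0 <= n%:R :> R by [].
pose b := a * n%:R * M.
have b0 : 0 <= b by apply: mulr_ge0 (ltW M0); exact: mulr_ge0.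
exists (b * (2 * a * M) + 1).
  by rewrite ltr_wpDl// mulr_ge0// mulr_ge0 ?(ltW M0)// mulr_ge0.
exists (2^-1 / (b + 1)); first by rewrite divr_gt0 ?invr_gt0// ltr_wpDl.
move=> r Ah B /andP[r0 rb] hA hB.
have br : b * r <= 2^-1.
  move: rb; rewrite ler_pdivlMr ?ltr_wpDl// => h; apply: le_trans h.
  by rewrite mulrC ler_wpM2l ?(ltW r0)// lerDl.
have uAh : Ah \in unitmx.
  (* A left kernel k of the perturbed matrix satisfies k = - k (Ah - A) A^-1, so its norm is at most
     half of itself. *)
  rewrite -row_free_unit -kermx_eq0; set k := kermx Ah.
  have kE : k = - (k *m (Ah - A) *m N).
    by rewrite mulmxBr mulmx_ker sub0r mulNmx opprK -mulmxA mulmxV// mulmx1.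
  have : `|k| <= 2^-1 * `|k|.
    rewrite {1}kE normrN; apply: (le_trans (mulmx_norm_le _ _)).
    apply: (@le_trans _ _ (n%:R * ((n%:R * (`|k| * (M * r))) * `|N|))).
      rewrite ler_wpM2l//; apply: ler_wpM2r => //; apply: (le_trans (mulmx_norm_le _ _)).
      by do 2!apply: ler_wpM2l => //.
    have -> : n%:R * ((n%:R * (`|k| * (M * r))) * `|N|) = b * r * `|k| by rewrite /b /a; ring.
    by rewrite ler_wpM2r.
  move=> h; rewrite -normr_eq0 eq_le normr_ge0 andbT; lra.
split=> //; set x := invmx Ah *m B.
have xE : x - N *m B = - (N *m ((Ah - A) *m x)).
  rewrite mulmxBl mulmxBr /x mulKVmx// /N mulKmx// opprB.
  by rewrite [RHS]addrC addrC.
have nb (y : R) : `|x| <= y -> `|N *m ((Ah - A) *m x)| <= b * r * y.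
  move=> xy; apply: (le_trans (mulmx_norm_le _ _)).
  apply: (@le_trans _ _ (n%:R * (`|N| * (n%:R * (M * r * y))))).
    apply: ler_wpM2l => //; apply: ler_wpM2l => //; apply: (le_trans (mulmx_norm_le _ _)).
    by apply: ler_wpM2l => //; exact: ler_pM.
  by rewrite le_eqVlt; apply/orP; left; apply/eqP; rewrite /b /a; ring.
have x1 : `|x| <= 2 * a * M * r.
  have h1 := nb _ (lexx _).
  have h2 : `|N *m B| <= a * (M * r).
    apply: (le_trans (mulmx_norm_le _ _)); rewrite mulrA.
    by rewrite ler_wpM2l.
  have h3 : b * r * `|x| <= 2^-1 * `|x| by rewrite ler_wpM2r.
  have : `|x| <= `|N *m B| + `|N *m ((Ah - A) *m x)|.
    have {1}-> : x = N *m B - N *m ((Ah - A) *m x) by rewrite -xE addrC subrK.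
    exact: ler_normB.
  lra.
rewrite xE normrN; apply: (le_trans (nb _ x1)).
have -> : b * r * (2 * a * M * r) = b * (2 * a * M) * r ^+ 2 by ring.
by rewrite ler_wpM2r ?sqr_ge0// lerDl.
Qed.

End within.

(** * Linearisation of the difference of the two estimators *)

Section comparison.
Context {R : realType} {T1 K m : nat}.
Local Notation T := (1 + T1)%N.
Local Notation p := (K + (m + T1))%N.
Variables (S : 'I_T -> 'M[R]_(m, K)) (Q : 'M[R]_T).
Variables (b0 : 'cV[R]_K) (th0 : 'cV[R]_m) (l0 : 'cV[R]_T1) (Sg : 'M[R]_m).
Local Notation ps0 := (col_mx b0 (col_mx th0 l0)).
Local Notation hess := (hess S th0 l0 Sg).
Local Notation score := (score S th0 l0).
Local Notation crit := (crit S b0 th0 l0).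

(** X' Q X expanded over pairs of periods, when row t of X is z' S_t; Z stands for z z' or one of
    its means. *)
Definition within_mx (Z : 'M[R]_m) : 'M[R]_K :=
  \sum_s \sum_t Q s t *: ((S s)^T *m Z *m S t).

(** X' Q applied to the residual Lambda z' theta + u, with D in place of z z' and [g t] in place of
    z u_t. Being linear in (D, g), it serves for one observation, for the sample means and for their
    deviations from the population. *)
Definition within_score (D : 'M[R]_m) (g : 'I_T -> 'cV[R]_m) : 'cV[R]_K :=
  \sum_s \sum_t Q s t *: ((S s)^T *m (Lambda_of l0 t 0 *: (D *m th0) + g t)).

Definition diff_lin (D : 'M[R]_m) (g : 'I_T -> 'cV[R]_m) : 'cV[R]_K :=
  psi_beta (invmx hess *m score g) - invmx (within_mx Sg) *m within_score D g.

Lemma psi_betaB (x y : 'cV[R]_p) : psi_beta (x - y) = psi_beta x - psi_beta y.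
Proof. by apply/matrixP => i j; rewrite !mxE. Qed.

Lemma within_mxB Z Z' : within_mx Z - within_mx Z' = within_mx (Z - Z').
Proof.
rewrite /within_mx -sumrB; apply: eq_bigr => s _; rewrite -sumrB; apply: eq_bigr => t _.
by rewrite -scalerBr mulmxBr mulmxBl.
Qed.

Lemma within_mx_norm : exists2 C, 0 <= C & forall Z, `|within_mx Z| <= C * `|Z|.
Proof.
exists (\sum_s \sum_t `|Q s t| * (m%:R * (m%:R * `|S s|) * `|S t|)).
  by apply: sumr_ge0 => s _; apply: sumr_ge0 => t _; rewrite !mulr_ge0.
move=> Z; apply: (le_trans (ler_norm_sum _ _ _)); rewrite mulr_suml; apply: ler_sum => s _.
apply: (le_trans (ler_norm_sum _ _ _)); rewrite mulr_suml; apply: ler_sum => t _.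
rewrite normrZ -[leRHS]mulrA ler_wpM2l//; apply: (le_trans (mulmx_norm_le _ _)).
apply: (@le_trans _ _ (m%:R * ((m%:R * (`|S s| * `|Z|)) * `|S t|))).
  apply: ler_wpM2l => //; apply: ler_wpM2r => //.
  by apply: (le_trans (mulmx_norm_le _ _)); rewrite trmx_norm.
by rewrite le_eqVlt; apply/orP; left; apply/eqP; ring.
Qed.

Lemma within_score_norm : exists2 C, 0 <= C & forall D g c, 0 <= c -> `|D| <= c ->
  (forall t, `|g t| <= c) -> `|within_score D g| <= C * c.
Proof.
exists (\sum_s \sum_t `|Q s t| * (m%:R * (`|S s| * (`|Lambda_of l0 t 0| * (m%:R * `|th0|) + 1)))).
  by apply: sumr_ge0 => s _; apply: sumr_ge0 => t _; rewrite !mulr_ge0// addr_ge0// !mulr_ge0.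
move=> D g c c0 Dc gc.
apply: (le_trans (ler_norm_sum _ _ _)); rewrite mulr_suml; apply: ler_sum => s _.
apply: (le_trans (ler_norm_sum _ _ _)); rewrite mulr_suml; apply: ler_sum => t _.
rewrite normrZ -[leRHS]mulrA ler_wpM2l//; apply: (le_trans (mulmx_norm_le _ _)).
rewrite trmx_norm -!mulrA; do 2!apply: ler_wpM2l => //.
apply: (le_trans (ler_normD _ _)); rewrite mulrDl mul1r lerD// normrZ -mulrA ler_wpM2l//.
apply: (le_trans (mulmx_norm_le _ _)); rewrite -mulrA ler_wpM2l// mulrC ler_wpM2l//.
Qed.

Lemma diff_lin_norm : exists2 C, 0 <= C & forall D g c, 0 <= c -> `|D| <= c ->
  (forall t, `|g t| <= c) -> `|diff_lin D g| <= C * c.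
Proof.
have [C C0 h] := within_score_norm.
have J0 := jacbound_ge0 S th0 l0.
exists (p%:R * (`|invmx hess| * (m%:R * jacbound S th0 l0)) +
    K%:R * (`|invmx (within_mx Sg)| * C)).
  by apply: addr_ge0; do ?apply: mulr_ge0.
move=> D g c c0 Dc gc.
apply: (le_trans (ler_normB _ _)); rewrite mulrDl lerD//.
  apply: (@le_trans _ _ `|invmx hess *m score g|).
    by apply: mx_norm_le => // i j; rewrite mxE mx_entry_le.
  apply: (le_trans (mulmx_norm_le _ _)); rewrite -!mulrA; do 2!apply: ler_wpM2l => //.
  by rewrite mulrA; exact: score_norm.
apply: (le_trans (mulmx_norm_le _ _)); rewrite -!mulrA; do 2!apply: ler_wpM2l => //.
exact: h.
Qed.

Lemma bil_diff_norm n (A : 'M[R]_n) (x y : 'cV[R]_n) : A^T = A ->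
  `|bil A x x - bil A y y| <= n%:R ^+ 2 * `|A| * (`|x - y| * (`|x - y| + 2 * `|y|)).
Proof.
move=> sA; have -> : bil A x x - bil A y y = bil A (x - y) (x - y) + 2 * bil A (x - y) y.
  have {1 2}-> : x = (x - y) + y by rewrite subrK.
  by rewrite bilD//; ring.
apply: (le_trans (ler_normD _ _)); rewrite normrM (ger0_norm (ler0n _ 2)).
have h1 := bil_norm_le A (x - y) (x - y); have h2 := bil_norm_le A (x - y) y.
rewrite mulrDr mulrDr; lra.
Qed.

Variable (kS : R) (Psibar : set 'cV[R]_p) (A : 'M[R]_K).
Hypothesis kS0 : 0 < kS.
Hypothesis Sg_coer : forall x, kS * `|x| ^+ 2 <= bil Sg x x.
Hypothesis cPsi : compact Psibar.
Hypothesis ident : forall psi, Psibar psi -> psi != ps0 ->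
  exists t, pi_t S t psi != pi_t S t ps0.
Hypothesis Sg_sym : Sg^T = Sg.
Hypothesis hess_unit : hess \in unitmx.
Hypothesis Psibar_int : (Psibar^°) ps0.
Hypothesis within_unit : within_mx Sg \in unitmx.
Hypothesis A_sym : A^T = A.

(** In the application r = n^(-1/2) and W is an i.i.d. mean, which misses [diff_lin] by r^2 because
    demeaning subtracts products of sample means. The error of the minimiser is of order r^(3/2), so
    that after division by r^2 the two forms differ by O(sqrt r). *)
Theorem diff_expansion (M e : R) : 0 < M -> 0 < e -> exists2 r0, 0 < r0 &
  forall r Z g psih W, 0 < r <= r0 -> `|Z - Sg| <= M * r -> (forall t, `|g t| <= M * r) ->
  Psibar psih -> (forall psi, Psibar psi -> crit Z g psih <= crit Z g psi) ->
  `|W - diff_lin (Z - Sg) g| <= M * r ^+ 2 ->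
  within_mx Z \in unitmx /\
  let b := psi_beta psih - (b0 + invmx (within_mx Z) *m within_score (Z - Sg) g) in
  `|(r ^+ 2)^-1 * bil A b b - (r ^+ 2)^-1 * bil A W W| <= e.
Proof.
move=> M0 e0.
have [C1 C10 [r1 r10 H1]] := argmin_expansion kS0 Sg_coer cPsi ident Sg_sym hess_unit Psibar_int M0.
have [CM CM0 HM] := within_mx_norm.
have [CS CS0 HS] := within_score_norm.
have [CL CL0 HL] := diff_lin_norm.
have M'0 : 0 < (CM + CS + 1) * M by rewrite mulr_gt0// ltr_wpDl// addr_ge0.
have [C2 C20 [r2 r20 H2]] := perturbed_inverse within_unit M'0.
pose a := K%:R ^+ 2 * `|A|.
have a0 : 0 <= a by rewrite mulr_ge0// sqr_ge0.
(* with rho = sqrt r, the error of b is at most cst * rho^3 and |W| <= cst * rho^2 *)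
pose c1 := Num.sqrt C1 + C2 + M.
have c10 : 0 <= c1 by rewrite addr_ge0 ?(ltW M0)// addr_ge0 ?sqrtr_ge0// ltW.
pose c2 := CL * M + M.
have c20 : 0 <= c2 by rewrite addr_ge0 ?(ltW M0)// mulr_ge0// ltW.
pose E := a * (c1 * (c1 + 2 * c2)) + 1.
have E0 : 0 < E by rewrite ltr_wpDl// !mulr_ge0// addr_ge0// mulr_ge0.
(* The final bound is (E - 1) sqrt r, which is at most e once sqrt r <= e / E. *)
pose r3 := (e / E) ^+ 2.
have r30 : 0 < r3 by rewrite exprn_gt0// divr_gt0.
exists (Num.min 1 (Num.min r1 (Num.min r2 r3))); first by rewrite !lt_min ltr01 r10 r20.
move=> r Z g psih W /andP[r0]; rewrite !le_min => /and4P[rl1 rr1 rr2 rr3] ZS gM Pp pmin WL.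
have r0' := ltW r0.
have Mr0 : 0 <= M * r by rewrite mulr_ge0// ltW.
have hM : `|within_mx Z - within_mx Sg| <= (CM + CS + 1) * M * r.
  rewrite within_mxB; apply: (le_trans (HM _)).
  rewrite -mulrA; apply: ler_pM => //; lra.
have hS : `|within_score (Z - Sg) g| <= (CM + CS + 1) * M * r.
  apply: (le_trans (HS _ _ _ Mr0 ZS gM)).
  by rewrite -mulrA ler_wpM2r//; lra.
have [uZ h2] := H2 r _ _ (introT andP (conj r0 rr2)) hM hS.
split=> // b.
have h1 := H1 r Z g psih (introT andP (conj r0 rr1)) ZS gM Pp pmin.
pose rho := Num.sqrt r.
have rho0 : 0 < rho by rewrite sqrtr_gt0.
have rho2 : rho ^+ 2 = r by rewrite sqr_sqrtr.
have rho1 : rho <= 1 by rewrite -sqrtr1 ler_sqrt.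
have h1' : `|psih - ps0 - invmx hess *m score g| <= Num.sqrt C1 * rho ^+ 3.
  rewrite -(@ler_pXn2r _ 2)// ?nnegrE ?mulr_ge0 ?sqrtr_ge0 ?exprn_ge0 ?(ltW rho0)//.
  rewrite exprMn sqr_sqrtr ?(ltW C10)//; apply: (le_trans h1).
  by rewrite -rho2 -!exprM.
have r2rho : r ^+ 2 <= rho ^+ 3.
  by rewrite -rho2 -exprM [leLHS](exprSr _ 3) ler_piMr// exprn_ge0// ltW.
have bE : b - diff_lin (Z - Sg) g = psi_beta (psih - ps0 - invmx hess *m score g) -
   (invmx (within_mx Z) *m within_score (Z - Sg) g - invmx (within_mx Sg) *m within_score (Z - Sg) g).
  rewrite !psi_betaB (_ : psi_beta ps0 = b0); last by rewrite /psi_beta col_mxKu.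
  rewrite /b /diff_lin.
  move: (psi_beta psih) (psi_beta (invmx hess *m score g))
    (invmx (within_mx Z) *m _) (invmx (within_mx Sg) *m _) => x y z u.
  by apply/matrixP => i j; rewrite !mxE; ring.
have bW : `|b - W| <= c1 * rho ^+ 3.
  have -> : b - W = (b - diff_lin (Z - Sg) g) - (W - diff_lin (Z - Sg) g).
    by move: (diff_lin _ _) => u; rewrite opprB addrA subrK.
  apply: (le_trans (ler_normB _ _)); rewrite /c1 mulrDl lerD//; last first.
    by apply: (le_trans WL); rewrite ler_wpM2l// ltW.
  rewrite bE; apply: (le_trans (ler_normB _ _)); rewrite mulrDl lerD//.
    apply: le_trans h1'; apply: mx_norm_le => // i j; rewrite mxE; exact: mx_entry_le.
  by apply: (le_trans h2); rewrite ler_wpM2l// ltW.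
have Wb : `|W| <= c2 * rho ^+ 2.
  have -> : W = (W - diff_lin (Z - Sg) g) + diff_lin (Z - Sg) g.
    by move: (diff_lin _ _) => u; rewrite subrK.
  apply: (le_trans (ler_normD _ _)); rewrite /c2 mulrDl addrC lerD//.
    by rewrite rho2 -mulrA; exact: HL.
  apply: (le_trans WL); rewrite ler_wpM2l ?(ltW M0)// rho2 expr2 ler_piMr//.
rewrite -mulrBr normrM ger0_norm ?invr_ge0 ?sqr_ge0//.
rewrite mulrC ler_pdivrMr ?exprn_gt0//.
apply: (le_trans (bil_diff_norm _ _ A_sym)); rewrite -/a.
have rho32 : rho ^+ 3 <= rho ^+ 2 by rewrite [leLHS]exprSr ler_piMr ?exprn_ge0// ltW.
apply: (@le_trans _ _ (a * (c1 * rho ^+ 3 * ((c1 + 2 * c2) * rho ^+ 2)))).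
  apply: ler_wpM2l => //; apply: ler_pM => //.
  rewrite [leRHS]mulrDl lerD//.
    by apply: (le_trans bW); rewrite ler_wpM2l.
  by rewrite -mulrA ler_wpM2l.
have -> : a * (c1 * rho ^+ 3 * ((c1 + 2 * c2) * rho ^+ 2)) = (E - 1) * rho * r ^+ 2.
  by rewrite -rho2 /E; ring.
rewrite ler_wpM2r ?sqr_ge0//.
have rhoe : rho <= e / E.
  rewrite -(@ler_pXn2r _ 2)// ?nnegrE ?(ltW rho0) ?divr_ge0 ?(ltW e0) ?(ltW E0)//.
  by rewrite rho2.
apply: (@le_trans _ _ (E * rho)); first by rewrite ler_wpM2r ?(ltW rho0)//; lra.
by rewrite mulrC -ler_pdivlMr.
Qed.

End comparison.

(** * Asymptotically quadratic statistics *)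

Section transfer.
Context {d d' : measure_display} {Omega : measurableType d}
  {T : measurableType d'} {R : realType}.
Variables (P : probability Omega R) (V : nat -> Omega -> T).
Hypothesis mV : forall i, measurable_fun setT (V i).
Hypothesis indV : forall (J : {fset nat}) (B : nat -> set T),
  (forall i, measurable (B i)) ->
  P (\bigcap_(i in [set` J]) V i @^-1` B i) =
  (\prod_(i <- J) P (V i @^-1` B i))%E.
Hypothesis idV : forall i j (B : set T), measurable B ->
  P (V i @^-1` B) = P (V j @^-1` B).

(** A union bound: one exceptional set serves a whole finite family, with the sum of the variances
    as constant. *)
Lemma iid_family_prob (I : finType) (F : I -> T -> R) :
  (forall i, measurable_fun setT (F i)) ->
  (forall i, moment P 2 (fun w => F i (V 0%N w))) ->
  (forall i, \int[P]_w F i (V 0%N w) = 0) ->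
  exists2 v, 0 <= v & forall (n : nat) (M : R), (0 < n)%N -> 0 < M ->
    exists2 A : set Omega, measurable A /\ (P A <= (v / M ^+ 2)%:E)%E &
    forall w, ~ A w -> forall i, `|\sum_(j < n) F i (V j w)| <= M * Num.sqrt n%:R.
Proof.
move=> mF m2 E0.
have /choice[v vP] i : exists v, 0 <= v /\ forall (n : nat) (M : R), (0 < n)%N -> 0 < M ->
    (P [set w | (M * Num.sqrt n%:R < `|(\sum_(j < n) F i (V j w))|)%R] <= (v / M ^+ 2)%:E)%E.
  by have [v v0 vP] := iid_sum_prob mV indV idV (mF i) (m2 i) (E0 i); exists v.
exists (\sum_i v i); first by apply: sumr_ge0 => i _; case: (vP i).
move=> n M n0 M0.
pose B i := [set w | M * Num.sqrt n%:R < `|\sum_(j < n) F i (V j w)|].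
have mB i : measurable (B i).
  apply: measurable_gtr; apply: measurableT_comp => //.
  by apply: measurable_sum => j; exact: measurableT_comp.
exists (\big[setU/set0]_(i : I) B i).
  rewrite mulr_suml; elim: (index_enum I) => [|i r [mr hr]].
    by rewrite !big_nil measure0.
  rewrite !big_cons EFinD; split; first exact: measurableU.
  apply: (le_trans (measureU2 _ (mB i) mr)); apply: leeD => //.
  by have [_] := vP i; apply.
move=> w nA i; rewrite leNgt; apply/negP => h; apply: nA.
by rewrite (bigD1 i)//=; left.
Qed.

Variables (K : nat) (zeta : T -> 'cV[R]_K) (Sg : 'M[R]_K).
Hypothesis mz : forall a, measurable_fun setT (fun x => zeta x a 0).
Hypothesis z2 : forall a, moment P 2 (fun w => zeta (V 0%N w) a 0).
Hypothesis z0 : forall a, \int[P]_w zeta (V 0%N w) a 0 = 0.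
Hypothesis zV : forall a b,
  \int[P]_w (zeta (V 0%N w) a 0 * zeta (V 0%N w) b 0) = Sg a b.
Hypothesis uSg : Sg \in unitmx.

Lemma expRN_lipschitz (k x y : R) : 0 <= k -> 0 <= x -> 0 <= y ->
  `|expR (- (k * x)) - expR (- (k * y))| <= k * `|x - y|.
Proof.
move=> k0; wlog xy : x y / x <= y.
  move=> H x0 y0; case: (leP x y) => [xy|/ltW yx]; first exact: H.
  by rewrite distrC [X in _ <= _ * X]distrC; exact: H.
move=> x0 y0; have e : expR (- (k * y)) = expR (- (k * x)) * expR (- (k * (y - x))).
  by rewrite -expRD; congr expR; ring.
have e1 : expR (- (k * x)) <= 1 by rewrite expR_le1 oppr_le0 mulr_ge0.
have e2 : expR (- (k * (y - x))) <= 1 by rewrite expR_le1 oppr_le0 mulr_ge0// subr_ge0.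
have e3 := expR_ge1Dx (- (k * (y - x))).
have e0 := expR_ge0 (- (k * x)).
have -> : `|x - y| = y - x by rewrite ler0_norm ?subr_le0// opprB.
have -> : expR (- (k * x)) - expR (- (k * y)) =
    expR (- (k * x)) * (1 - expR (- (k * (y - x)))) by rewrite e; ring.
rewrite ger0_norm; last by rewrite mulr_ge0// subr_ge0.
apply: (@le_trans _ _ (1 - expR (- (k * (y - x))))); last by lra.
by rewrite ler_piMl// subr_ge0.
Qed.

(** The functions exp(- k x) are Lipschitz and take values in [0, 1] for x >= 0, so closeness
    outside a small event transfers the limit of their means. The closeness hypothesis is
    convergence in probability with a measurable exceptional set. *)
Lemma clt_transfer (theta : nat -> Omega -> R) :
  (forall n, measurable_fun setT (theta n)) -> (forall n w, 0 <= theta n w) ->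
  (forall e dl : R, 0 < e -> 0 < dl -> exists N, forall n, (N <= n)%N ->
    exists2 A : set Omega, measurable A /\ (P A <= dl%:E)%E &
    forall w, ~ A w ->
      `|theta n w - n%:R^-1 * bil (invmx Sg) (psum V zeta n w) (psum V zeta n w)| <= e) ->
  converges_in_distribution P theta (chi_square K).
Proof.
move=> mth th0 close; split=> // x mux.
pose q n w := n%:R^-1 * bil (invmx Sg) (psum V zeta n w) (psum V zeta n w).
have q0 n w : 0 <= q n w.
  by apply: mulr_ge0; [rewrite invr_ge0|exact: (@invcov_psd _ _ _ _ _ P V K zeta Sg z2 zV uSg)].
have mq n : measurable_fun setT (q n).
  by apply: measurable_funM => //; exact: (@measurable_qpsum _ _ _ _ _ V mV K zeta Sg mz).
have eint k (f : Omega -> R) : measurable_fun setT f -> (forall w, 0 <= f w) ->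
    P.-integrable setT (EFin \o (fun w => expR (- (k%:R * f w)))).
  move=> mf f0; apply/moment1_integrable; apply: (@moment_bounded _ _ _ P 1 _ 1).
    apply: measurableT_comp => //; apply: measurableT_comp => //.
    exact: measurable_funM.
  by move=> w; rewrite ger0_norm ?expR_ge0// expR_le1 oppr_le0 mulr_ge0.
have lap (k : nat) : \int[P]_w expR (- (k%:R * theta n w)) @[n --> \oo] -->
    \int[chi_square K]_y expR (- (k%:R * Num.max y 0)).
  rewrite chi_square_laplace//.
  have L := @lindeberg_laplace _ _ _ _ _ P V mV indV idV K zeta Sg mz z2 z0 zV uSg k%:R (ler0n R k).
  apply/cvgrPdist_le => e e0.
  have e3 : 0 < e / 3 by rewrite divr_gt0.
  (* The divisor is k + 1 because k may be 0. *)
  have ek : 0 < e / 3 / (k%:R + 1) by rewrite divr_gt0// ltr_wpDl.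
  have [N HN] := close _ _ ek e3.
  near=> n.
  have nN : (N <= n)%N by near: n; exact: nbhs_infty_ge.
  have [A [mA PA] HA] := HN n nN.
  have h1 : `|expR (- (K%:R / 2 * ln (1 + 2 * k%:R))) - \int[P]_w expR (- (k%:R * q n w))| <= e / 3.
    by near: n; move/cvgrPdist_le : L; apply.
  have h2 : `|\int[P]_w expR (- (k%:R * q n w)) - \int[P]_w expR (- (k%:R * theta n w))| <= e / 3 + e / 3.
    have i1 := eint k _ (mq n) (q0 n); have i2 := eint k _ (mth n) (th0 n).
    rewrite -RintegralB//.
    apply: le_trans (le_normr_Rintegral _ _) _ => //; first exact: rintegrableB.
    apply: (@le_trans _ _ (\int[P]_w (e / 3 + \1_A w))).
      apply: le_Rintegral => //.
      - by apply: integrable_norm; exact: rintegrableB.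
      - by apply: rintegrableD; [exact: rintegrable_cst|exact: integrable_indic_r].
      move=> w _; rewrite indicE; case: (boolP (w \in A)) => [_|wA].
        apply: (@le_trans _ _ 1); last by rewrite lerDr ltW.
        have b (z : R) : 0 <= z -> 0 <= expR (- (k%:R * z)) <= 1.
          by move=> z0'; rewrite expR_ge0 expR_le1 oppr_le0 mulr_ge0.
        move: (b _ (q0 n w)) (b _ (th0 n w)) => /andP[? ?] /andP[? ?].
        by rewrite ler_norml; apply/andP; split; lra.
      rewrite addr0; apply: (le_trans (expRN_lipschitz _ _ _)) => //.
      have hA : `|q n w - theta n w| <= e / 3 / (k%:R + 1).
        by rewrite distrC; apply: HA; move: wA; rewrite notin_setE.
      apply: (@le_trans _ _ (k%:R * (e / 3 / (k%:R + 1)))); first by rewrite ler_wpM2l.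
      rewrite mulrCA -[leRHS]mulr1 ler_wpM2l ?(ltW e3)//.
      by rewrite ler_pdivrMr ?ltr_wpDl// mul1r lerDl.
    rewrite RintegralD//; [|exact: rintegrable_cst|exact: integrable_indic_r].
    rewrite int_cst int_indic// lerD2l.
    by rewrite -lee_fin fineK// fin_num_measure.
  have tri (a b c : R) : a - c = (a - b) + (b - c) by ring.
  rewrite (tri _ (\int[P]_w expR (- (k%:R * q n w)))).
  apply: (le_trans (ler_normD _ _)).
  lra.
have mmax : measurable_fun [set: R] (fun y : R => Num.max y 0) by exact: measurable_maxr.
have mle (c : R) : measurable [set y : R | y <= c].
  have -> : [set y : R | y <= c] = `]-oo, c]%classic.
    by apply/seteqP; split => y /=; rewrite in_itv.
  exact: measurable_itv.
have mlt (c : R) : measurable [set y : R | y < c].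
  have -> : [set y : R | y < c] = `]-oo, c[%classic.
    by apply/seteqP; split => y /=; rewrite in_itv.
  exact: measurable_itv.
have chi0 := @chi_square_lt0 R K.
(* Below 0 both distribution functions vanish; [cdf_cvg] treats x >= 0. *)
have [x0|x0] := ltP x 0.
  have -> : chi_square K [set y : R | y <= x] = 0%E.
    apply/eqP; rewrite -measure_le0 -chi0; apply: le_measure; rewrite ?inE//.
    by move=> y /= yx; exact: le_lt_trans yx x0.
  have -> : (fun n => P [set w | theta n w <= x]) = (fun=> 0%E).
    apply/funext => n; have -> : [set w | theta n w <= x] = set0.
      apply/seteqP; split => // w /= h; have := th0 n w.
      by rewrite leNgt (le_lt_trans h x0).
    by rewrite measure0.
  exact: cvg_cst.
(* At x = 0 the truncation moves the negative half-line onto x, but that half-line is a null set. *)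
have Zx : chi_square K [set y : R | Num.max y 0 = x] = 0%E.
  apply/eqP; rewrite -measure_le0.
  have -> : 0%E = (chi_square K [set y : R | (y < 0)%R] + chi_square K [set x] :> \bar R)%E.
    by rewrite chi0 mux adde0.
  apply: (@le_trans _ _ (chi_square K ([set y : R | y < 0] `|` [set x]))); last first.
    exact: measureU2.
  apply: le_measure; rewrite ?inE//.
  - have -> : [set y : R | Num.max y 0 = x] = setT `&` (fun y : R => Num.max y 0) @^-1` [set x].
      by apply/seteqP; split => y //= [].
    exact: mmax.
  - exact: measurableU.
  - move=> y /=; have [y0 ex|y0 ex] := leP (0 : R) y; [by right|by left].
have Z0 (y : R) : 0 <= Num.max y 0 by rewrite le_max lexx orbT.
have := @cdf_cvg _ _ _ _ R P (chi_square K) theta (fun y => Num.max y 0) mth mmax th0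
  Z0 lap x x0 Zx.
have -> : [set w | Num.max w 0 <= x] = [set y : R | y <= x].
  by apply/seteqP; split => y /=; rewrite ge_max x0 andbT.
move=> h; rewrite -[X in _ --> X]fineK ?fin_num_measure//; apply/cvg_EFin.
  by near=> n; apply: fin_num_measure; exact: measurable_ler.
apply: h.
Unshelve. all: by end_near.
Qed.

End transfer.

(** * Random matrices *)

Section random_mx.
Context {d : measure_display} {Omega : measurableType d} {R : realType}.
Variable P : probability Omega R.

Definition mmoment k a b (A : Omega -> 'M[R]_(a, b)) : Prop :=
  forall i j, moment P k (fun w => A w i j).

Lemma EmxE a b (A : Omega -> 'M[R]_(a, b)) i j : Emx P A i j = \int[P]_w A w i j.
Proof. by rewrite mxE fine_expectation. Qed.

Lemma mmoment_leq j k a b (A : Omega -> 'M[R]_(a, b)) : (j <= k)%N ->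
  mmoment k A -> mmoment j A.
Proof. by move=> jk mA x y; exact: moment_leq jk (mA x y). Qed.

Lemma mmoment_cst k a b (C : 'M[R]_(a, b)) : mmoment k (fun=> C).
Proof. by move=> i j; exact: moment_cst. Qed.

Lemma Emx_cst a b (C : 'M[R]_(a, b)) : Emx P (fun=> C) = C.
Proof. by apply/matrixP => i j; rewrite EmxE int_cst. Qed.

Lemma mmomentD k a b (A B : Omega -> 'M[R]_(a, b)) : mmoment k A -> mmoment k B ->
  mmoment k (fun w => A w + B w).
Proof.
move=> mA mB i j; rewrite (_ : (fun w => _) = (fun w => A w i j + B w i j)).
  exact: momentD.
by apply/funext => w; rewrite mxE.
Qed.

Lemma mmomentZ k c a b (A : Omega -> 'M[R]_(a, b)) : mmoment k A ->
  mmoment k (fun w => c *: A w).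
Proof.
move=> mA i j; rewrite (_ : (fun w => _) = (fun w => c * A w i j)).
  exact: momentZ.
by apply/funext => w; rewrite mxE.
Qed.

Lemma mmomentB k a b (A B : Omega -> 'M[R]_(a, b)) : mmoment k A -> mmoment k B ->
  mmoment k (fun w => A w - B w).
Proof.
move=> mA mB i j; rewrite (_ : (fun w => _) = (fun w => A w i j - B w i j)).
  exact: momentB.
by apply/funext => w; rewrite !mxE.
Qed.

Lemma mmoment_tr k a b (A : Omega -> 'M[R]_(a, b)) : mmoment k A ->
  mmoment k (fun w => (A w)^T).
Proof.
by move=> mA i j; rewrite (_ : (fun w => _) = (fun w => A w j i))//;
  apply/funext => w; rewrite mxE.
Qed.

Lemma mmoment_sum k (I : Type) (r : seq I) a b (A : I -> Omega -> 'M[R]_(a, b)) :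
  (forall i, mmoment k (A i)) -> mmoment k (fun w => \sum_(i <- r) A i w).
Proof.
move=> mA i j; rewrite (_ : (fun w => _) = (fun w => \sum_(l <- r) A l w i j)).
  by apply: moment_sum => l _; exact: mA.
by apply/funext => w; rewrite summxE.
Qed.

Lemma mmoment_mull k a b c (C : 'M[R]_(a, b)) (A : Omega -> 'M[R]_(b, c)) :
  mmoment k A -> mmoment k (fun w => C *m A w).
Proof.
move=> mA i j; rewrite (_ : (fun w => _) = (fun w => \sum_l C i l * A w l j)).
  by apply: moment_sum => l _; exact: momentZ.
by apply/funext => w; rewrite mxE.
Qed.

Lemma mmoment_mulr k a b c (A : Omega -> 'M[R]_(a, b)) (C : 'M[R]_(b, c)) :
  mmoment k A -> mmoment k (fun w => A w *m C).
Proof.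
move=> mA i j; rewrite (_ : (fun w => _) = (fun w => \sum_l C l j * A w i l)).
  by apply: moment_sum => l _; exact: momentZ.
by apply/funext => w; rewrite mxE; apply: eq_bigr => l _; rewrite mulrC.
Qed.

Lemma mmomentM k a b c (A : Omega -> 'M[R]_(a, b)) (B : Omega -> 'M[R]_(b, c)) :
  mmoment (k + k) A -> mmoment (k + k) B -> mmoment k (fun w => A w *m B w).
Proof.
move=> mA mB i j; rewrite (_ : (fun w => _) = (fun w => \sum_l A w i l * B w l j)).
  by apply: moment_sum => l _; exact: momentM.
by apply/funext => w; rewrite mxE.
Qed.

Let mint a b (A : Omega -> 'M[R]_(a, b)) i j : mmoment 1 A ->
  P.-integrable setT (EFin \o (fun w => A w i j)).
Proof. by move=> mA; apply/moment1_integrable. Qed.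

Lemma EmxD a b (A B : Omega -> 'M[R]_(a, b)) : mmoment 1 A -> mmoment 1 B ->
  Emx P (fun w => A w + B w) = Emx P A + Emx P B.
Proof.
move=> mA mB; apply/matrixP => i j; rewrite [RHS]mxE !EmxE -RintegralD//; try exact: mint.
by apply: eq_Rintegral => w _; rewrite mxE.
Qed.

Lemma EmxZ c a b (A : Omega -> 'M[R]_(a, b)) : mmoment 1 A ->
  Emx P (fun w => c *: A w) = c *: Emx P A.
Proof.
move=> mA; apply/matrixP => i j; rewrite [RHS]mxE !EmxE -RintegralZl//; try exact: mint.
by apply: eq_Rintegral => w _; rewrite mxE.
Qed.

Lemma EmxB a b (A B : Omega -> 'M[R]_(a, b)) : mmoment 1 A -> mmoment 1 B ->
  Emx P (fun w => A w - B w) = Emx P A - Emx P B.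
Proof.
move=> mA mB; rewrite -[in RHS]scaleN1r -EmxZ// -EmxD//; last exact: mmomentZ.
by congr Emx; apply/funext => w; rewrite scaleN1r.
Qed.

Lemma Emx_sum (I : Type) (r : seq I) a b (A : I -> Omega -> 'M[R]_(a, b)) :
  (forall i, mmoment 1 (A i)) ->
  Emx P (fun w => \sum_(i <- r) A i w) = \sum_(i <- r) Emx P (A i).
Proof.
move=> mA; apply/matrixP => i j; rewrite EmxE summxE.
under eq_Rintegral do rewrite summxE.
rewrite (int_sum _ _).1; last by move=> l _; exact: mint.
by apply: eq_bigr => l _; rewrite EmxE.
Qed.

Lemma Emx_tr a b (A : Omega -> 'M[R]_(a, b)) : Emx P (fun w => (A w)^T) = (Emx P A)^T.
Proof.
apply/matrixP => i j; rewrite [RHS]mxE !EmxE.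
by apply: eq_Rintegral => w _; rewrite mxE.
Qed.

Lemma Emx_mull a b c (C : 'M[R]_(a, b)) (A : Omega -> 'M[R]_(b, c)) :
  mmoment 1 A -> Emx P (fun w => C *m A w) = C *m Emx P A.
Proof.
move=> mA; apply/matrixP => i j; rewrite EmxE mxE.
under eq_Rintegral do rewrite mxE.
rewrite (int_sum _ _).1; last by move=> l _; apply: rintegrableZ; exact: mint.
by apply: eq_bigr => l _; rewrite EmxE RintegralZl//; exact: mint.
Qed.

Lemma Emx_mulr a b c (A : Omega -> 'M[R]_(a, b)) (C : 'M[R]_(b, c)) :
  mmoment 1 A -> Emx P (fun w => A w *m C) = Emx P A *m C.
Proof.
move=> mA; rewrite -[RHS]trmxK trmx_mul -Emx_tr -Emx_mull; last exact: mmoment_tr.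
rewrite -Emx_tr; congr Emx; apply/funext => w.
by rewrite trmx_mul !trmxK.
Qed.

Lemma Rintegral_ae (X Y : Omega -> R) : measurable_fun setT X -> measurable_fun setT Y ->
  {ae P, forall w, X w = Y w} -> \int[P]_w X w = \int[P]_w Y w.
Proof.
move=> mX mY XY; congr fine; apply: ae_eq_integral => //; try exact/measurable_EFinP.
by apply: filterS XY => w /= ->.
Qed.

Lemma Emx_ae a b (A B : Omega -> 'M[R]_(a, b)) : measurable_mx A -> measurable_mx B ->
  {ae P, forall w, A w = B w} -> Emx P A = Emx P B.
Proof.
move=> mA mB AB; apply/matrixP => i j; rewrite !EmxE; apply: Rintegral_ae => //.
by apply: filterS AB => w /= ->.
Qed.

(** The regressors get their moments from z through an identity that holds only almost surely. *)
Lemma mmoment_ae k a b (A B : Omega -> 'M[R]_(a, b)) : measurable_mx A ->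
  {ae P, forall w, A w = B w} -> mmoment k B -> mmoment k A.
Proof.
move=> mA AB mB i j; split=> //; have [mBij iBij] := mB i j.
apply/integrableP; split; first by apply/measurable_EFinP; exact: measurable_normX.
case/integrableP : iBij => _; congr (_ < _)%E; apply: ae_eq_integral => //.
- apply: measurableT_comp => //; apply/measurable_EFinP; exact: measurable_normX.
- apply: measurableT_comp => //; apply/measurable_EFinP; exact: measurable_normX.
- by apply: filterS AB => w /= ->.
Qed.

Lemma mmoment_measurable k a b (A : Omega -> 'M[R]_(a, b)) : mmoment k A -> measurable_mx A.
Proof. by move=> mA i j; exact: moment_measurable (mA i j). Qed.

Lemma measurable_mxM a b c (A : Omega -> 'M[R]_(a, b)) (B : Omega -> 'M[R]_(b, c)) :
  measurable_mx A -> measurable_mx B -> measurable_mx (fun w => A w *m B w).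
Proof.
move=> mA mB i j; rewrite (_ : (fun w => _) = (fun w => \sum_l A w i l * B w l j)).
  by apply: measurable_sum => l; exact: measurable_funM.
by apply/funext => w; rewrite mxE.
Qed.

Lemma measurable_mxD a b (A B : Omega -> 'M[R]_(a, b)) :
  measurable_mx A -> measurable_mx B -> measurable_mx (fun w => A w + B w).
Proof.
move=> mA mB i j; rewrite (_ : (fun w => _) = (fun w => A w i j + B w i j)).
  exact: measurable_funD.
by apply/funext => w; rewrite mxE.
Qed.

Lemma measurable_mxB a b (A B : Omega -> 'M[R]_(a, b)) :
  measurable_mx A -> measurable_mx B -> measurable_mx (fun w => A w - B w).
Proof.
move=> mA mB i j; rewrite (_ : (fun w => _) = (fun w => A w i j - B w i j)).
  exact: measurable_funB.
by apply/funext => w; rewrite !mxE.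
Qed.

Lemma measurable_mxZ a b (c : Omega -> R) (A : Omega -> 'M[R]_(a, b)) :
  measurable_fun setT c -> measurable_mx A -> measurable_mx (fun w => c w *: A w).
Proof.
move=> mc mA i j; rewrite (_ : (fun w => _) = (fun w => c w * A w i j)).
  exact: measurable_funM.
by apply/funext => w; rewrite !mxE.
Qed.

Lemma measurable_mx_tr a b (A : Omega -> 'M[R]_(a, b)) :
  measurable_mx A -> measurable_mx (fun w => (A w)^T).
Proof.
move=> mA i j; rewrite (_ : (fun w => _) = (fun w => A w j i))//.
by apply/funext => w; rewrite mxE.
Qed.

Lemma measurable_mx_sum (I : Type) (r : seq I) a b (A : I -> Omega -> 'M[R]_(a, b)) :
  (forall i, measurable_mx (A i)) -> measurable_mx (fun w => \sum_(i <- r) A i w).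
Proof.
move=> mA i j; rewrite (_ : (fun w => _) = (fun w => \sum_(l <- r) A l w i j)).
  by apply: measurable_sum => l; exact: mA.
by apply/funext => w; rewrite summxE.
Qed.

Lemma measurable_mx_cst a b (C : 'M[R]_(a, b)) :
  measurable_mx (fun _ : Omega => C).
Proof. by move=> i j; exact: measurable_cst. Qed.

Lemma measurable_det n (A : Omega -> 'M[R]_n) : measurable_mx A ->
  measurable_fun setT (fun w => \det (A w)).
Proof.
move=> mA; apply: measurable_sum => s; apply: measurable_funM => //.
by apply: measurable_prod => i _; exact: mA.
Qed.

Lemma measurable_adj n (A : Omega -> 'M[R]_n) : measurable_mx A ->
  measurable_mx (fun w => \adj (A w)).
Proof.
move=> mA i j; rewrite (_ : (fun w => _) = (fun w => cofactor (A w) j i)).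
  apply: measurable_funM => //; apply: measurable_det => k l.
  rewrite (_ : (fun w => _) = (fun w => A w (lift j k) (lift i l)))//.
  by apply/funext => w; rewrite !mxE.
by apply/funext => w; rewrite mxE.
Qed.

Lemma measurable_invr : measurable_fun [set: R] (@GRing.inv R).
Proof.
have -> : (@GRing.inv R) = fun x : R => if x == 0 then 0 else x^-1.
  by apply/funext => x; case: eqVneq => // ->; rewrite invr0.
apply: measurable_fun_if => //; first exact: measurable_fun_eqr.
have -> : [set: R] `&` (fun x : R => x == 0) @^-1` [set false] = [set x : R | x != 0].
  by apply/seteqP; split => x /=; [case=> _ ->|move=> /negbTE ->].
apply: open_continuous_measurable_fun.
  have -> : [set x : R | x != 0] = ~` [set 0] by apply/seteqP; split => x /= /eqP.
  by apply: closed_openC; exact: closed_eq.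
by move=> x; rewrite inE /= => x0; exact: inv_continuous.
Qed.

Lemma measurable_invmx n (A : Omega -> 'M[R]_n) : measurable_mx A ->
  measurable_mx (fun w => invmx (A w)).
Proof.
move=> mA i j.
(* Cramer's rule; on singular matrices [invmx] returns its argument. *)
rewrite (_ : (fun w => _) = (fun w => if \det (A w) == 0 then A w i j
  else (\det (A w))^-1 * (\adj (A w)) i j)); last first.
  apply/funext => w; rewrite /invmx unitmxE unitfE.
  by case: eqVneq => //= _; rewrite mxE.
apply: measurable_fun_ifT => //.
- apply: measurable_fun_eqr => //; exact: measurable_det.
- apply: measurable_funM; last exact: measurable_adj.
  apply: measurableT_comp; last exact: measurable_det.
  exact: measurable_invr.
Qed.

End random_mx.

Section blocks.
Context {d : measure_display} {Omega : measurableType d} {R : realType}.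
Variable P : probability Omega R.

Lemma Emx_row_mx a b c (A : Omega -> 'M[R]_(a, b)) (B : Omega -> 'M[R]_(a, c)) :
  Emx P (fun w => row_mx (A w) (B w)) = row_mx (Emx P A) (Emx P B).
Proof.
apply/matrixP => i j; rewrite EmxE [RHS]mxE; case: split_ordP => k ->;
  by rewrite EmxE; apply: eq_Rintegral => w _; rewrite ?row_mxEl ?row_mxEr.
Qed.

Lemma Emx_col_mx a b c (A : Omega -> 'M[R]_(a, c)) (B : Omega -> 'M[R]_(b, c)) :
  Emx P (fun w => col_mx (A w) (B w)) = col_mx (Emx P A) (Emx P B).
Proof.
apply/matrixP => i j; rewrite EmxE [RHS]mxE; case: split_ordP => k ->;
  by rewrite EmxE; apply: eq_Rintegral => w _; rewrite ?col_mxEu ?col_mxEd.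
Qed.

Lemma mmoment_row_mx k a b c (A : Omega -> 'M[R]_(a, b)) (B : Omega -> 'M[R]_(a, c)) :
  mmoment P k A -> mmoment P k B -> mmoment P k (fun w => row_mx (A w) (B w)).
Proof.
move=> mA mB i j; under eq_fun do rewrite mxE.
by case: (fintype.split j) => l; [exact: mA|exact: mB].
Qed.

Lemma mmoment_col_mx k a b c (A : Omega -> 'M[R]_(a, c)) (B : Omega -> 'M[R]_(b, c)) :
  mmoment P k A -> mmoment P k B -> mmoment P k (fun w => col_mx (A w) (B w)).
Proof.
move=> mA mB i j; under eq_fun do rewrite mxE.
by case: (fintype.split i) => l; [exact: mA|exact: mB].
Qed.

End blocks.

Section row_sums.
Context {R : realType} {T1 : nat}.
Local Notation T := (1 + T1)%N.

Lemma trmul_rows n a b (A : 'M[R]_(n, a)) (B : 'M[R]_(n, b)) :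
  A^T *m B = \sum_t (row t A)^T *m row t B.
Proof.
apply/matrixP => i j; rewrite mxE summxE; apply: eq_bigr => t _.
by rewrite !mxE big_ord1 !mxE.
Qed.

Lemma trmul_rows_weighted n a b (A : 'M[R]_(n, a)) (Q : 'M[R]_n) (B : 'M[R]_(n, b)) :
  A^T *m Q *m B = \sum_s \sum_t Q s t *: ((row s A)^T *m row t B).
Proof.
apply/matrixP => i j; rewrite mxE summxE.
under [RHS]eq_bigr do rewrite summxE.
rewrite exchange_big /=; apply: eq_bigr => t _.
rewrite mxE mulr_suml; apply: eq_bigr => s _.
by rewrite !mxE big_ord1 !mxE; ring.
Qed.

Local Notation io := (@iota_T R T1).
Local Notation Q := (@Qmx R T1).

Lemma iota_unit : io^T *m io \in unitmx.
Proof.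
have -> : io^T *m io = (T%:R)%:M.
  apply/matrixP => i j; rewrite !ord1 !mxE eqxx mulr1n.
  under eq_bigr do rewrite !mxE mulr1.
  by rewrite sumr_const card_ord.
by rewrite unitmxE det_scalar expr1 unitfE pnatr_eq0.
Qed.

Lemma Qmx_iota : Q *m io = 0.
Proof.
rewrite /Qmx mulmxBl mul1mx -!mulmxA mulVmx ?mulmx1 ?subrr//.
exact: iota_unit.
Qed.

Lemma Qmx_sym : Q^T = Q.
Proof.
rewrite /Qmx linearB /= trmx1 !trmx_mul trmxK trmx_inv trmx_mul trmxK.
by rewrite mulmxA.
Qed.

Lemma Qmx_idem : Q *m Q = Q.
Proof.
rewrite {2}/Qmx mulmxBr mulmx1 !mulmxA Qmx_iota !mul0mx subr0 //.
Qed.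

(** Q annihilates constants over the periods. Row sums serve alternative (A); column sums, equal to
    them by symmetry, serve (B). *)
Lemma Qmx_row_sum s : \sum_t Q s t = 0.
Proof.
have : (Q *m io) s 0 = 0 by rewrite Qmx_iota mxE.
rewrite mxE => {2}<-; apply: eq_bigr => t _.
by rewrite [io _ _]mxE mulr1.
Qed.

Lemma Qmx_col_sum t : \sum_s Q s t = 0.
Proof.
rewrite -[RHS](Qmx_row_sum t); apply: eq_bigr => s _.
by rewrite -[in LHS]Qmx_sym mxE.
Qed.

End row_sums.

(** * Population moments of the panel *)

Section population.
Context {d : measure_display} {Omega : measurableType d} {R : realType}.
Context {T1 K m : nat}.
Local Notation T := (1 + T1)%N.
Local Notation p := (K + (m + T1))%N.
Variables (P : probability Omega R) (M : panel Omega R T1 K m).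
Variable (sel : 'I_m -> 'I_T * 'I_K).
Hypothesis mX : forall i, measurable_mx (regr M i).
Hypothesis meff : forall i, measurable_fun [set: Omega] (effect M i).
Hypothesis meps : forall i, measurable_mx (error M i).
Hypothesis phi_neq0 : phi01 M != 0.
Hypothesis Eeff : forall i, ('E_P[effect M i] = 0)%E.
Hypothesis Eeps : forall i t, \int[P]_w error M i w t 0 = 0.
Hypothesis zsel : forall i w j, zvec M i w j 0 = regr M i w (sel j).1 (sel j).2.
Hypothesis v4 : forall i j, ('E_P[(fun w => vvec P M i w j 0 ^+ 4)%R] < +oo)%E.
Hypothesis zeps0 : Emx P (fun w => zvec M 0%N w *m (error M 0%N w)^T) = 0.
Hypothesis zpos : posdefmx (Varmx P (zvec M 0%N)).

Definition zcen (i : nat) (w : Omega) : 'cV[R]_m := zvec M i w - Emx P (zvec M 0%N).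

Local Notation Sg := (Varmx P (zvec M 0%N)).
Local Notation th0 := (theta0 P M).

Lemma measurable_zvec i : measurable_mx (zvec M i).
Proof.
move=> a b; rewrite ord1 (_ : (fun w => _) = (fun w => regr M i w (sel a).1 (sel a).2)).
  exact: mX.
by apply/funext => w; exact: zsel.
Qed.

Lemma measurable_eta i : measurable_fun setT (eta M i).
Proof. exact: measurable_funM. Qed.

Lemma measurable_proj_error i : measurable_fun setT (proj_error P M i).
Proof.
apply: measurable_funB; first by apply: measurable_funB => //; exact: measurable_eta.
exact: (measurable_mxM (measurable_mx_tr (@measurable_zvec i)) (measurable_mx_cst th0)).
Qed.

Lemma measurable_vvec i : measurable_mx (vvec P M i).
Proof.
move=> a b; rewrite ord1 /vvec; under eq_fun do rewrite mxE.
case: (fintype.split a) => j; first exact: measurable_zvec.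
under eq_fun do rewrite mxE.
case: (fintype.split j) => k; last exact: meps.
by under eq_fun do rewrite mxE ord1 eqxx mulr1n; exact: measurable_proj_error.
Qed.

Lemma moment_vvec i : mmoment P 4 (vvec P M i).
Proof.
move=> a b; rewrite ord1; split; first exact: measurable_vvec.
have E : (fun w => `|vvec P M i w a 0| ^+ 4) = (fun w => vvec P M i w a 0 ^+ 4).
  apply/funext => w; rewrite (_ : 4 = 2 * 2)%N// !exprM.
  by rewrite real_normK ?num_real.
rewrite E; apply/integrableP; split.
  by apply/measurable_EFinP; apply: measurable_funX; exact: measurable_vvec.
have := v4 i a; rewrite unlock; congr (_ < _)%E; apply: eq_integral => w _.
by rewrite /= ger0_norm// (_ : 4 = 2 * 2)%N// exprM sqr_ge0.
Qed.

Lemma moment_zvec i : mmoment P 4 (zvec M i).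
Proof.
move=> a b; rewrite ord1; have := @moment_vvec i (lshift _ a) 0.
by congr moment; apply/funext => w; rewrite /vvec col_mxEu.
Qed.

Lemma moment_proj_error i : moment P 4 (proj_error P M i).
Proof.
have := @moment_vvec i (rshift m (lshift T 0)) 0.
by congr moment; apply/funext => w; rewrite /vvec col_mxEd col_mxEu mxE mulr1n.
Qed.

Lemma moment_error i : mmoment P 4 (error M i).
Proof.
move=> a b; rewrite ord1; have := @moment_vvec i (rshift m (rshift 1 a)) 0.
by congr moment; apply/funext => w; rewrite /vvec col_mxEd col_mxEd.
Qed.

Lemma moment_zcen i : mmoment P 4 (zcen i).
Proof. by apply: mmomentB; [exact: moment_zvec|exact: mmoment_cst]. Qed.

Lemma moment_uvec i : mmoment P 4 (uvec P M i).
Proof.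
apply: mmomentD; last exact: moment_error.
move=> a b; rewrite (_ : (fun w => _) = (fun w => Lambda0 M a b * proj_error P M i w)).
  by apply: momentZ; exact: moment_proj_error.
by apply/funext => w; rewrite mxE mulrC.
Qed.

(** The intercept [mu0] is such that it disappears once z is centred. *)
Lemma eta_decomp i w : eta M i w = ((zcen i w)^T *m th0) 0 0 + proj_error P M i w.
Proof.
rewrite /zcen /proj_error /mu0 linearB /= mulmxBl !mxE; ring.
Qed.

(** The moment assumption is on z and on the projection error; the effect inherits it through the
    decomposition. *)
Lemma moment_eta i : moment P 4 (eta M i).
Proof.
rewrite (_ : eta M i = fun w => ((zcen i w)^T *m th0) 0 0 + proj_error P M i w).
  apply: momentD; last exact: moment_proj_error.
  by apply: (mmoment_mulr _ (mmoment_tr (@moment_zcen i))).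
by apply/funext => w; exact: eta_decomp.
Qed.

Lemma expect_eta : \int[P]_w eta M 0%N w = 0.
Proof.
have meta := @moment_eta 0%N.
have E : effect M 0%N = fun w => (phi01 M)^-1 * eta M 0%N w.
  by apply/funext => w; rewrite /eta mulKf.
have : \int[P]_w effect M 0%N w = 0 by rewrite -fine_expectation Eeff.
rewrite E RintegralZl//; last exact: (moment_integrable _ meta).
by move/eqP; rewrite mulf_eq0 invr_eq0 (negbTE phi_neq0) => /eqP.
Qed.

Lemma expect_zcen : Emx P (zcen 0%N) = 0.
Proof.
have mz : mmoment P 1 (zvec M 0%N) := mmoment_leq (isT : (1 <= 4)%N) (@moment_zvec 0%N).
by rewrite EmxB ?Emx_cst ?subrr//; exact: mmoment_cst.
Qed.

Let zcen1 : mmoment P 1 (zcen 0%N).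
Proof. exact: mmoment_leq (isT : (1 <= 4)%N) (@moment_zcen 0%N). Qed.

Let zcen2 i : mmoment P 2 (zcen i).
Proof. exact: mmoment_leq (isT : (2 <= 4)%N) (@moment_zcen i). Qed.

Lemma expect_proj_error : \int[P]_w proj_error P M 0%N w = 0.
Proof.
have E : proj_error P M 0%N = fun w => eta M 0%N w - ((zcen 0%N w)^T *m th0) 0 0.
  by apply/funext => w; rewrite eta_decomp; ring.
have mzt : mmoment P 1 (fun w => (zcen 0%N w)^T *m th0).
  by apply: mmoment_mulr; apply: mmoment_tr.
rewrite E RintegralB//; last 2 first.
- exact: (moment_integrable _ (@moment_eta 0%N)).
- exact: (moment_integrable _ (mzt 0 0)).
rewrite expect_eta sub0r -(EmxE P (fun w => (zcen 0%N w)^T *m th0)) Emx_mulr; last exact: mmoment_tr.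
by rewrite Emx_tr expect_zcen trmx0 mul0mx mxE oppr0.
Qed.

Lemma expect_uvec t : \int[P]_w uvec P M 0%N w t 0 = 0.
Proof.
transitivity (\int[P]_w (Lambda0 M t 0 * proj_error P M 0%N w + error M 0%N w t 0)).
  by apply: eq_Rintegral => w _; rewrite /uvec !mxE mulrC.
have ia := moment_integrable (isT : (0 < 4)%N) (@moment_proj_error 0%N).
rewrite RintegralD//; last 2 first.
- exact: rintegrableZ.
- exact: (moment_integrable _ (@moment_error 0%N t 0)).
by rewrite RintegralZl// expect_proj_error mulr0 Eeps addr0.
Qed.

Lemma covE (X Y : Omega -> R) :
  fine (covariance P X Y) = \int[P]_w ((X w - \int[P]_w X w) * (Y w - \int[P]_w Y w)).
Proof. by rewrite covariance.unlock fine_expectation; apply: eq_Rintegral => w _; rewrite /= !fine_expectation. Qed.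

Lemma Var_zcen : Sg = Emx P (fun w => zcen 0%N w *m (zcen 0%N w)^T).
Proof.
apply/matrixP => i j; rewrite EmxE mxE covE; apply: eq_Rintegral => w _.
by rewrite mxE big_ord1 !mxE !fine_expectation.
Qed.

Lemma expect_zcen_eta : Emx P (fun w => eta M 0%N w *: zcen 0%N w) =
  Covmx P (zvec M 0%N) (fun w => (eta M 0%N w)%:M : 'cV[R]_1).
Proof.
apply/matrixP => i j; rewrite EmxE [RHS]mxE covE ord1.
have E0 : \int[P]_w ((eta M 0%N w)%:M : 'cV[R]_1) 0 0 = 0.
  by rewrite -expect_eta; apply: eq_Rintegral => w _; rewrite mxE mulr1n.
rewrite E0; apply: eq_Rintegral => w _.
by rewrite !mxE !fine_expectation mulr1n subr0 mulrC.
Qed.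

Lemma Sg_sym : Sg^T = Sg. Proof. by case: zpos. Qed.

Lemma Sg_psd x : 0 <= bil Sg x x.
Proof.
have [->|x0] := eqVneq x 0; first by rewrite bil0l.
by case: zpos => _ /(_ x x0) /ltW.
Qed.

Lemma Sg_unit : Sg \in unitmx.
Proof.
rewrite -row_free_unit -kermx_eq0; apply/eqP/row_matrixP => i.
set v := row i _; have vS : v *m Sg = 0.
  by apply/eqP; rewrite -row_mul mulmx_ker row0.
rewrite row0; apply/eqP; apply: contraT => v0.
have vt0 : v^T != 0 by apply: contra_neq v0 => h; rewrite -[v]trmxK h trmx0.
by case: zpos => _ /(_ _ vt0); rewrite trmxK vS mul0mx mxE ltxx.
Qed.

Let zz1 : mmoment P 1 (fun w => zcen 0%N w *m (zcen 0%N w)^T).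
Proof. by apply: mmomentM; [exact: zcen2|exact: mmoment_tr (zcen2 0)]. Qed.

Lemma moment_zcenZ k i (X : Omega -> R) : moment P (k + k) X -> mmoment P (k + k) (zcen i) ->
  mmoment P k (fun w => X w *: zcen i w).
Proof.
move=> mX' mz a b; rewrite (_ : (fun w => _) = (fun w => X w * zcen i w a b)).
  exact: momentM.
by apply/funext => w; rewrite mxE.
Qed.

(** The normal equation of the projection: E(eta z) - Var(z) theta0 = 0 for centred z. *)
Lemma expect_zcen_proj_error : Emx P (fun w => proj_error P M 0%N w *: zcen 0%N w) = 0.
Proof.
have E w : proj_error P M 0%N w *: zcen 0%N w =
    eta M 0%N w *: zcen 0%N w - (zcen 0%N w *m (zcen 0%N w)^T) *m th0.
  rewrite eta_decomp scalerDl -mulmxA.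
  set x := (zcen 0%N w)^T *m th0.
  have -> : zcen 0%N w *m x = x 0 0 *: zcen 0%N w.
    by rewrite {1}[x]mx11_scalar mul_mx_scalar.
  by rewrite addrAC subrr add0r.
rewrite (_ : (fun w => _) = (fun w => eta M 0%N w *: zcen 0%N w -
   (zcen 0%N w *m (zcen 0%N w)^T) *m th0)); last by apply/funext => w; exact: E.
rewrite EmxB; last 2 first.
- by apply: moment_zcenZ; [exact: moment_leq (moment_eta 0)|exact: zcen2].
- exact: mmoment_mulr.
rewrite expect_zcen_eta Emx_mulr// -Var_zcen /theta0 mulKVmx ?subrr//; exact: Sg_unit.
Qed.

Lemma expect_zcen_error t : Emx P (fun w => error M 0%N w t 0 *: zcen 0%N w) = 0.
Proof.
have m1 : mmoment P 1 (fun w => error M 0%N w t 0 *: zvec M 0%N w).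
  move=> a b; rewrite (_ : (fun w => _) = (fun w => error M 0%N w t 0 * zvec M 0%N w a b)).
    by apply: momentM; [exact: moment_leq (@moment_error 0%N t 0)|exact: moment_leq (@moment_zvec 0%N a b)].
  by apply/funext => w; rewrite mxE.
have ie := moment_integrable (isT : (0 < 4)%N) (@moment_error 0%N t 0).
apply/matrixP => i j; rewrite EmxE [RHS]mxE ord1.
transitivity (\int[P]_w ((zvec M 0%N w *m (error M 0%N w)^T) i t
   - Emx P (zvec M 0%N) i 0 * error M 0%N w t 0)).
  by apply: eq_Rintegral => w _; rewrite /zcen !mxE big_ord1 !mxE; ring.
have mze : mmoment P 1 (fun w => zvec M 0%N w *m (error M 0%N w)^T).
  apply: mmomentM; first exact: mmoment_leq (moment_zvec 0).
  by apply: mmoment_tr; exact: mmoment_leq (moment_error 0).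
rewrite RintegralB//; last 2 first.
- exact: (moment_integrable _ (mze i t)).
- exact: rintegrableZ.
rewrite RintegralZl// Eeps mulr0 subr0.
by rewrite -(EmxE P (fun w => zvec M 0%N w *m (error M 0%N w)^T)) zeps0 mxE.
Qed.

Lemma expect_zcen_uvec t : Emx P (fun w => uvec P M 0%N w t 0 *: zcen 0%N w) = 0.
Proof.
rewrite (_ : (fun w => _) = (fun w => Lambda0 M t 0 *: (proj_error P M 0%N w *: zcen 0%N w)
   + error M 0%N w t 0 *: zcen 0%N w)); last first.
  by apply/funext => w; rewrite /uvec !mxE scalerDl mulrC scalerA.
have m1 : mmoment P 1 (fun w => proj_error P M 0%N w *: zcen 0%N w).
  by apply: moment_zcenZ; [exact: moment_leq (moment_proj_error 0)|exact: zcen2].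
have m2 : mmoment P 1 (fun w => error M 0%N w t 0 *: zcen 0%N w).
  by apply: moment_zcenZ; [exact: moment_leq (@moment_error 0%N t 0)|exact: zcen2].
rewrite EmxD//; last exact: mmomentZ.
by rewrite EmxZ// expect_zcen_proj_error expect_zcen_error scaler0 addr0.
Qed.

Variable S : 'I_T -> 'M[R]_(m, K).
Hypothesis xae : forall i t, {ae P, forall w, xvec M t i w - Emx P (xvec M t 0%N)
  = (S t)^T *m (zvec M i w - Emx P (zvec M 0%N))}.
Hypothesis Vneq : ('V_P[effect M 0%N] != 0)%E.
Hypothesis AB : Lambda0 M = iota_T \/ (exists F, forall t, Phi_x P M t = F).
Hypothesis within_unit :
  Emx P (fun w => (Xstar P M 0%N w)^T *m Qmx *m Xstar P M 0%N w) \in unitmx.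
Hypothesis H0_unit : H0plus P M \in unitmx.

Local Notation l0 := (lambda0 M).
Local Notation hess0 := (hess S th0 l0 Sg).
Local Notation within0 := (within_mx S (@Qmx R T1) Sg).

Definition xlin (z : 'cV[R]_m) : 'M[R]_(T, K) := \matrix_(t, k) (z^T *m S t) 0 k.

Lemma row_xlin t z : row t (xlin z) = z^T *m S t.
Proof. by apply/matrixP => i j; rewrite !mxE ord1; apply: eq_bigr => k _; rewrite !mxE. Qed.

(** One event for all individuals at once, of probability one as a countable intersection; on it the
    algebra of the sample can be done pointwise. *)
Definition regr_in_span (w : Omega) : Prop := forall i, Xstar P M i w = xlin (zcen i w).

Lemma regr_in_span_ae : {ae P, forall w, regr_in_span w}.
Proof.
apply: ae_foralln => i.
have : {ae P, forall w, forall t : 'I_T, xvec M t i w - Emx P (xvec M t 0%N)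
  = (S t)^T *m (zvec M i w - Emx P (zvec M 0%N))}.
  by apply: filter_forall => t; exact: xae.
apply: filterS => w h; apply/row_matrixP => t; rewrite row_xlin.
apply: trmx_inj; rewrite trmx_mul trmxK /zcen -h /Xstar /xvec linearB /= linearB /=; congr (_ - _).
apply/matrixP => a b; rewrite ord1 !mxE !fine_expectation.
by apply: eq_Rintegral => w' _; rewrite !mxE.
Qed.

Lemma moment_xlin i : mmoment P 4 (fun w => xlin (zcen i w)).
Proof.
move=> t k; under eq_fun do rewrite mxE.
exact: (mmoment_mulr (S t) (mmoment_tr (@moment_zcen i)) 0 k).
Qed.

Lemma moment_Xstar i : mmoment P 4 (Xstar P M i).
Proof.
apply: (mmoment_ae _ _ (@moment_xlin i)).
  by apply: measurable_mxB => //; exact: measurable_mx_cst.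
by apply: filterS regr_in_span_ae => w; exact.
Qed.

Lemma moment_regr i : mmoment P 4 (regr M i).
Proof.
have -> : regr M i = fun w => Xstar P M i w + Emx P (regr M 0%N).
  by apply/funext => w; rewrite /Xstar subrK.
by apply: mmomentD; [exact: moment_Xstar|exact: mmoment_cst].
Qed.

Let E01 : 'M[R]_(T, T1) := col_mx 0 1%:M.

Lemma RmxE i w : Rmx P M i w = row_mx (regr M i w)
  (row_mx (Lambda0 M *m (zvec M i w)^T) (((zvec M i w)^T *m th0) 0 0 *: E01)).
Proof.
rewrite /Rmx block_mxEh vsubmxK; congr row_mx.
rewrite -[col_mx (row_mx _ _) _]/(block_mx _ _ _ _) block_mxEh; congr row_mx.
  by rewrite /Lambda0 /Lambda_of mul_col_mx mul1mx.
by rewrite /E01 scale_col_mx scaler0 scalemx1.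
Qed.

Lemma RstarE i w : Rstar P M i w = row_mx (Xstar P M i w)
  (row_mx (Lambda0 M *m (zcen i w)^T) (((zcen i w)^T *m th0) 0 0 *: E01)).
Proof.
have z4 := @moment_zvec 0%N.
have z1 : mmoment P 1 (zvec M 0%N) := mmoment_leq (isT : (1 <= 4)%N) z4.
have z1t := mmoment_tr z1.
rewrite /Rstar RmxE.
have -> : Emx P (Rmx P M 0%N) = row_mx (Emx P (regr M 0%N))
  (row_mx (Lambda0 M *m (Emx P (zvec M 0%N))^T) (((Emx P (zvec M 0%N))^T *m th0) 0 0 *: E01)).
  have -> : Rmx P M 0%N = fun w => row_mx (regr M 0%N w)
     (row_mx (Lambda0 M *m (zvec M 0%N w)^T) (((zvec M 0%N w)^T *m th0) 0 0 *: E01)).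
    by apply/funext => w'; exact: RmxE.
  rewrite !Emx_row_mx Emx_mull// Emx_tr; congr (row_mx _ (row_mx _ _)).
  apply/matrixP => a b; rewrite EmxE [RHS]mxE -Emx_tr -Emx_mulr// EmxE.
  rewrite -RintegralZr//; last exact: (moment_integrable (isT : (0 < 1)%N) (mmoment_mulr th0 z1t 0 0)).
  by apply: eq_Rintegral => w' _; rewrite mxE.
rewrite opp_row_mx add_row_mx opp_row_mx add_row_mx; congr (row_mx _ (row_mx _ _)).
  by rewrite -mulmxBr -linearB.
by rewrite -scalerBl /zcen [in RHS]linearB /= mulmxBl !mxE.
Qed.

(** R is the derivative in psi of the regression function, whose entry t is z' pi_t(psi). This is
    what identifies the first block of [H0plus] with [hess]. *)
Lemma row_Rstar i w t : regr_in_span w ->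
  row t (Rstar P M i w) = (zcen i w)^T *m jac S th0 l0 t.
Proof.
move=> gw; rewrite RstarE gw !row_row_mx row_xlin /jac !mul_mx_row; congr (row_mx _ (row_mx _ _)).
  by rewrite row_mul mul_mx_scalar [X in X *m _]mx11_scalar mul_scalar_mx mxE.
rewrite mulmxA [X in X *m row t _]mx11_scalar mul_scalar_mx.
by rewrite linearZ.
Qed.

Lemma moment_Rstar i : mmoment P 4 (Rstar P M i).
Proof.
have -> : Rstar P M i = fun w => row_mx (Xstar P M i w)
  (row_mx (Lambda0 M *m (zcen i w)^T) (((zcen i w)^T *m th0) 0 0 *: E01)).
  by apply/funext => w; exact: RstarE.
have zt := mmoment_tr (@moment_zcen i).
apply: mmoment_row_mx; first exact: moment_Xstar.
apply: mmoment_row_mx; first exact: mmoment_mull.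
move=> a b; rewrite (_ : (fun w => _) = fun w => E01 a b * ((zcen i w)^T *m th0) 0 0).
  by apply: momentZ; exact: mmoment_mulr.
by apply/funext => w; rewrite mxE mulrC.
Qed.

Lemma moment_Rplus i : mmoment P 4 (Rplus P M i).
Proof.
apply: mmoment_col_mx; apply: mmoment_row_mx.
- exact: moment_Rstar.
- exact: mmoment_cst.
- exact: mmoment_cst.
- by apply: mmoment_mull; exact: moment_Xstar.
Qed.

Lemma outcomeE i w : outcome M i w =
  regr M i w *m beta0 M + delta0 M + eta M i w *: Lambda0 M + error M i w.
Proof.
rewrite /outcome; congr (_ + _ + _).
rewrite /eta mulrC -scalerA; congr (_ *: _).
rewrite /Lambda0 /Lambda_of /lambda0 scale_col_mx scalerA mulfV// scale1r.
rewrite -[LHS]vsubmxK; congr col_mx.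
by apply/matrixP => a b; rewrite !ord1 !mxE mulr1n mulr1.
Qed.

(** What remains after beta0 still contains z' theta0 Lambda0, the predictable part of the effect.
    The nonlinear estimator models it; the within estimator needs Q to remove it, or its product
    with Q X to have mean zero. *)
Lemma outcome_center i w : ystar P M i w - Xstar P M i w *m beta0 M =
  ((zcen i w)^T *m th0) 0 0 *: Lambda0 M + uvec P M i w.
Proof.
have x1 : mmoment P 1 (regr M 0%N) := mmoment_leq (isT : (1 <= 4)%N) (moment_regr 0).
have e1 : mmoment P 1 (error M 0%N) := mmoment_leq (isT : (1 <= 4)%N) (moment_error 0).
have eta1 : mmoment P 1 (fun w => eta M 0%N w *: Lambda0 M).
  move=> a b; rewrite (_ : (fun w => _) = fun w => Lambda0 M a b * eta M 0%N w).
    by apply: momentZ; exact: moment_leq (isT : (1 <= 4)%N) (moment_eta 0).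
  by apply/funext => w'; rewrite mxE mulrC.
have EE0 : Emx P (outcome M 0%N) = Emx P (regr M 0%N) *m beta0 M + delta0 M.
  have -> : outcome M 0%N = fun w => regr M 0%N w *m beta0 M + delta0 M +
      eta M 0%N w *: Lambda0 M + error M 0%N w.
    by apply/funext => w'; exact: outcomeE.
  have m1 : mmoment P 1 (fun w => regr M 0%N w *m beta0 M) by exact: mmoment_mulr.
  have m2 := mmomentD m1 (mmoment_cst P 1 (delta0 M)).
  have m3 := mmomentD m2 eta1.
  rewrite EmxD// EmxD// EmxD//; last exact: mmoment_cst.
  rewrite Emx_mulr// Emx_cst -addrA [X in _ + X](_ : _ = 0) ?addr0//.
  apply/matrixP => a b; rewrite ord1 [LHS]mxE [RHS]mxE !EmxE Eeps addr0.
  transitivity (\int[P]_w (Lambda0 M a 0 * eta M 0%N w)).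
    by apply: eq_Rintegral => w' _; rewrite mxE mulrC.
  rewrite RintegralZl// ?expect_eta ?mulr0//.
  exact: (moment_integrable (isT : (0 < 4)%N) (moment_eta 0)).
rewrite /ystar /Xstar EE0 outcomeE mulmxBl eta_decomp /uvec scalerDl.
set a := regr M i w *m _; set b := Emx P _ *m _.
set x := _ *: Lambda0 M; set y := _ *: Lambda0 M; set D := delta0 M.
by apply/matrixP => s r; rewrite !mxE; ring.
Qed.

Lemma moment_uplus i : mmoment P 4 (uplus P M i).
Proof.
apply: mmoment_col_mx; first exact: moment_uvec.
have -> : (fun w => ystar P M i w - Xstar P M i w *m beta0 M) =
  (fun w => ((zcen i w)^T *m th0) 0 0 *: Lambda0 M + uvec P M i w).
  by apply/funext => w; exact: outcome_center.
apply: mmomentD; last exact: moment_uvec.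
move=> a b; rewrite (_ : (fun w => _) = fun w => Lambda0 M a b * ((zcen i w)^T *m th0) 0 0).
  by apply: momentZ; apply: mmoment_mulr; apply: mmoment_tr; exact: moment_zcen.
by apply/funext => w; rewrite mxE mulrC.
Qed.

Let QTQ : (@Qmx R T1)^T *m Qmx = Qmx.
Proof. by rewrite Qmx_sym Qmx_idem. Qed.

Lemma xlin_within z z' : (xlin z)^T *m Qmx *m xlin z' =
  \sum_s \sum_t (@Qmx R T1) s t *: ((S s)^T *m (z *m z'^T) *m S t).
Proof.
rewrite trmul_rows_weighted; apply: eq_bigr => s _; apply: eq_bigr => t _.
by rewrite !row_xlin trmx_mul trmxK !mulmxA.
Qed.

Lemma expect_hess : Emx P (fun w => (Rstar P M 0%N w)^T *m Rstar P M 0%N w) = hess0.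
Proof.
rewrite (@Emx_ae _ _ _ _ _ _ _ (fun w => \sum_t (jac S th0 l0 t)^T *m
    (zcen 0%N w *m (zcen 0%N w)^T) *m jac S th0 l0 t)).
- rewrite Emx_sum; last by move=> t; apply: mmoment_mulr; exact: mmoment_mull.
  apply: eq_bigr => t _; rewrite Emx_mulr; last exact: mmoment_mull.
  by rewrite Emx_mull// -Var_zcen.
- have mR := mmoment_measurable (moment_Rstar 0).
  by apply: measurable_mxM => //; exact: measurable_mx_tr.
- apply: measurable_mx_sum => t.
  by apply: (mmoment_measurable (k := 1)); apply: mmoment_mulr; exact: mmoment_mull.
apply: filterS regr_in_span_ae => w gw; rewrite trmul_rows; apply: eq_bigr => t _.
by rewrite row_Rstar// trmx_mul trmxK !mulmxA.
Qed.

Lemma expect_within : Emx P (fun w => (Xstar P M 0%N w)^T *m Qmx *m Xstar P M 0%N w) = within0.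
Proof.
have mS s t : mmoment P 1 (fun w => (@Qmx R T1) s t *: ((S s)^T *m (zcen 0%N w *m (zcen 0%N w)^T) *m S t)).
  by apply: mmomentZ; apply: mmoment_mulr; exact: mmoment_mull.
have mX' := mmoment_measurable (moment_Xstar 0).
rewrite (@Emx_ae _ _ _ _ _ _ _ (fun w => \sum_s \sum_t (@Qmx R T1) s t *:
   ((S s)^T *m (zcen 0%N w *m (zcen 0%N w)^T) *m S t))).
- rewrite Emx_sum; last by move=> s; apply: mmoment_sum => t; exact: mS.
  apply: eq_bigr => s _; rewrite Emx_sum//; apply: eq_bigr => t _.
  rewrite EmxZ; last by apply: mmoment_mulr; exact: mmoment_mull.
  rewrite Emx_mulr; last exact: mmoment_mull.
  by rewrite Emx_mull// -Var_zcen.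
- apply: measurable_mxM => //; apply: measurable_mxM; last exact: measurable_mx_cst.
  exact: measurable_mx_tr.
- by apply: measurable_mx_sum => s; apply: measurable_mx_sum => t; exact: mmoment_measurable (mS s t).
by apply: filterS regr_in_span_ae => w gw; rewrite gw xlin_within.
Qed.

Lemma H0plusE : H0plus P M = block_mx hess0 0 0 within0.
Proof.
rewrite /H0plus -expect_hess -expect_within.
rewrite -(Emx_cst P (0 : 'M[R]_(p, K))) -(Emx_cst P (0 : 'M[R]_(K, p))).
rewrite /block_mx -!Emx_row_mx -Emx_col_mx; congr Emx; apply/funext => w.
rewrite /Rplus tr_block_mx mulmx_block !trmx0 !mul0mx !mulmx0 !addr0 !add0r.
by rewrite trmx_mul mulmxA -[_ *m Qmx^T *m Qmx]mulmxA QTQ.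
Qed.

Lemma hess_unit0 : hess0 \in unitmx.
Proof. by have := H0_unit; rewrite H0plusE block_diag_mx_unit => /andP[]. Qed.

Lemma within_unit0 : within0 \in unitmx.
Proof. by rewrite -expect_within. Qed.

Lemma H0plus_inv : invmx (H0plus P M) = block_mx (invmx hess0) 0 0 (invmx within0).
Proof. by rewrite H0plusE invmx_block_diag// -H0plusE. Qed.

Lemma within0_sym : within0^T = within0.
Proof.
rewrite -expect_within -Emx_tr; congr Emx; apply/funext => w.
by rewrite !trmx_mul trmxK Qmx_sym mulmxA.
Qed.

Lemma H0plus_inv_sym : (invmx (H0plus P M))^T = invmx (H0plus P M).
Proof.
rewrite trmx_inv; congr invmx; rewrite H0plusE tr_block_mx !trmx0.
by rewrite within0_sym hess_sym//; exact: Sg_sym.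
Qed.

(** Influence function of the difference of the estimators, as a function of z and u alone and hence
    of v_i; by [influenceE] it is almost surely the linear map of the sandwich applied to one
    summand. *)
Definition influence (z : 'cV[R]_m) (u : 'cV[R]_T) : 'cV[R]_K :=
  diff_lin S Qmx th0 l0 Sg (z *m z^T) (fun t => u t 0 *: z).

Lemma influenceE w : regr_in_span w -> forall i, influence (zcen i w) (uvec P M i w) =
  Cmx *m invmx (H0plus P M) *m ((Rplus P M i w)^T *m uplus P M i w).
Proof.
move=> gw i.
have -> : (Rplus P M i w)^T *m uplus P M i w =
    col_mx (score S th0 l0 (fun t => uvec P M i w t 0 *: zcen i w))
      (within_score S Qmx th0 l0 (zcen i w *m (zcen i w)^T) (fun t => uvec P M i w t 0 *: zcen i w)).
  rewrite /Rplus /uplus tr_block_mx mul_block_col !trmx0 !mul0mx addr0 add0r.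
  congr col_mx.
    rewrite trmul_rows /score; apply: eq_bigr => t _.
    rewrite row_Rstar// trmx_mul trmxK -mulmxA; congr (_ *m _).
    by rewrite [row t _]mx11_scalar mul_mx_scalar !mxE.
  rewrite outcome_center trmx_mul Qmx_sym gw trmul_rows_weighted /within_score.
  apply: eq_bigr => s _; apply: eq_bigr => t _; congr (_ *: _).
  rewrite row_xlin trmx_mul trmxK -[zcen i w *m _ *m th0]mulmxA -[LHS]mulmxA.
  congr (_ *m _); rewrite [row t _]mx11_scalar mul_mx_scalar.
  rewrite [X in _ = _ *: (_ *m X) + _]mx11_scalar mul_mx_scalar scalerA -scalerDl.
  by congr (_ *: _); rewrite !mxE mulrC.
rewrite H0plus_inv /Cmx mul_row_block !mulmx0 addr0 add0r mul_row_col mulNmx mul1mx.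
rewrite /influence /diff_lin mulNmx; congr (_ - _).
rewrite -mulmxA; set x := _ *m score _ _ _ _.
by rewrite -{2}[x]vsubmxK mul_row_col mul1mx mul0mx addr0.
Qed.

Lemma within_score_Sg : within_score S Qmx th0 l0 Sg (fun=> 0) = 0.
Proof.
(* In this factorised form, a constant Lambda is killed by the row sums of Q after exchanging the
   sums, and a constant f by its column sums. *)
have core f : (forall t, (S t)^T *m (Sg *m th0) = f t) ->
  within_score S Qmx th0 l0 Sg (fun=> 0) = \sum_t Lambda0 M t 0 *: \sum_s (@Qmx R T1) s t *: f s.
  move=> h; rewrite /within_score exchange_big /=; apply: eq_bigr => t _.
  rewrite scaler_sumr; apply: eq_bigr => s _.
  by rewrite addr0 -scalemxAr h !scalerA mulrC.
case: AB => [LA|[F FE]].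
  rewrite (core _ (fun t => erefl)).
  rewrite LA; under eq_bigr do rewrite mxE scale1r.
  rewrite exchange_big /=; apply: big1 => s _.
  by rewrite -scaler_suml Qmx_row_sum scale0r.
pose v := fine ('V_P[effect M 0%N])%E.
have v0 : v != 0.
  have e2 : moment P 2 (effect M 0%N).
    have E : effect M 0%N = fun w => (phi01 M)^-1 * eta M 0%N w.
      by apply/funext => w; rewrite /eta mulKf.
    by rewrite E; apply: momentZ; exact: moment_leq (isT : (2 <= 4)%N) (moment_eta 0).
  (* [fine] would send an infinite variance to 0, so finiteness is what makes v invertible. *)
  have vf : ('V_P[effect M 0%N] \is a fin_num)%E.
    rewrite /variance covariance.unlock.
    have -> : fine ('E_P[effect M 0%N])%E = 0 by rewrite Eeff.
    rewrite unlock; apply: (integrable_fin_num measurableT).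
    have := moment2_sqr e2; congr (_.-integrable _ _); apply/funext => w.
    rewrite /= -[RHS]/(((effect M 0%N w - 0) * (effect M 0%N w - 0))%:E).
    by rewrite subr0 expr2.
  by rewrite fine_eq0.
(* [Sg *m th0] is Cov(z, eta), so the left side is Cov(x_t, eta). The factor v undoes the division
   by the variance in [Phi_x], and [phi01] turns the effect into eta. *)
have Sc t : (S t)^T *m (Sg *m th0) = (phi01 M * v) *: F^T.
  rewrite -(FE t) /Phi_x -/v.
  have -> : Sg *m th0 = Emx P (fun w => eta M 0%N w *: zcen 0%N w).
    by rewrite expect_zcen_eta /theta0 mulKVmx//; exact: Sg_unit.
  have m1 : mmoment P 1 (fun w => eta M 0%N w *: zcen 0%N w).
    by apply: moment_zcenZ; [exact: moment_leq (moment_eta 0)|exact: zcen2].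
  rewrite -Emx_mull// linearZ /= scalerA mulfK//.
  apply/matrixP => a b; rewrite ord1 [RHS]mxE [X in _ = _ * X]mxE [X in _ = _ * X]mxE covE.
  have E0 : \int[P]_w ((effect M 0%N w)%:M : 'cV[R]_1) 0 0 = 0.
    transitivity (\int[P]_w effect M 0%N w); last by rewrite -fine_expectation Eeff.
    by apply: eq_Rintegral => w _; rewrite mxE mulr1n.
  rewrite E0 EmxE.
  have mxe : mmoment P 1 (fun w => eta M 0%N w *: (Xstar P M 0%N w)).
    move=> x y; rewrite (_ : (fun w => _) = (fun w => eta M 0%N w * Xstar P M 0%N w x y)).
      apply: momentM; first exact: moment_leq (moment_eta 0).
      exact: moment_leq (moment_Xstar 0 x y).
    by apply/funext => w; rewrite mxE.
  transitivity (\int[P]_w (eta M 0%N w *: Xstar P M 0%N w) t a).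
    apply: Rintegral_ae.
    - exact: moment_measurable (mmoment_mull (S t)^T m1 a 0).
    - exact: moment_measurable (mxe t a).
    - apply: filterS regr_in_span_ae => w gw; rewrite gw -scalemxAr !mxE; congr (_ * _).
      by apply: eq_bigr => k _; rewrite !mxE mulrC.
  rewrite -RintegralZl//; last first.
    have := rintegrableZ (phi01 M)^-1 (moment_integrable (isT : (0 < 1)%N) (mxe t a)).
    congr (_.-integrable _ _); apply/funext => w /=; congr EFin.
    rewrite [in LHS]mxE /eta mulrA mulKf// subr0 !mxE mulr1n; congr (_ * (_ - _)).
    by rewrite !fine_expectation; apply: eq_Rintegral => w' _; rewrite !mxE.
  apply: eq_Rintegral => w _; rewrite mxE /eta -mulrA; congr (_ * _).
  rewrite subr0 !mxE mulr1n; congr (_ * (_ - _)).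
  by rewrite !fine_expectation; apply: eq_Rintegral => w' _; rewrite !mxE.
rewrite (core _ Sc) big1// => t _.
by rewrite -scaler_suml Qmx_col_sum scale0r scaler0.
Qed.

Lemma psi_beta_mul (x : 'cV[R]_p) : psi_beta x = row_mx 1%:M 0 *m x.
Proof. by rewrite -{2}[x]vsubmxK mul_row_col mul1mx mul0mx addr0. Qed.

Let moment_uz i t : mmoment P 2 (fun w => uvec P M i w t 0 *: zcen i w).
Proof. by apply: moment_zcenZ; [exact: (@moment_uvec i t 0)|exact: (@moment_zcen i)]. Qed.

Let moment_zz i : mmoment P 2 (fun w => zcen i w *m (zcen i w)^T).
Proof. by apply: mmomentM; [exact: (@moment_zcen i)|apply: mmoment_tr; exact: (@moment_zcen i)]. Qed.

Let moment_score i : mmoment P 2 (fun w =>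
  invmx hess0 *m score S th0 l0 (fun t => uvec P M i w t 0 *: zcen i w)).
Proof. by apply: mmoment_mull; apply: mmoment_sum => t; apply: mmoment_mull. Qed.

Let moment_within_influence i s t : mmoment P 2 (fun w => (@Qmx R T1) s t *: ((S s)^T *m
  (Lambda_of l0 t 0 *: (zcen i w *m (zcen i w)^T *m th0) + uvec P M i w t 0 *: zcen i w))).
Proof.
apply: mmomentZ; apply: mmoment_mull; apply: mmomentD => //.
by apply: mmomentZ; apply: mmoment_mulr.
Qed.

Let moment_within_score i : mmoment P 2 (fun w => invmx within0 *m
  within_score S Qmx th0 l0 (zcen i w *m (zcen i w)^T) (fun t => uvec P M i w t 0 *: zcen i w)).
Proof.
apply: mmoment_mull; apply: mmoment_sum => s; apply: mmoment_sum => t.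
exact: moment_within_influence.
Qed.

Lemma moment_influence i : mmoment P 2 (fun w => influence (zcen i w) (uvec P M i w)).
Proof.
apply: mmomentB; last exact: moment_within_score.
rewrite (_ : (fun w => _) = (fun w => row_mx 1%:M 0 *m (invmx hess0 *m
  score S th0 l0 (fun t => uvec P M i w t 0 *: zcen i w)))).
  by apply: mmoment_mull; exact: moment_score.
by apply/funext => w; exact: psi_beta_mul.
Qed.

Lemma expect_influence : Emx P (fun w => influence (zcen 0%N w) (uvec P M 0%N w)) = 0.
Proof.
have l2 a b (A : Omega -> 'M[R]_(a, b)) : mmoment P 2 A -> mmoment P 1 A by exact: mmoment_leq.
have ms := l2 _ _ _ (moment_score 0); have mw := l2 _ _ _ (moment_within_score 0).
have E1 : Emx P (fun w => psi_beta (invmx hess0 *m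
    score S th0 l0 (fun t => uvec P M 0%N w t 0 *: zcen 0%N w))) = 0.
  rewrite (_ : (fun w => _) = (fun w => row_mx 1%:M 0 *m (invmx hess0 *m
    score S th0 l0 (fun t => uvec P M 0%N w t 0 *: zcen 0%N w)))); last first.
    by apply/funext => w; exact: psi_beta_mul.
  have mj t : mmoment P 1 (fun w => (jac S th0 l0 t)^T *m (uvec P M 0%N w t 0 *: zcen 0%N w)).
    by apply: mmoment_mull; exact: l2.
  rewrite Emx_mull// Emx_mull; last exact: mmoment_sum.
  rewrite Emx_sum// big1 ?mulmx0// => t _.
  by rewrite Emx_mull ?expect_zcen_uvec ?mulmx0//; exact: l2.
have E2 : Emx P (fun w => invmx within0 *m within_score S Qmx th0 l0
    (zcen 0%N w *m (zcen 0%N w)^T) (fun t => uvec P M 0%N w t 0 *: zcen 0%N w)) = 0.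
  have mt s t := l2 _ _ _ (moment_within_influence 0 s t).
  have mst s := mmoment_sum (index_enum 'I_T) (mt s).
  rewrite Emx_mull; last exact: mmoment_sum.
  rewrite -[RHS](mulmx0 _ (invmx within0)); congr (_ *m _).
  rewrite -within_score_Sg Emx_sum// /within_score; apply: eq_bigr => s _.
  rewrite Emx_sum//; apply: eq_bigr => t _.
  have mz : mmoment P 1 (fun w => Lambda_of l0 t 0 *: (zcen 0%N w *m (zcen 0%N w)^T *m th0)).
    by apply: mmomentZ; apply: mmoment_mulr; exact: l2.
  have mu : mmoment P 1 (fun w => uvec P M 0%N w t 0 *: zcen 0%N w) by exact: l2.
  rewrite EmxZ; last by apply: mmoment_mull; exact: mmomentD.
  rewrite Emx_mull; last exact: mmomentD.
  rewrite EmxD// EmxZ; last by apply: mmoment_mulr; exact: l2.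
  rewrite Emx_mulr; last exact: l2.
  by rewrite expect_zcen_uvec -Var_zcen.
rewrite EmxB// ?E1 ?E2 ?subrr//.
move=> a b; have := mmoment_mull (row_mx 1%:M 0 : 'M[R]_(K, p)) ms a b.
by congr moment; apply/funext => w; rewrite psi_beta_mul.
Qed.

(** The sandwich L A L' with L = C (H0+)^-1, using the symmetry of the inverse. The integrands agree
    only almost surely, since [Rplus] contains the regressors and [influence] only z and u. *)
Lemma expect_influence_sqr a b : \int[P]_w (influence (zcen 0%N w) (uvec P M 0%N w) a 0 *
  influence (zcen 0%N w) (uvec P M 0%N w) b 0) = Vdiff P M a b.
Proof.
pose L : 'M[R]_(K, p + K) := Cmx *m invmx (H0plus P M).
pose xi w := (Rplus P M 0%N w)^T *m uplus P M 0%N w.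
have mxi : mmoment P 2 xi.
  by apply: mmomentM; [apply: mmoment_tr; exact: moment_Rplus|exact: moment_uplus].
have mxx : mmoment P 1 (fun w => xi w *m (xi w)^T).
  by apply: mmomentM => //; exact: mmoment_tr.
have -> : Vdiff P M = Emx P (fun w => (L *m xi w) *m (L *m xi w)^T).
  rewrite (_ : (fun w => _) = (fun w => L *m (xi w *m (xi w)^T) *m L^T)); last first.
    by apply/funext => w; rewrite trmx_mul !mulmxA.
  rewrite Emx_mulr; last exact: mmoment_mull.
  rewrite Emx_mull// /L trmx_mul H0plus_inv_sym /Vdiff /A0plus !mulmxA.
  congr (_ *m Emx P _ *m _ *m _); apply/funext => w.
  by rewrite /xi trmx_mul trmxK !mulmxA.
rewrite EmxE; apply: Rintegral_ae.
- by apply: measurable_funM; exact: (moment_measurable (moment_influence 0 _ 0)).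
- apply: (mmoment_measurable (k := 1)); apply: mmomentM; first exact: mmoment_mull.
  by apply: mmoment_tr; exact: mmoment_mull.
- by apply: filterS regr_in_span_ae => w gw; rewrite [RHS]mxE big_ord1 [X in _ = _ * X]mxE -!influenceE.
Qed.

End population.

(** * Demeaned samples *)

Section centering.
Context {R : realType}.
Variable n : nat.
Hypothesis n_gt0 : (0 < n)%N.

(** [demean] along a fixed sample path, for an arbitrary sequence of matrices, so that linear maps
    pass through it. *)
Definition center a b (A : nat -> 'M[R]_(a, b)) (i : nat) : 'M[R]_(a, b) :=
  A i - n%:R^-1 *: \sum_(j < n) A j.

Let n0 : (n%:R : R) != 0. Proof. by rewrite pnatr_eq0 -lt0n. Qed.

Lemma centerD_cst a b (A : nat -> 'M[R]_(a, b)) C i :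
  center (fun j => A j + C) i = center A i.
Proof.
rewrite /center big_split /= sumr_const card_ord scalerDr -[C *+ n]scaler_nat.
by rewrite scalerA mulVf// scale1r opprD addrACA subrr addr0.
Qed.

Lemma center_linear a b a' b' (f : {linear 'M[R]_(a, b) -> 'M[R]_(a', b')}) A i :
  center (fun j => f (A j)) i = f (center A i).
Proof. by rewrite /center [RHS]linearB /= [in RHS]linearZ /= [in RHS]linear_sum. Qed.

Lemma centerD a b (A B : nat -> 'M[R]_(a, b)) i :
  center (fun j => A j + B j) i = center A i + center B i.
Proof. by rewrite /center big_split /= scalerDr opprD addrACA. Qed.

Lemma sum_center_mul a b c (A : nat -> 'M[R]_(a, b)) (B : nat -> 'M[R]_(b, c)) :
  n%:R^-1 *: (\sum_(i < n) center A i *m center B i) =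
  n%:R^-1 *: (\sum_(i < n) A i *m B i) -
  (n%:R^-1 *: \sum_(i < n) A i) *m (n%:R^-1 *: \sum_(i < n) B i).
Proof.
set x := n%:R^-1 *: \sum_(i < n) A i; set y := n%:R^-1 *: \sum_(i < n) B i.
have sA : \sum_(i < n) A i = n%:R *: x by rewrite /x scalerA mulfV// scale1r.
have sB : \sum_(i < n) B i = n%:R *: y by rewrite /y scalerA mulfV// scale1r.
have cA i : center A i = A i - x by []; have cB i : center B i = B i - y by [].
clearbody x y; have -> : \sum_(i < n) center A i *m center B i =
    \sum_(i < n) A i *m B i - n%:R *: (x *m y).
  transitivity (\sum_(i < n) (A i *m B i - A i *m y - x *m B i + x *m y)).
    by apply: eq_bigr => i _; rewrite cA cB mulmxBl !mulmxBr opprB addrA addrAC.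
  rewrite !(sumrB, big_split) /= -mulmx_suml -mulmx_sumr sA sB sumr_const card_ord.
  by rewrite -!scalemxAl -!scalemxAr -[(x *m y) *+ n]scaler_nat subrK.
by rewrite scalerBr [X in _ - X]scalerA mulVf// scale1r.
Qed.

Lemma mean_norm_le a b (A : nat -> 'M[R]_(a, b)) (c : R) : 0 <= c ->
  (forall i j, `|\sum_(k < n) A k i j| <= c * Num.sqrt n%:R) ->
  `|n%:R^-1 *: \sum_(k < n) A k| <= c * (Num.sqrt n%:R)^-1.
Proof.
move=> c0 h; have s0 : 0 < Num.sqrt (n%:R : R) by rewrite sqrtr_gt0 ltr0n.
apply: mx_norm_le => [|i j]; first by rewrite mulr_ge0// invr_ge0 ltW.
rewrite mxE summxE normrM ger0_norm ?invr_ge0//.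
apply: (le_trans (ler_wpM2l _ (h i j))); first by rewrite invr_ge0.
have e : (n%:R : R) = (Num.sqrt n%:R) ^+ 2 by rewrite sqr_sqrtr.
rewrite {1}e; move: (Num.sqrt n%:R) s0 => r r0.
by rewrite le_eqVlt; apply/orP; left; apply/eqP; field; rewrite gt_eqF.
Qed.

End centering.

Lemma col_outer (R : realType) a b (v : 'cV[R]_a) (x : 'cV[R]_b) t :
  col t (v *m x^T) = x t 0 *: v.
Proof. by apply/matrixP => i j; rewrite ord1 !mxE big_ord1 mxE mulrC. Qed.

Section sample.
Context {R : realType} {T1 K m : nat}.
Local Notation T := (1 + T1)%N.
Local Notation p := (K + (m + T1))%N.
Variables (S : 'I_T -> 'M[R]_(m, K)) (b0 : 'cV[R]_K) (th0 : 'cV[R]_m) (l0 : 'cV[R]_T1).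
Variable Sg : 'M[R]_m.
Variable n : nat.
Hypothesis n_gt0 : (0 < n)%N.
Variables (z : nat -> 'cV[R]_m) (u : nat -> 'cV[R]_T).

Local Notation ps0 := (col_mx b0 (col_mx th0 l0)).
Local Notation Q := (@Qmx R T1).
Local Notation zd := (center n z).
Local Notation ud := (center n u).

Definition Zhat : 'M[R]_m := n%:R^-1 *: \sum_(i < n) zd i *m (zd i)^T.
Definition ghat : 'M[R]_(m, T) := n%:R^-1 *: \sum_(i < n) zd i *m (ud i)^T.

Let n0 : (n%:R : R) != 0. Proof. by rewrite pnatr_eq0 -lt0n. Qed.

(** Expanding the square: the terms in u alone are free of psi, the squares of z' dpi give half the
    form [Zhat], and the cross terms give [ghat]. *)
Lemma crit_objective (psi : 'cV[R]_p) :
  (2 * n%:R)^-1 * (\sum_(i < n) \sum_t (ud i t 0 - ((zd i)^T *m dpi S b0 th0 l0 t psi) 0 0) ^+ 2) =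
  (2 * n%:R)^-1 * (\sum_(i < n) \sum_t ud i t 0 ^+ 2) +
  crit S b0 th0 l0 Zhat (fun t => col t ghat) psi.
Proof.
have sq (x v : 'cV[R]_m) : (x^T *m (v *m v^T) *m x) 0 0 = (v^T *m x) 0 0 ^+ 2.
  have -> : x^T *m (v *m v^T) *m x = (v^T *m x)^T *m (v^T *m x).
    by rewrite trmx_mul trmxK !mulmxA.
  by move: (v^T *m x) => a; rewrite mxE big_ord1 mxE.
have dotC (x v : 'cV[R]_m) : (x^T *m v) 0 0 = (v^T *m x) 0 0.
  by rewrite -[v^T *m x]trmxK trmx_mul trmxK [RHS]mxE.
have Zb (x : 'cV[R]_m) : bil Zhat x x = n%:R^-1 * \sum_(i < n) ((zd i)^T *m x) 0 0 ^+ 2.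
  rewrite /bil /Zhat -scalemxAr -scalemxAl mxE mulmx_sumr mulmx_suml summxE; congr (_ * _).
  by apply: eq_bigr => i _; exact: sq.
have Gb (x : 'cV[R]_m) t : (x^T *m col t ghat) 0 0 =
    n%:R^-1 * \sum_(i < n) ud i t 0 * ((zd i)^T *m x) 0 0.
  rewrite /ghat !linearZ /= mxE !linear_sum /= summxE; congr (_ * _).
  by apply: eq_bigr => i _; rewrite col_outer -scalemxAr [LHS]mxE dotC.
rewrite /crit exchange_big /= [X in _ = _ * X + _]exchange_big /=.
rewrite !mulr_sumr -big_split /=; apply: eq_bigr => t _.
rewrite Zb Gb invfM; set x := dpi _ _ _ _ _ _.
transitivity (2^-1 * (n%:R^-1 * (\sum_(i < n) ud i t 0 ^+ 2 +
  \sum_(i < n) ((zd i)^T *m x) 0 0 ^+ 2 -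
  2 * \sum_(i < n) ud i t 0 * ((zd i)^T *m x) 0 0))); last by field.
rewrite -mulrA; congr (_ * (_ * _)); rewrite mulr_sumr -big_split -sumrB /=.
by apply: eq_bigr => i _; ring.
Qed.

Lemma Zhat_sum : Zhat = n%:R^-1 *: (\sum_(i < n) z i *m (z i)^T) -
  (n%:R^-1 *: \sum_(i < n) z i) *m (n%:R^-1 *: \sum_(i < n) z i)^T.
Proof.
have E i : (zd i)^T = center n (fun j => (z j)^T) i by rewrite (center_linear n (@trmx R m 1)).
rewrite /Zhat; under eq_bigr do rewrite E.
by rewrite sum_center_mul// [in RHS]linearZ /= [in RHS](linear_sum (@trmx R m 1)).
Qed.

Lemma Zhat_center : Zhat - Sg =
  n%:R^-1 *: (\sum_(i < n) (z i *m (z i)^T - Sg)) -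
  (n%:R^-1 *: \sum_(i < n) z i) *m (n%:R^-1 *: \sum_(i < n) z i)^T.
Proof.
rewrite Zhat_sum sumrB sumr_const card_ord scalerBr -[Sg *+ n]scaler_nat.
by rewrite [X in _ = _ - X - _]scalerA mulVf// scale1r addrAC.
Qed.

Lemma ghat_center : ghat = n%:R^-1 *: (\sum_(i < n) z i *m (u i)^T) -
  (n%:R^-1 *: \sum_(i < n) z i) *m (n%:R^-1 *: \sum_(i < n) u i)^T.
Proof.
have E i : (ud i)^T = center n (fun j => (u j)^T) i by rewrite (center_linear n (@trmx R T 1)).
rewrite /ghat; under eq_bigr do rewrite E.
by rewrite sum_center_mul// [in RHS]linearZ /= [in RHS](linear_sum (@trmx R T 1)).
Qed.

Lemma within_scoreD D D' g g' : within_score S Q th0 l0 D g + within_score S Q th0 l0 D' g' =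
  within_score S Q th0 l0 (D + D') (fun t => g t + g' t).
Proof.
rewrite /within_score -big_split; apply: eq_bigr => s _ /=.
rewrite -big_split; apply: eq_bigr => t _ /=.
by rewrite -scalerDr -mulmxDr addrACA -scalerDr -mulmxDl.
Qed.

Lemma within_scoreZ c D g : c *: within_score S Q th0 l0 D g =
  within_score S Q th0 l0 (c *: D) (fun t => c *: g t).
Proof.
rewrite /within_score scaler_sumr; apply: eq_bigr => s _ /=.
rewrite scaler_sumr; apply: eq_bigr => t _ /=.
rewrite -scalemxAl [_ *: (c *: (D *m th0))]scalerA [_ * c]mulrC -[(c * _) *: _]scalerA.
by rewrite -scalerDr -scalemxAr !scalerA mulrC.
Qed.

Lemma scoreD g g' : score S th0 l0 g + score S th0 l0 g' = score S th0 l0 (fun t => g t + g' t).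
Proof. by rewrite /score -big_split; apply: eq_bigr => t _; rewrite mulmxDr. Qed.

Lemma scoreZ c g : c *: score S th0 l0 g = score S th0 l0 (fun t => c *: g t).
Proof. by rewrite /score scaler_sumr; apply: eq_bigr => t _; rewrite scalemxAr. Qed.

Lemma diff_linD D D' g g' : diff_lin S Q th0 l0 Sg D g + diff_lin S Q th0 l0 Sg D' g' =
  diff_lin S Q th0 l0 Sg (D + D') (fun t => g t + g' t).
Proof.
rewrite /diff_lin addrACA -opprD -mulmxDr within_scoreD; congr (_ - _).
by rewrite -scoreD mulmxDr /psi_beta linearD.
Qed.

Lemma diff_linZ c D g : c *: diff_lin S Q th0 l0 Sg D g =
  diff_lin S Q th0 l0 Sg (c *: D) (fun t => c *: g t).
Proof.
rewrite /diff_lin scalerBr -within_scoreZ -scoreZ -!scalemxAr; congr (_ - _).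
by rewrite /psi_beta linearZ.
Qed.

Lemma diff_lin_sum (D : nat -> 'M[R]_m) (G : nat -> 'M[R]_(m, T)) :
  \sum_(i < n) diff_lin S Q th0 l0 Sg (D i) (fun t => col t (G i)) =
  diff_lin S Q th0 l0 Sg (\sum_(i < n) D i) (fun t => col t (\sum_(i < n) G i)).
Proof.
elim: n => [|k IH]; last first.
  rewrite !big_ord_recr /= IH diff_linD; congr diff_lin; apply/funext => t.
  by rewrite linearD.
rewrite !big_ord0; have := diff_linZ 0 0 (fun t => col t (0 : 'M[R]_(m, T))).
rewrite scale0r => ->; rewrite scaler0; congr diff_lin; apply/funext => t.
by rewrite scale0r linear0.
Qed.

Hypothesis score_Sg : within_score S Q th0 l0 Sg (fun=> 0) = 0.

Lemma diff_lin_Sg : diff_lin S Q th0 l0 Sg Sg (fun=> 0) = 0.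
Proof.
rewrite /diff_lin score_Sg mulmx0 subr0 /score big1 ?mulmx0 /psi_beta ?linear0//.
by move=> t _; rewrite mulmx0.
Qed.

(** [diff_lin] is linear and vanishes at ([Sg], 0) by the population within equation. Only the
    effect of demeaning is left, a product of two sample means. *)
Lemma diff_lin_hat :
  n%:R^-1 *: (\sum_(i < n) diff_lin S Q th0 l0 Sg (z i *m (z i)^T) (fun t => u i t 0 *: z i)) -
  diff_lin S Q th0 l0 Sg (Zhat - Sg) (fun t => col t ghat) =
  diff_lin S Q th0 l0 Sg ((n%:R^-1 *: \sum_(i < n) z i) *m (n%:R^-1 *: \sum_(i < n) z i)^T)
    (fun t => col t ((n%:R^-1 *: \sum_(i < n) z i) *m (n%:R^-1 *: \sum_(i < n) u i)^T)).
Proof.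
have E (i : 'I_n) : diff_lin S Q th0 l0 Sg (z i *m (z i)^T) (fun t => u i t 0 *: z i) =
    diff_lin S Q th0 l0 Sg (z i *m (z i)^T) (fun t => col t (z i *m (u i)^T)).
  by congr diff_lin; apply/funext => t; rewrite col_outer.
under eq_bigr do rewrite E.
rewrite (diff_lin_sum (fun i => z i *m (z i)^T) (fun i => z i *m (u i)^T)) diff_linZ.
rewrite -[LHS]addr0 -[X in _ + X](scaler0 _ (-1)) -{1}diff_lin_Sg -scaleN1r.
rewrite !diff_linZ !diff_linD.
set x := (X in diff_lin S Q th0 l0 Sg X _ = diff_lin _ _ _ _ _ _ _).
have -> : x = (n%:R^-1 *: \sum_(i < n) z i) *m (n%:R^-1 *: \sum_(i < n) z i)^T.
  rewrite /x Zhat_sum !scaleN1r !opprB; move: (_ *: _) (_ *m _) => A B.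
  by apply/matrixP => i j; rewrite !mxE; ring.
congr diff_lin; apply/funext => t; rewrite scaler0 addr0 ghat_center.
rewrite -linearZ /= -linearZ /= -linearD /=; congr col.
by rewrite scaleN1r opprB addrCA subrr addr0.
Qed.

Section sample_bounds.
Variable c : R.
Hypothesis c_ge0 : 0 <= c.
Hypothesis bz : forall a, `|\sum_(j < n) z j a 0| <= c * Num.sqrt n%:R.
Hypothesis bu : forall t, `|\sum_(j < n) u j t 0| <= c * Num.sqrt n%:R.
Hypothesis bzz : forall a b,
  `|\sum_(j < n) (z j *m (z j)^T - Sg) a b| <= c * Num.sqrt n%:R.
Hypothesis bzu : forall a t, `|\sum_(j < n) (z j *m (u j)^T) a t| <= c * Num.sqrt n%:R.

Local Notation r := ((Num.sqrt n%:R)^-1 : R).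
Local Notation zm := (n%:R^-1 *: \sum_(i < n) z i).
Local Notation um := (n%:R^-1 *: \sum_(i < n) u i).

Let r_gt0 : 0 < r. Proof. by rewrite invr_gt0 sqrtr_gt0 ltr0n. Qed.

Let r_le1 : r <= 1.
Proof. by rewrite invf_le1 ?sqrtr_gt0 ?ltr0n// -[leLHS]sqrtr1 ler_wsqrtr// ler1n. Qed.

Let zm_le : `|zm| <= c * r.
Proof. by apply: mean_norm_le => // i j; rewrite ord1; exact: bz. Qed.

Let um_le : `|um| <= c * r.
Proof. by apply: mean_norm_le => // i j; rewrite ord1; exact: bu. Qed.

Let outer_le k (v : 'cV[R]_k) : `|v| <= c * r -> `|zm *m v^T| <= c ^+ 2 * r ^+ 2.
Proof.
move=> vr; apply: (le_trans (mulmx_norm_le _ _)); rewrite mul1r trmx_norm -exprMn expr2.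
exact: ler_pM.
Qed.

Let rr_le : c ^+ 2 * r ^+ 2 <= c ^+ 2 * r.
Proof. by apply: ler_wpM2l; [exact: sqr_ge0|rewrite expr2 ler_piMl// ltW]. Qed.

(** c comes from the i.i.d. mean, c^2 from the product of two sample means, with r^2 <= r. *)
Lemma Zhat_le : `|Zhat - Sg| <= (c + c ^+ 2) * r.
Proof.
rewrite Zhat_center mulrDl; apply: (le_trans (ler_normB _ _)); apply: lerD.
  exact: (@mean_norm_le R n n_gt0 m m (fun i => z i *m (z i)^T - Sg)).
exact: (le_trans (outer_le zm_le)).
Qed.

Lemma ghat_le t : `|col t ghat| <= (c + c ^+ 2) * r.
Proof.
apply: (@le_trans _ _ `|ghat|).
  by apply: mx_norm_le => // i j; rewrite mxE mx_entry_le.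
rewrite ghat_center mulrDl; apply: (le_trans (ler_normB _ _)); apply: lerD.
  exact: (@mean_norm_le R n n_gt0 m T (fun i => z i *m (u i)^T)).
exact: (le_trans (outer_le um_le)).
Qed.

Lemma diff_lin_hat_le C :
  (forall (D : 'M[R]_m) g k, 0 <= k -> `|D| <= k -> (forall t, `|g t : 'cV[R]_m| <= k) ->
    `|diff_lin S Q th0 l0 Sg D g| <= C * k) ->
  `|n%:R^-1 *: (\sum_(i < n) diff_lin S Q th0 l0 Sg (z i *m (z i)^T) (fun t => u i t 0 *: z i)) -
    diff_lin S Q th0 l0 Sg (Zhat - Sg) (fun t => col t ghat)| <= C * (c ^+ 2 * r ^+ 2).
Proof.
move=> hC; rewrite diff_lin_hat; apply: hC.
- by rewrite mulr_ge0// exprn_ge0// ltW.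
- exact: outer_le.
move=> t; apply: (le_trans _ (outer_le um_le)).
by apply: mx_norm_le => // i j; rewrite mxE mx_entry_le.
Qed.

End sample_bounds.

End sample.

(** * Both estimators in terms of the demeaned sample moments *)

Section sample_panel.
Context {d : measure_display} {Omega : measurableType d} {R : realType}.
Context {T1 K m : nat}.
Local Notation T := (1 + T1)%N.
Local Notation p := (K + (m + T1))%N.
Variables (P : probability Omega R) (M : panel Omega R T1 K m).
Variables (S : 'I_T -> 'M[R]_(m, K)) (n : nat) (w : Omega).
Hypothesis n_gt0 : (0 < n)%N.
Hypothesis gw : regr_in_span P M S w.
Hypothesis outcomeE : forall i, ystar P M i w - Xstar P M i w *m beta0 M =
  ((zcen P M i w)^T *m theta0 P M) 0 0 *: Lambda0 M + uvec P M i w.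
Local Notation Sg := (Varmx P (zvec M 0%N)).
Local Notation th0 := (theta0 P M).
Local Notation l0 := (lambda0 M).
Hypothesis score_Sg : within_score S Qmx th0 l0 Sg (fun=> 0) = 0.
Local Notation z := (fun i => zcen P M i w).
Local Notation u := (fun i => uvec P M i w).
Local Notation zd := (center n z).
Local Notation ud := (center n u).
Local Notation Zh := (Zhat n z).
Local Notation Gh := (ghat n z u).

Let n0 : (n%:R : R) != 0. Proof. by rewrite pnatr_eq0 -lt0n. Qed.

Lemma demean_zvec i : demean n (zvec M) i w = zd i.
Proof. exact/esym/(@centerD_cst R n n_gt0). Qed.

Lemma center_xlin (v : nat -> 'cV[R]_m) i :
  center n (fun j => xlin S (v j)) i = xlin S (center n v i).
Proof.
apply/row_matrixP => t; rewrite row_xlin -(center_linear n (@row R T K t)) /=.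
rewrite (_ : (fun j => _) = (fun j => mulmxr (S t) (v j)^T)); last first.
  by apply/funext => j; rewrite row_xlin.
rewrite (center_linear n (mulmxr (S t)) (fun j => (v j)^T)) /=.
by rewrite (center_linear n (@trmx R m 1)).
Qed.

Lemma center_Xstar i : center n (fun j => Xstar P M j w) i = xlin S (zd i).
Proof. by rewrite -center_xlin; congr center; apply/funext => j; exact: gw. Qed.

Lemma demean_regr i : demean n (regr M) i w = xlin S (zd i).
Proof. by rewrite -center_Xstar; exact/esym/(@centerD_cst R n n_gt0). Qed.

Lemma demean_outcome i : demean n (outcome M) i w =
  xlin S (zd i) *m beta0 M + Lambda0 M *m ((zd i)^T *m th0) + ud i.
Proof.
transitivity (center n (fun j => ystar P M j w) i); first exact/esym/(@centerD_cst R n n_gt0).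
have -> : (fun j => ystar P M j w) = (fun j => Xstar P M j w *m beta0 M +
    Lambda0 M *m ((zcen P M j w)^T *m th0) + uvec P M j w).
  apply/funext => j; have h := outcomeE j.
  have -> : ystar P M j w = Xstar P M j w *m beta0 M +
      (ystar P M j w - Xstar P M j w *m beta0 M) by rewrite addrC subrK.
  rewrite h [RHS](esym (addrA _ _ _)); congr (_ + (_ + _)).
  by rewrite [X in _ = _ *m X]mx11_scalar mul_mx_scalar.
rewrite centerD centerD (center_linear n (mulmxr (beta0 M))) /= center_Xstar.
rewrite (center_linear n (mulmx (Lambda0 M)) (fun j => (zcen P M j w)^T *m th0)) /=.
rewrite (center_linear n (mulmxr th0) (fun j => (zcen P M j w)^T)) /=.
by rewrite (center_linear n (@trmx R m 1)).
Qed.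

Lemma xlin_mul t (v : 'cV[R]_m) (b : 'cV[R]_K) :
  (xlin S v *m b) t 0 = (v^T *m (S t *m b)) 0 0.
Proof.
rewrite mulmxA -row_xlin -row_mul; set x := xlin S v *m b.
by rewrite [RHS]mxE.
Qed.

Lemma col_mul11 (v : 'cV[R]_T) (x : 'M[R]_1) t : (v *m x) t 0 = v t 0 * x 0 0.
Proof. by rewrite mxE big_ord1. Qed.

Lemma objective_crit psi : objective M n w psi =
  (2 * n%:R)^-1 * (\sum_(i < n) \sum_t ud i t 0 ^+ 2) +
  crit S (beta0 M) th0 l0 Zh (fun t => col t Gh) psi.
Proof.
rewrite -crit_objective// /objective; congr (_ * _); apply: eq_bigr => i _.
rewrite /sqnorm; apply: eq_bigr => t _; congr (_ ^+ 2).
rewrite demean_outcome demean_regr demean_zvec.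
rewrite /dpi /pi_t mulmxBr !mulmxDr -!scalemxAr.
have -> : psi_beta (col_mx (beta0 M) (col_mx th0 l0)) = beta0 M by rewrite /psi_beta col_mxKu.
have -> : psi_theta (col_mx (beta0 M) (col_mx th0 l0)) = th0 by rewrite /psi_theta col_mxKd col_mxKu.
have -> : psi_lambda (col_mx (beta0 M) (col_mx th0 l0)) = l0 by rewrite /psi_lambda !col_mxKd.
have addE (A B : 'cV[R]_T) : (A + B) t 0 = A t 0 + B t 0 by rewrite mxE.
have subE (A B : 'cV[R]_T) : (A - B) t 0 = A t 0 - B t 0 by rewrite !mxE.
have addE1 (A B : 'M[R]_1) : (A + B) 0 0 = A 0 0 + B 0 0 by rewrite mxE.
have subE1 (A B : 'M[R]_1) : (A - B) 0 0 = A 0 0 - B 0 0 by rewrite !mxE.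
have sE1 c (A : 'M[R]_1) : (c *: A) 0 0 = c * A 0 0 by rewrite !mxE.
rewrite !(subE, addE) !xlin_mul !col_mul11 !(subE1, addE1, sE1) /Lambda0.
ring.
Qed.

Lemma within_score_sum k (D : nat -> 'M[R]_m) (G : nat -> 'M[R]_(m, T)) :
  \sum_(i < k) within_score S Qmx th0 l0 (D i) (fun t => col t (G i)) =
  within_score S Qmx th0 l0 (\sum_(i < k) D i) (fun t => col t (\sum_(i < k) G i)).
Proof.
elim: k => [|k IH]; last first.
  rewrite !big_ord_recr /= IH within_scoreD; congr within_score; apply/funext => t.
  by rewrite linearD.
rewrite !big_ord0; have := within_scoreZ S th0 l0 0 0 (fun t => col t (0 : 'M[R]_(m, T))).
rewrite scale0r => ->; rewrite scaler0; congr within_score; apply/funext => t.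
by rewrite scale0r linear0.
Qed.

Lemma within_gram : \sum_(i < n) (demean n (regr M) i w)^T *m Qmx *m demean n (regr M) i w =
  n%:R *: within_mx S Qmx Zh.
Proof.
have -> : within_mx S Qmx Zh = n%:R^-1 *: within_mx S Qmx (\sum_(i < n) zd i *m (zd i)^T).
  rewrite /within_mx scaler_sumr; apply: eq_bigr => s _; rewrite scaler_sumr.
  apply: eq_bigr => t _; rewrite scalerA mulrC -scalerA; congr (_ *: _).
  by rewrite /Zhat -scalemxAr -scalemxAl.
rewrite scalerA mulfV// scale1r /within_mx exchange_big /=.
under eq_bigr do rewrite demean_regr xlin_within.
rewrite exchange_big /= [RHS]exchange_big /=; apply: eq_bigr => s _.
rewrite exchange_big /=; apply: eq_bigr => t _.
by rewrite -scaler_sumr mulmx_sumr mulmx_suml.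
Qed.

Lemma within_cross : \sum_(i < n) (demean n (regr M) i w)^T *m Qmx *m demean n (outcome M) i w =
  n%:R *: (within_mx S Qmx Zh *m beta0 M +
    within_score S Qmx th0 l0 (Zh - Sg) (fun t => col t Gh)).
Proof.
(* The population value of the within score is zero, so subtracting [Sg] leaves the score
   unchanged. *)
have -> : within_score S Qmx th0 l0 (Zh - Sg) (fun t => col t Gh) =
    within_score S Qmx th0 l0 Zh (fun t => col t Gh).
  rewrite -[LHS]addr0 -score_Sg within_scoreD subrK; congr within_score.
  by apply/funext => t; rewrite addr0.
have -> : within_score S Qmx th0 l0 Zh (fun t => col t Gh) = n%:R^-1 *:
  \sum_(i < n) within_score S Qmx th0 l0 (zd i *m (zd i)^T) (fun t => col t (zd i *m (ud i)^T)).
  rewrite (within_score_sum n (fun i => zd i *m (zd i)^T) (fun i => zd i *m (ud i)^T)).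
  by rewrite within_scoreZ; congr within_score; apply/funext => t; rewrite linearZ.
rewrite scalerDr [X in _ = _ + X]scalerA mulfV// scale1r scalemxAl -within_gram mulmx_suml.
rewrite -big_split; apply: eq_bigr => i _ /=.
rewrite demean_outcome demean_regr -[X in _ *m X]addrA mulmxDr mulmxA; congr (_ + _).
rewrite trmul_rows_weighted /within_score; apply: eq_bigr => s _; apply: eq_bigr => t _.
congr (_ *: _); rewrite row_xlin trmx_mul trmxK -[LHS]mulmxA; congr (_ *m _).
rewrite col_outer -[zd i *m _ *m th0]mulmxA [X in zd i *m X]mx11_scalar mul_mx_scalar.
rewrite [X in _ = _ *: (_ *m X) + _]mx11_scalar mul_mx_scalar scalerA -scalerDl.
by congr (_ *: _); rewrite mxE [LHS]mxE col_mul11.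
Qed.

Lemma beta_FE_hat : within_mx S Qmx Zh \in unitmx -> beta_FE M n w =
  beta0 M + invmx (within_mx S Qmx Zh) *m
    within_score S Qmx th0 l0 (Zh - Sg) (fun t => col t Gh).
Proof.
move=> uW; rewrite /beta_FE within_gram within_cross invmxZ; last first.
  by rewrite unitmxZ// unitfE.
by rewrite -scalemxAl -scalemxAr scalerA mulVf// scale1r mulmxDr mulKmx.
Qed.

End sample_panel.

(** * Statistics as measurable functions of i.i.d. tuples *)

Section vvec_functions.
Context {d : measure_display} {Omega : measurableType d} {R : realType}.
Context {T1 K m : nat}.
Local Notation T := (1 + T1)%N.
Local Notation q := (m + (1 + T))%N.
Variables (P : probability Omega R) (M : panel Omega R T1 K m).
Variable S : 'I_T -> 'M[R]_(m, K).
Local Notation Sg := (Varmx P (zvec M 0%N)).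

(** Independence and equality of laws are stated for Borel sets of tuples, so the summands must be
    measurable functions of this tuple. *)
Definition vtuple (i : nat) (w : Omega) : q.-tuple R := tuple_of_cV (vvec P M i w).

Definition tuple_z (x : q.-tuple R) : 'cV[R]_m :=
  \col_j tnth x (lshift (1 + T) j) - Emx P (zvec M 0%N).

Definition tuple_u (x : q.-tuple R) : 'cV[R]_T :=
  tnth x (rshift m (lshift T 0)) *: Lambda0 M + \col_t tnth x (rshift m (rshift 1 t)).

Lemma tuple_zE i w : tuple_z (vtuple i w) = zcen P M i w.
Proof.
rewrite /tuple_z /zcen; congr (_ - _); apply/matrixP => a b.
by rewrite ord1 mxE tnth_mktuple /vvec col_mxEu.
Qed.

Lemma tuple_uE i w : tuple_u (vtuple i w) = uvec P M i w.
Proof.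
rewrite /tuple_u /uvec; congr (_ *: _ + _).
  by rewrite tnth_mktuple /vvec col_mxEd col_mxEu mxE mulr1n.
by apply/matrixP => a b; rewrite ord1 mxE tnth_mktuple /vvec !col_mxEd.
Qed.

Lemma measurable_tuple_z : measurable_mx tuple_z.
Proof.
apply: measurable_mxB; last exact: measurable_mx_cst.
by move=> a b; under eq_fun do rewrite mxE; exact: measurable_tnth.
Qed.

Lemma measurable_tuple_u : measurable_mx tuple_u.
Proof.
apply: measurable_mxD.
  by apply: measurable_mxZ; [exact: measurable_tnth|exact: measurable_mx_cst].
by move=> a b; under eq_fun do rewrite mxE; exact: measurable_tnth.
Qed.

Definition tuple_influence (x : q.-tuple R) : 'cV[R]_K := influence P M S (tuple_z x) (tuple_u x).

Lemma measurable_tuple_influence : measurable_mx tuple_influence.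
Proof.
have mz := measurable_tuple_z; have mu := measurable_tuple_u.
have muz t : measurable_mx (fun x => tuple_u x t 0 *: tuple_z x) by exact: measurable_mxZ.
have mcst a b (C : 'M[R]_(a, b)) : measurable_mx (fun _ : q.-tuple R => C) by exact: measurable_mx_cst.
apply: measurable_mxB.
  move=> a b; have := @measurable_mxM _ _ _ _ _ _ _ _ (mcst _ _ (invmx (hess S (theta0 P M) (lambda0 M) Sg)))
    (@measurable_mx_sum _ _ _ _ (index_enum 'I_T) _ _ _ (fun t =>
      measurable_mxM (mcst _ _ (jac S (theta0 P M) (lambda0 M) t)^T) (muz t))) (lshift _ a) b.
  by congr measurable_fun; apply/funext => x; rewrite [RHS]mxE.
apply: measurable_mxM => //; apply: measurable_mx_sum => s; apply: measurable_mx_sum => t.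
apply: measurable_mxZ => //; apply: measurable_mxM => //; apply: measurable_mxD => //.
apply: measurable_mxZ => //; apply: measurable_mxM => //; apply: measurable_mxM => //.
exact: measurable_mx_tr.
Qed.

(* The centred functions whose sample means control the fluctuations of the
   demeaned second moments. *)
Definition fluctuation (k : ('I_m + 'I_T) + ('I_m * 'I_m + 'I_m * 'I_T)) (x : q.-tuple R) : R :=
  match k with
  | inl (inl j) => tuple_z x j 0
  | inl (inr t) => tuple_u x t 0
  | inr (inl (a, b)) => (tuple_z x *m (tuple_z x)^T - Sg) a b
  | inr (inr (a, t)) => (tuple_z x *m (tuple_u x)^T) a t
  end.

Lemma measurable_fluctuation k : measurable_fun setT (fluctuation k).
Proof.
have mz := measurable_tuple_z; have mu := measurable_tuple_u.
case: k => [[j|t]|[[a b]|[a t]]] /=; [exact: mz|exact: mu| |].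
  apply: (measurable_mxB (B := fun=> Sg)); last exact: measurable_mx_cst.
  by apply: measurable_mxM => //; exact: measurable_mx_tr.
by apply: measurable_mxM => //; exact: measurable_mx_tr.
Qed.

Hypothesis mz4 : mmoment P 4 (zcen P M 0%N).
Hypothesis mu4 : mmoment P 4 (uvec P M 0%N).

Lemma moment_fluctuation k : moment P 2 (fun w => fluctuation k (vtuple 0%N w)).
Proof.
case: k => [[j|t]|[[a b]|[a t]]] /=.
- by under eq_fun do rewrite tuple_zE; exact: moment_leq (mz4 j 0).
- by under eq_fun do rewrite tuple_uE; exact: moment_leq (mu4 t 0).
- under eq_fun do rewrite tuple_zE.
  apply: mmomentB; last exact: mmoment_cst.
  by apply: mmomentM => //; exact: mmoment_tr.
- under eq_fun do rewrite tuple_zE tuple_uE.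
  by apply: mmomentM => //; exact: mmoment_tr.
Qed.

Hypothesis Ez : Emx P (zcen P M 0%N) = 0.
Hypothesis Eu : forall t, \int[P]_w uvec P M 0%N w t 0 = 0.
Hypothesis Ezu : forall t, Emx P (fun w => uvec P M 0%N w t 0 *: zcen P M 0%N w) = 0.

Lemma expect_fluctuation k : \int[P]_w fluctuation k (vtuple 0%N w) = 0.
Proof.
case: k => [[j|t]|[[a b]|[a t]]] /=.
- by under eq_Rintegral do rewrite tuple_zE; rewrite -EmxE Ez mxE.
- by under eq_Rintegral do rewrite tuple_uE; exact: Eu.
- under eq_Rintegral do rewrite tuple_zE.
  have mzz : mmoment P 1 (fun w => zcen P M 0%N w *m (zcen P M 0%N w)^T).
    by apply: mmomentM; [|apply: mmoment_tr]; exact: mmoment_leq mz4.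
  rewrite -(EmxE P (fun w => zcen P M 0%N w *m (zcen P M 0%N w)^T - Sg)).
  rewrite EmxB//; last exact: mmoment_cst.
  by rewrite Emx_cst -Var_zcen subrr mxE.
- under eq_Rintegral do rewrite tuple_zE tuple_uE.
  have := congr1 (fun A : 'cV[R]_m => A a 0) (Ezu t); rewrite EmxE [RHS]mxE => <-.
  by apply: eq_Rintegral => w _; rewrite -col_outer [RHS]mxE.
Qed.

Lemma measurable_vtuple i : measurable_mx (vvec P M i) -> measurable_fun setT (vtuple i).
Proof.
move=> mv; apply/measurable_fun_tnthP => j.
rewrite (_ : _ \o _ = fun w => vvec P M i w j 0); first exact: mv.
by apply/funext => w /=; rewrite tnth_mktuple.
Qed.

End vvec_functions.

Section measurable_statistic.
Context {d : measure_display} {Omega : measurableType d} {R : realType}.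
Context {T1 K m : nat}.
Variables (P : probability Omega R) (M : panel Omega R T1 K m).
Hypothesis mX : forall i, measurable_mx (regr M i).
Hypothesis meff : forall i, measurable_fun [set: Omega] (effect M i).
Hypothesis meps : forall i, measurable_mx (error M i).

Lemma measurable_outcome i : measurable_mx (outcome M i).
Proof.
apply: measurable_mxD => //; apply: measurable_mxD.
  apply: measurable_mxD; last exact: measurable_mx_cst.
  by apply: measurable_mxM => //; exact: measurable_mx_cst.
by apply: measurable_mxZ => //; exact: measurable_mx_cst.
Qed.

Lemma measurable_demean n a b (A : nat -> Omega -> 'M[R]_(a, b)) i :
  (forall j, measurable_mx (A j)) -> measurable_mx (demean n A i).
Proof.
move=> mA; apply: measurable_mxB => //; apply: measurable_mxZ => //.
exact: measurable_mx_sum.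
Qed.

Lemma measurable_beta_FE n : measurable_mx (beta_FE M n).
Proof.
have mXd i : measurable_mx (demean n (regr M) i) by exact: measurable_demean.
have myd i : measurable_mx (demean n (outcome M) i).
  by apply: measurable_demean => j; exact: measurable_outcome.
have mXQ i : measurable_mx (fun w => (demean n (regr M) i w)^T *m Qmx).
  by apply: measurable_mxM; [exact: measurable_mx_tr|exact: measurable_mx_cst].
apply: measurable_mxM; first apply: measurable_invmx.
  by apply: measurable_mx_sum => i; exact: measurable_mxM.
by apply: measurable_mx_sum => i; exact: measurable_mxM.
Qed.

Lemma measurable_vartheta psihat n : measurable_mx (psihat n) ->
  measurable_fun setT (vartheta P M psihat n).
Proof.
move=> mp; pose b w := psi_beta (psihat n w) - beta_FE M n w.
have mb : measurable_mx b.
  apply: measurable_mxB; last exact: measurable_beta_FE.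
  by move=> i j; under eq_fun do rewrite mxE; exact: mp.
apply: measurable_funM => //.
apply: (measurable_mxM (A := fun w => (b w)^T *m invmx (Vdiff P M))) => //.
by apply: measurable_mxM; [exact: measurable_mx_tr|exact: measurable_mx_cst].
Qed.

End measurable_statistic.
Theorem mainTheorem6 (d : measure_display) (Omega : measurableType d)
    (R : realType) (P : probability Omega R) (T1 K m : nat)
    (M : panel Omega R T1 K m)
    (sel : 'I_m -> 'I_(1 + T1) * 'I_K)
    (S : 'I_(1 + T1) -> 'M[R]_(m, K))
    (Psi Psibar : set 'cV[R]_(K + (m + T1)))
    (psihat : nat -> Omega -> 'cV[R]_(K + (m + T1))) :
  (* the model, with T = 1 + T1 >= 2 *)
  (1 <= T1)%N ->
  (forall i, measurable_mx (regr M i)) ->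
  (forall i, measurable_fun [set: Omega] (effect M i)) ->
  (forall i, measurable_mx (error M i)) ->
  phi01 M != 0 ->
  (forall i, 'E_P[effect M i] = 0)%E ->
  (forall i, 'V_P[effect M i] != 0)%E ->
  (forall i (t : 'I_(1 + T1)),
     cond_mean0 P (fun w => error M i w t 0)
       (fun w => col_mx (xvec M t i w)
                   (col_mx (delta0 M t 0)%:M (Phi0 M t 0 * effect M i w)%:M))) ->
  (* z_i consists of entries of X_i, of which all x_it are linear functions,
     up to means *)
  injective sel ->
  (forall i w j, zvec M i w j 0 = regr M i w (sel j).1 (sel j).2) ->
  Emx P (fun w => zvec M 0 w *m (zvec M 0 w)^T) \in unitmx ->
  (forall i (t : 'I_(1 + T1)),
     {ae P, forall w, xvec M t i w - Emx P (xvec M t 0)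
                    = (S t)^T *m (zvec M i w - Emx P (zvec M 0))}) ->
  (* the parameter sets and the estimator *)
  Psi (psi0 P M) ->
  Psibar `<=` Psi ->
  compact Psibar ->
  (Psibar^°) (psi0 P M) ->
  is_estimator M Psibar psihat ->
  (* the inverses in the conclusion exist *)
  Emx P (fun w => (Xstar P M 0 w)^T *m Qmx *m Xstar P M 0 w) \in unitmx ->
  H0plus P M \in unitmx ->
  Vdiff P M \in unitmx ->
  (* (A1) *)
  mutually_independent P (vvec P M) ->
  identically_distributed P (vvec P M) ->
  (* (A2* ) *)
  (forall i j, 'E_P[(fun w => vvec P M i w j 0 ^+ 4)%R] < +oo)%E ->
  (* (A3) *)
  Emx P (fun w => zvec M 0 w *m (error M 0 w)^T) = 0 ->
  (* (A4) *)
  posdefmx (Varmx P (zvec M 0)) ->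
  (* (A5) *)
  (forall psi, Psi psi -> psi != psi0 P M ->
     exists t, pi_t S t psi != pi_t S t (psi0 P M)) ->
  (* (A) or (B) *)
  Lambda0 M = iota_T \/ (exists F, forall t, Phi_x P M t = F) ->
  converges_in_distribution P (vartheta P M psihat) (chi_square K).
Proof.
move=> _ mX meff meps phi0 Eeff Vneq cm _ zsel _ xae Psi0 PsiS cPsi Psi_int est wu H0u Vu.
move=> indV idV v4 zeps zpos A5 AB.
(* The conditional mean assumption, taken on the whole space. *)
have Eeps i t : \int[P]_w error M i w t 0 = 0.
  by have := (cm i t).2 setT measurableT; rewrite /Rintegral => ->.
have mV i : measurable_fun setT (vtuple P M i).
  by apply: measurable_vtuple; exact: (measurable_vvec P mX meff meps zsel).
have sE i w : tuple_influence P M S (vtuple P M i w) =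
    influence P M S (zcen P M i w) (uvec P M i w).
  by rewrite /tuple_influence tuple_zE tuple_uE.
have mz a : measurable_fun setT (fun x => tuple_influence P M S x a 0).
  exact: measurable_tuple_influence.
have z2 a : moment P 2 (fun w => tuple_influence P M S (vtuple P M 0 w) a 0).
  under eq_fun do rewrite sE.
  exact: (moment_influence mX meff meps zsel v4 S 0 a 0).
have z0 a : \int[P]_w tuple_influence P M S (vtuple P M 0 w) a 0 = 0.
  under eq_Rintegral do rewrite sE.
  rewrite -EmxE (expect_influence mX meff meps phi0 Eeff Eeps zsel v4 zeps zpos xae (Vneq 0%N) AB).
  by rewrite mxE.
have zV a b : \int[P]_w (tuple_influence P M S (vtuple P M 0 w) a 0 *
    tuple_influence P M S (vtuple P M 0 w) b 0) = Vdiff P M a b.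
  under eq_Rintegral do rewrite sE.
  exact: (expect_influence_sqr mX meff meps phi0 Eeff Eeps zsel v4 zpos xae H0u).
apply: (@clt_transfer _ _ _ _ _ P (vtuple P M) mV indV idV K (tuple_influence P M S)
  (Vdiff P M) mz z2 z0 zV Vu).
- by move=> n; apply: measurable_vartheta => //; case: (est n).
- by move=> n w; apply: mulr_ge0 => //; exact: (invcov_psd z2 zV Vu).
move=> e dl e0 dl0.
have Ss := Sg_sym zpos; have Su := Sg_unit zpos.
have [kS kS0 coer] := psd_unit_coercive Ss (Sg_psd zpos) Su.
have [C C0 hC] := diff_lin_norm S Qmx (theta0 P M) (lambda0 M) (Varmx P (zvec M 0%N)).
have [v v0 hv] := iid_family_prob mV indV idV (@measurable_fluctuation _ _ _ _ _ _ P M)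
  (moment_fluctuation (moment_zcen mX meff meps zsel v4 0) (moment_uvec mX meff meps zsel v4 0))
  (expect_fluctuation (moment_zcen mX meff meps zsel v4 0)
     (expect_zcen mX meff meps zsel v4)
     (expect_uvec mX meff meps phi0 Eeff Eeps zsel v4)
     (expect_zcen_uvec mX meff meps phi0 Eeff Eeps zsel v4 zeps zpos)).
have v1 : 0 < v + 1 by rewrite ltr_wpDl.
(* Chebyshev gives probability v / c^2, made at most [dl]; v + 1 keeps c positive when v = 0. *)
pose c := Num.sqrt ((v + 1) / dl).
have c0 : 0 < c by rewrite sqrtr_gt0 divr_gt0.
have cv : v / c ^+ 2 <= dl.
  rewrite sqr_sqrtr; last by rewrite ltW// divr_gt0.
  rewrite invf_div mulrA ler_pdivrMr// mulrC; apply: ler_wpM2l; first exact: ltW.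
  by rewrite lerDl.
have c20 : 0 <= c ^+ 2 by exact: sqr_ge0.
(* c + c^2 bounds the deviations of [Zhat] and [ghat], and C c^2 the effect of demeaning on W: one
   constant for all the hypotheses of [diff_expansion]. *)
pose B := c + c ^+ 2 + C * c ^+ 2.
have B0 : 0 < B by apply: ltr_wpDr; [exact: mulr_ge0|exact: ltr_wpDr].
have ident psi : Psibar psi -> psi != psi0 P M ->
    exists t, pi_t S t psi != pi_t S t (psi0 P M).
  by move=> /PsiS; exact: A5.
have [r0 r00 hr] := diff_expansion kS0 coer cPsi ident Ss
  (hess_unit0 mX meff meps zsel v4 xae H0u) Psi_int
  (within_unit0 mX meff meps zsel v4 xae wu) (invcov_sym zV) B0 e0.
(* n > r0^-2 means n^(-1/2) <= r0; the successor makes n positive. *)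
exists (Num.bound (r0 ^- 2)).+1 => n Nn.
have n0 : (0 < n)%N by exact: leq_trans Nn.
have [A [mA PA] hA] := hv n c n0 c0.
have [N [mN PN hN]] := regr_in_span_ae xae.
(* A is the event where a Chebyshev bound fails; N is a null set outside which the centred
   regressors are linear in z. *)
exists (A `|` N).
  split; first exact: measurableU.
  have {}PN : P N = 0%E by exact: PN.
  apply: (le_trans (measureU2 _ mA mN)); rewrite /= PN adde0.
  by apply: (le_trans PA); rewrite lee_fin.
move=> w nAN.
have gw : regr_in_span P M S w.
  by apply: contrapT => ng; apply: nAN; right; apply: hN.
have {}hA k : `|\sum_(j < n) fluctuation P M k (vtuple P M j w)| <= c * Num.sqrt n%:R.
  by apply: hA => Aw; apply: nAN; left.
have sn0 : 0 < Num.sqrt (n%:R : R) by rewrite sqrtr_gt0 ltr0n.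
pose r : R := (Num.sqrt n%:R)^-1.
have rsq : r ^+ 2 = n%:R^-1 by rewrite /r exprVn sqr_sqrtr.
have r_gt0 : 0 < r by rewrite invr_gt0.
have rr0 : r <= r0.
  suff : r ^+ 2 <= r0 ^+ 2 by rewrite ler_pXn2r// nnegrE ltW.
  rewrite rsq -[r0 ^+ 2]invrK.
  rewrite lef_pV2 ?posrE ?invr_gt0 ?exprn_gt0 ?ltr0n//.
  have b0 : 0 <= r0 ^- 2 by rewrite invr_ge0 sqr_ge0.
  apply: (le_trans (ltW (archi_boundP b0))).
  by rewrite ler_nat; exact: leq_trans (leqnSn _) Nn.
pose z i := zcen P M i w; pose u i := uvec P M i w.
have bz a : `|\sum_(j < n) z j a 0| <= c * Num.sqrt n%:R.
  have := hA (inl (inl a)); rewrite /fluctuation.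
  by under eq_bigr do rewrite tuple_zE.
have bu t : `|\sum_(j < n) u j t 0| <= c * Num.sqrt n%:R.
  have := hA (inl (inr t)); rewrite /fluctuation.
  by under eq_bigr do rewrite tuple_uE.
have bzz a b : `|\sum_(j < n) (z j *m (z j)^T - Varmx P (zvec M 0%N)) a b| <= c * Num.sqrt n%:R.
  have := hA (inr (inl (a, b))); rewrite /fluctuation.
  by under eq_bigr do rewrite tuple_zE.
have bzu a t : `|\sum_(j < n) (z j *m (u j)^T) a t| <= c * Num.sqrt n%:R.
  have := hA (inr (inr (a, t))); rewrite /fluctuation.
  by under eq_bigr do rewrite tuple_zE tuple_uE.
have oE i := outcome_center mX meff meps phi0 Eeff Eeps zsel v4 xae i w.
have sSg := within_score_Sg mX meff meps phi0 Eeff zsel v4 zpos xae (Vneq 0%N) AB.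
have objE := objective_crit n0 gw oE.
have [_ /(_ n0 w)[Pps mins]] := est n.
have crit_min psi : Psibar psi ->
    crit S (beta0 M) (theta0 P M) (lambda0 M) (Zhat n z) (fun t => col t (ghat n z u)) (psihat n w) <=
    crit S (beta0 M) (theta0 P M) (lambda0 M) (Zhat n z) (fun t => col t (ghat n z u)) psi.
  by move=> /mins; rewrite !objE lerD2l.
pose W := n%:R^-1 *: psum (vtuple P M) (tuple_influence P M S) n w.
have cB : (c + c ^+ 2) * r <= B * r.
  by apply: ler_wpM2r; [exact: ltW|rewrite lerDl mulr_ge0].
have hZ := le_trans (Zhat_le n0 (ltW c0) bz bzz) cB.
have hG t := le_trans (ghat_le n0 (ltW c0) bz bu bzu t) cB.
have hW : `|W - diff_lin S Qmx (theta0 P M) (lambda0 M) (Varmx P (zvec M 0%N))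
    (Zhat n z - Varmx P (zvec M 0%N)) (fun t => col t (ghat n z u))| <= B * r ^+ 2.
  have -> : W = n%:R^-1 *: \sum_(i < n) influence P M S (z i) (u i).
    by rewrite /W /psum; congr (_ *: _); apply: eq_bigr => i _; rewrite sE.
  apply: (le_trans (diff_lin_hat_le n0 sSg (ltW c0) bz bu hC)).
  rewrite mulrA; apply: ler_wpM2r; first exact: sqr_ge0.
  by rewrite lerDr addr_ge0// ltW.
have rP : 0 < r <= r0 by rewrite r_gt0.
have [uW] := hr r _ _ _ W rP hZ hG Pps crit_min hW.
rewrite -(beta_FE_hat n0 gw oE sSg uW) /vartheta.
have -> : r ^- 2 = n%:R by rewrite rsq invrK.
rewrite /W bilZl bilZr; congr (`|_ - _| <= _).
by rewrite mulVKf// pnatr_eq0 -lt0n.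
Qed.
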